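(* Let $D$ be a $+$-adequate link diagram with $n$ crossings, let $G=G_{s_+}(D)$, and let $G'$ be the simple graph obtained from $G$ by replacing each multiple edge by a single edge. Let $p_1(\cdot)$ denote the cyclomatic number, let $G'^{bi}$ be the union of the bipartite connected components of $G'$, and let $p_0^{nbi}$ be the number of non-bipartite connected components of $G'$. (1) If $G'$ is connected, then $$\mathrm{tor}\,H_{n-4,\,n+2|D_{s_+}|-8}(D)\cong\begin{cases}\mathbb{Z}_2^{p_1(G')-1}, & \text{if } G' \text{ has an odd cycle},\\ \mathbb{Z}_2^{p_1(G')}, & \text{if } G' \text{ is bipartite}.\end{cases}$$ (2) In general, $$\mathrm{tor}\,H_{n-4,\,n+2|D_{s_+}|-8}(D)\cong\mathbb{Z}_2^{\,p_1(G'^{bi})+p_0^{nbi}\,p_1(G')-\binom{p_0^{nbi}+1}{2}}.$$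
   Context: $\mathrm{tor}\,A$ denotes the torsion subgroup of an abelian group $A$; $\mathbb{Z}_2=\mathbb{Z}/2\mathbb{Z}$. The cyclomatic number of a graph with edge set $E$, $v$ vertices and $p_0$ components is $|E|-v+p_0$. Kauffman states. Let $D$ be an unoriented link diagram. A Kauffman state $s$ assigns a marker $+1$ or $-1$ to each crossing; each crossing is smoothed according to its marker ($+1$ gives the $A$-smoothing of the Kauffman bracket, $-1$ the $B$-smoothing). $D_s$ is the resulting system of circles and $|D_s|$ their number. $s_+$ is the state with all markers $+1$. The graph $G_s(D)$ has vertices the circles of $D_s$ and one edge for each crossing of $D$, joining the (possibly equal) circles of $D_s$ meeting at that crossing. $D$ is $+$-adequate if $G_{s_+}(D)$ has no loops. Khovanov homology (Viro's framed version). An enhanced Kauffman state $S$ is a Kauffman state $s$ together with a sign $+$ or $-$ on each circle of $D_s$. Let $\sigma(S)$ be the number of positive markers minus the number of negative markers and $\tau(S)$ the number of positive circles minus the number of negative circles. $\mathcal{C}_{i,j}(D)$ is the free abelian group on the enhanced states with $\sigma(S)=i$ and $\sigma(S)+2\tau(S)=j$. After ordering the crossings, $d:\mathcal{C}_{i,j}(D)\to\mathcal{C}_{i-2,j}(D)$ is $d(S)=\sum_{S'}(-1)^{t(S:S')}[S:S']S'$, where $[S:S']=1$ if $S\in\mathcal{C}_{i,j}$, $S'\in\mathcal{C}_{i-2,j}$, the markers of $S$ and $S'$ differ at exactly one crossing $c$ (so $c$ is positive in $S$, negative in $S'$, and $\tau(S')=\tau(S)+1$) and all circles not touching $c$ have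 the same signs in $S$ and $S'$; $[S:S']=0$ otherwise; $t(S:S')$ is the number of negative markers of $S$ at crossings bigger than $c$. $H_{i,j}(D)$ is the homology of this complex at $\mathcal{C}_{i,j}(D)$. *)

(* Defs.v *)
From HB Require Import structures.
From mathcomp Require Import all_boot all_order all_algebra.
From mathcomp Require Import ring_quotient.
From mathcomp Require Import boolp.

Set Implicit Arguments.
Unset Strict Implicit.
Unset Printing Implicit Defensive.

Import GRing.Theory.

Local Open Scope ring_scope.

(* Abelian groups. *)

Section Torsion.
Variable A : zmodType.

Definition torsion : {pred A} :=
  [pred x : A | `[< exists2 m : nat, (0 < m)%N & x *+ m = 0 >]].

Fact torsion_zmod_closed : zmod_closed torsion.
Proof.
split=> [|x y]; first by apply/asboolP; exists 1%N; rewrite ?mulr1n.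
move=> /asboolP[m m0 xm] /asboolP[k k0 yk]; apply/asboolP.
exists (m * k)%N; first by rewrite muln_gt0 m0.
by rewrite mulrnBl mulrnA xm mul0rn mulnC mulrnA yk mul0rn subr0.
Qed.

Record tor := Tor { tor_val : A; _ : tor_val \in torsion }.

HB.instance Definition _ := [isSub for tor_val].
HB.instance Definition _ := [Choice of tor by <:].
HB.instance Definition _ :=
  GRing.SubChoice_isSubZmodule.Build A torsion tor torsion_zmod_closed.

End Torsion.

Section Kernel.
Variables (A B : zmodType) (g : {additive A -> B}).

Definition kernel : {pred A} := [pred x | g x == 0].

Fact kernel_zmod_closed : zmod_closed kernel.
Proof.
split=> [|x y]; rewrite !inE ?raddf0 // => /eqP gx /eqP gy.
by rewrite raddfB gx gy subr0.
Qed.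

Record ker := Ker { ker_val : A; _ : ker_val \in kernel }.

HB.instance Definition _ := [isSub for ker_val].
HB.instance Definition _ := [Choice of ker by <:].
HB.instance Definition _ :=
  GRing.SubChoice_isSubZmodule.Build A kernel ker kernel_zmod_closed.

End Kernel.

Section Homology.
Variables (A B C : zmodType) (f : {additive A -> B}) (g : {additive B -> C}).

(* The elements of ker g that lie in the image of f.  When g \o f = 0 this is
   the whole image of f, and homology below is ker g / im f. *)
Definition boundary : ker g -> bool :=
  fun x => `[< exists y : A, f y = \val x >].

Fact boundary_zmod_closed : zmod_closed boundary.
Proof.
split=> [|x y]; first by apply/asboolP; exists 0; rewrite !raddf0.
move=> /asboolP[u fu] /asboolP[v fv]; apply/asboolP.
by exists (u - v); rewrite !raddfB fu fv.
Qed.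

HB.instance Definition _ :=
  GRing.isZmodClosed.Build (ker g) boundary boundary_zmod_closed.

Definition homology := Quotient.quot (GRing.ZmodClosed.clone _ boundary _).

HB.instance Definition _ := GRing.Zmodule.on homology.

End Homology.

(* A is isomorphic to (Z/2)^r; the exponent is an integer, so that the
   subtractions in it are not truncated. *)
Definition isog_Z2_pow (A : zmodType) (r : int) : Prop :=
  exists2 k : nat, k%:Z = r &
    exists f : {additive A -> 'rV['Z_2]_k}, bijective f.

(* Graphs. *)

(* An edge is given by the set of its ends, a singleton for a loop. *)
Record multigraph (T E : finType) := Multigraph {
  mverts : {set T};
  mends : E -> {set T} }.

Definition loopless (T E : finType) (G : multigraph T E) : bool :=
  [forall e, #|mends G e| != 1%N].

Record graph (T : finType) := Graph {
  verts : {set T};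
  edges : {set {set T}} }.

Definition simplify (T E : finType) (G : multigraph T E) : graph T :=
  Graph (mverts G) [set mends G e | e : E].

Section Graph.
Variables (T : finType) (G : graph T).

Definition adj : rel T := fun x y => [set x; y] \in edges G.

Definition components : {set {set T}} :=
  [set [set y | connect adj x y] | x in verts G].

Definition connected : bool := #|components| == 1%N.

Definition cyclomatic : int :=
  #|edges G|%:Z - #|verts G|%:Z + #|components|%:Z.

Definition bipartite : bool :=
  [exists B : {set T},
    [forall x, forall y, adj x y ==> ((x \in B) != (y \in B))]].

Definition has_odd_cycle : Prop :=
  exists p : seq T, [/\ ucycle adj p, (2 < size p)%N & odd (size p)].

Definition induced (W : {set T}) : graph T :=
  Graph (verts G :&: W) [set e in edges G | e \subset W].

End Graph.

Definition bip_components (T : finType) (G : graph T) : {set {set T}} :=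
  [set K in components G | bipartite (induced G K)].

Definition nonbip_components (T : finType) (G : graph T) : {set {set T}} :=
  [set K in components G | ~~ bipartite (induced G K)].

Definition bip_part (T : finType) (G : graph T) : graph T :=
  induced G (cover (bip_components G)).

(* Link diagrams. *)

(* The four half-edges at each crossing are numbered 0, 1, 2, 3
   counterclockwise, 0 and 2 belonging to the under-strand and 1 and 3 to the
   over-strand, as in planar diagram codes. *)
Definition halfedge (n : nat) : finType := ('I_n * 'I_4)%type.

Definition ccw (n : nat) (h : halfedge n) : halfedge n := (h.1, ordS h.2).

(* Euler's formula for the 4-valent map on the half-edges whose vertices are
   the orbits of ccw, whose edges are the orbits of the involution a and whose
   faces are the orbits of ccw \o a: every connected component of the map has
   genus 0. *)
Definition planar_map (n : nat) (a : halfedge n -> halfedge n) : Prop :=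
  (fcard (@ccw n) (halfedge n) + fcard (@ccw n \o a) (halfedge n) =
   fcard a (halfedge n)
   + 2 * n_comp (relU (frel (@ccw n)) (frel a)) (halfedge n))%N.

(* A link diagram, up to the relative position in the plane of its connected
   components, on which states and homology do not depend: arc_of sends each
   half-edge to the other half of the arc that contains it, and free_circles
   is the number of components without crossings.  The crossings are ordered
   as elements of 'I_ncross. *)
Record link_diagram := LinkDiagram {
  ncross : nat;
  free_circles : nat;
  arc_of : halfedge ncross -> halfedge ncross;
  arc_ofK : involutive arc_of;
  arc_of_neq : forall h, arc_of h != h;
  arc_of_planar : planar_map arc_of }.

Section Khovanov.
Variable D : link_diagram.
Local Notation n := (ncross D).

(* The marker +1 is true, the marker -1 is false. *)
Definition kstate : finType := {ffun 'I_n -> bool}.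

Definition splus : kstate := [ffun=> true].

Definition site : finType := (halfedge n + 'I_(free_circles D))%type.

(* The regions swept by the over-strand rotating counterclockwise lie between
   1 and 2 and between 3 and 0; the A-smoothing merges them, hence joins 0
   with 1 and 2 with 3, while the B-smoothing joins 1 with 2 and 3 with 0. *)
Definition smoothing (s : kstate) (h : halfedge n) : halfedge n :=
  (h.1, if odd h.2 == s h.1 then ord_pred h.2 else ordS h.2).

Definition smooth_adj (s : kstate) : rel site := fun x y =>
  match x, y with
  | inl h, inl h' => (h' == arc_of h) || (h' == smoothing s h)
  | _, _ => false
  end.

(* A circle of D_s is represented by the set of half-edges on it, or by a
   singleton for a component without crossings. *)
Definition circle_at (s : kstate) (x : site) : {set site} :=
  [set y | connect (smooth_adj s) x y].

Definition circles (s : kstate) : {set {set site}} :=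
  [set circle_at s x | x : site].

Definition half (c : 'I_n) (k : 'I_4) : site := inl (c, k).

Definition touches (C : {set site}) (c : 'I_n) : bool :=
  [exists k : 'I_4, half c k \in C].

(* In both smoothings the half-edges 0 and 2 lie on different strands. *)
Definition state_graph (s : kstate) : multigraph {set site} 'I_n :=
  Multigraph (circles s) (fun c =>
    [set circle_at s (half c 0); circle_at s (half c (inord 2))]).

Definition plus_adequate : bool := loopless (state_graph splus).

(* An enhanced state is a state with the set of its positive circles. *)
Definition estate : finType :=
  {p : kstate * {set {set site}} | p.2 \subset circles p.1}.

Definition markers (S : estate) : kstate := (\val S).1.
Definition positive (S : estate) : {set {set site}} := (\val S).2.

Definition sigma (S : estate) : int := \sum_(c < n) (-1) ^+ (~~ markers S c).

Definition tau (S : estate) : int :=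
  #|positive S|%:Z - #|circles (markers S) :\: positive S|%:Z.

Definition jdeg (S : estate) : int := sigma S + 2 * tau S.

(* [S : S'] = 1, the markers of S and S' differing at c only. *)
Definition incident (S S' : estate) (c : 'I_n) : bool :=
  [&& sigma S' == sigma S - 2,
      jdeg S' == jdeg S,
      [forall c', (markers S c' != markers S' c') == (c' == c)]
    & [forall C in circles (markers S),
        ~~ touches C c ==> ((C \in positive S) == (C \in positive S'))]].

Definition tsign (S : estate) (c : 'I_n) : nat :=
  #|[set c' : 'I_n | ~~ markers S c' & (c < c')%N]|.

(* At most one term of the sum is nonzero. *)
Definition dcoef (S S' : estate) : int :=
  \sum_(c < n | incident S S' c) (-1) ^+ tsign S c.

Definition estate_deg (i j : int) : finType :=
  {S : estate | (sigma S == i) && (jdeg S == j)}.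

Definition chain (i j : int) : zmodType := {ffun estate_deg i j -> int}.

(* The target degree i' is an argument so that no transport along
   i + 2 - 2 = i is needed; the map is 0 unless i' = i - 2. *)
Definition diff (i i' j : int) (x : chain i j) : chain i' j :=
  [ffun S' => \sum_S x S * dcoef (\val S) (\val S')].
Arguments diff : clear implicits.

Fact diff_zmod_morphism (i i' j : int) : zmod_morphism (diff i i' j).
Proof.
move=> x y; apply/ffunP=> S'; rewrite !ffunE -sumrB.
by apply: eq_bigr => S _; rewrite !ffunE mulrBl.
Qed.

HB.instance Definition _ (i i' j : int) :=
  GRing.isZmodMorphism.Build (chain i j) (chain i' j) (diff i i' j)
    (@diff_zmod_morphism i i' j).

Definition khovanov (i j : int) : zmodType :=
  homology (diff (i + 2) i j) (diff i (i - 2) j).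

End Khovanov.

Arguments splus : clear implicits.

(* Main.v *)
(** Let B be the vertex-edge incidence matrix of G'.  Adequacy determines the
    enhanced states in the degrees at hand: when a single marker e is negative
    exactly one circle is negative, so that chains in degree n - 2 are matrices
    N indexed by edges and vertices of G, with equal values at the two ends of
    the edge e in row e; when the negative markers are e and f, all circles are
    positive if e and f are not parallel, and one circle is negative otherwise.
    The boundary of N at (e, f) is the skew-symmetric part of N B, the signs
    being controlled by planarity, which excludes smoothing changes that keep
    the number of circles.  Parallel crossings only contribute a free summand,
    and the torsion becomes that of the integer square matrices indexed by the
    edges of G' modulo the lattice generated by the symmetric matrices and the
    N B.

    That torsion is killed by 2, so Smith normal form computes its rank as the
    rank of the lattice over the rationals minus its rank over F_2.  Over a field
    the annihilator of the lattice consists of the alternating matrices Om with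
    Om B^T = diag(u) C^T, where C is the coboundary matrix of an orientation of
    G' and u is a cycle.  Those with u = 0 form the exterior square of the
    cokernel of B.  Over F_2, B = C has rank |V| - p_0 and every cycle u occurs;
    over the rationals B has rank |V| - p_0^bi and u has to vanish on the
    bipartite components. *)

From HB Require Import structures.
Require Import Defs.
From mathcomp Require Import all_boot fingroup perm all_order all_algebra.
From mathcomp Require Import ring_quotient boolp zify ring.

Set Implicit Arguments.
Unset Strict Implicit.
Unset Printing Implicit Defensive.

Import GRing.Theory Num.Theory.

(** * The torsion of a homology group *)

(** Planarity enters through a direction of the half-edges that alternates around crossings and
    along arcs, as given by a checkerboard colouring. The double cover on which such a direction
    exists has twice the Euler characteristic of the diagram, and no component exceeds 2; so it has
    twice as many components and is trivial. Smoothings join entering to leaving half-edges, so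
    circles are orbits of a permutation and a change of marker multiplies it by a transposition,
    which never keeps the number of orbits.

    The exponent 2 comes from the cokernel of [B], whose torsion it kills, and passes to the
    exterior square; but the matrix [N] so obtained need not be constant along edges. Its defect
    must be a coboundary plus twice a function on bipartite edges. By duality this holds once the
    defect is orthogonal to the rational cycles off the bipartite part and to all cycles modulo 2.
    These are the cycles [u] carried by forms, and pairing with the form gives the orthogonality:
    the same forms bound the exponent and compute the rank. *)

Section TorHomology.
Local Open Scope ring_scope.
Local Open Scope quotient_scope.
Variables (A B C : zmodType) (f : {additive A -> B}) (g : {additive B -> C}).
Hypothesis gf0 : forall x, g (f x) = 0.
Hypothesis C_free : forall (c : C) m, (0 < m)%N -> c *+ m = 0 -> c = 0.

Variables (M V : zmodType) (I : {additive M -> B}) (theta : {additive M -> V}).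
Definition in_image x := exists y, f y = x.
Hypothesis I_image : forall x m, (0 < m)%N -> in_image (x *+ m) -> exists Y, in_image (x - I Y).
Hypothesis theta0 : forall Y, in_image (I Y) -> theta Y = 0.
Hypothesis theta_inj : forall Y m, (0 < m)%N -> in_image (I Y *+ m) -> theta Y = 0 -> in_image (I Y).
Hypothesis theta_surj : forall w, exists Y, theta Y = w /\ exists2 m, (0 < m)%N & in_image (I Y *+ m).

Local Notation H := (homology f g).
Definition hclass (x : ker g) : H := \pi_(homology f g) x.

Lemma in_imageB x y : in_image x -> in_image y -> in_image (x - y).
Proof. by move=> [u <-] [v <-]; exists (u - v); rewrite raddfB. Qed.

Lemma in_imageMn x m : in_image x -> in_image (x *+ m).
Proof. by move=> [u <-]; exists (u *+ m); rewrite raddfMn. Qed.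

Lemma hclassB x y : hclass (x - y) = hclass x - hclass y.
Proof. exact: raddfB. Qed.

Lemma hclassMn x m : hclass (x *+ m) = hclass x *+ m.
Proof. exact: raddfMn. Qed.

Lemma hclass_eq0 x : hclass x = 0 <-> in_image (\val x).
Proof.
have -> : (hclass x = 0) <-> (hclass x == hclass 0).
  have -> : hclass 0 = 0 by rewrite -(subrr 0) hclassB subrr.
  by split=> [->|/eqP].
rewrite /hclass -Quotient.idealrBE subr0; split=> [/asboolP //|im]; exact/asboolP.
Qed.

Lemma hclass_surj (h : H) : exists x, hclass x = h.
Proof. by exists (generic_quotient.repr h); rewrite /hclass reprK. Qed.

(** The graph of the isomorphism: a torsion class is moved by a boundary to some [I Y], and [theta]
    is read there. A relation postpones the choice of [x] and [Y] until single-valuedness is known,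
    and its additivity reduces the later checks to the element 0. *)
Definition tor_rel (h : tor H) (w : V) := exists (x : ker g) (Y : M),
  [/\ hclass x = tor_val h, in_image (\val x - I Y) & theta Y = w].

Lemma tor_valP (h : tor H) : exists2 m, (0 < m)%N & tor_val h *+ m = 0.
Proof. by case: h => x /= /asboolP. Qed.

Lemma tor_relB h h' w w' : tor_rel h w -> tor_rel h' w' -> tor_rel (h - h') (w - w').
Proof.
move=> [x [Y [hx xY <-]]] [x' [Y' [hx' xY' <-]]]; exists (x - x'), (Y - Y').
have tB : tor_val (h - h') = tor_val h - tor_val h' by exact: (raddfB \val).
have vB : \val (x - x') = \val x - \val x' by exact: raddfB.
rewrite hclassB hx hx' tB vB (raddfB I) (raddfB theta); split=> //.
suff -> : \val x - \val x' - (I Y - I Y') = (\val x - I Y) - (\val x' - I Y').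
  exact: in_imageB.
by rewrite !opprB [I Y' - I Y]addrC [I Y' - _]addrC addrACA.
Qed.

Lemma tor_rel_total h : exists w, tor_rel h w.
Proof.
have [x hx] := hclass_surj (tor_val h); have [m m0 hm] := tor_valP h.
move: hm; rewrite -hx -hclassMn => /hclass_eq0; rewrite raddfMn /= => /(I_image m0)[Y xY].
by exists (theta Y), x, Y.
Qed.

Lemma tor_rel0 w : tor_rel 0 w -> w = 0.
Proof.
move=> [x [Y [hx xY <-]]]; apply: theta0.
have /hclass_eq0 x0 : hclass x = 0 by rewrite hx.
by rewrite -[I Y](subKr (\val x)); apply: in_imageB.
Qed.

Lemma tor_rel_inj h : tor_rel h 0 -> h = 0.
Proof.
move=> [x [Y [hx xY tY]]]; have [m m0 hm] := tor_valP h.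
move: hm; rewrite -hx -hclassMn => /hclass_eq0; rewrite raddfMn /= => xm.
have /theta_inj-/(_ m0 tY) IY : in_image (I Y *+ m).
  by rewrite -[I Y](subKr (\val x)) mulrnBl; apply: in_imageB => //; apply: in_imageMn.
apply: val_inj; rewrite /= -hx; apply/hclass_eq0.
rewrite -[\val x](subrK (I Y)) -[X in _ + X]opprK; apply: in_imageB => //.
by rewrite -sub0r; apply: in_imageB => //; exists 0; rewrite raddf0.
Qed.

Lemma tor_rel_surj w : exists h, tor_rel h w.
Proof.
have [Y [tY [m m0 Ym]]] := theta_surj w.
(* Since [C] is torsion-free, a torsion element modulo boundaries is automatically a cycle; the
   torsion of the homology is thus that of [B] modulo the image of [f]. *)
have IYk : I Y \in kernel g.
  rewrite inE; apply/eqP/(C_free m0); rewrite -raddfMn; have [y <-] := Ym; exact: gf0.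
have xt : hclass (Ker IYk) \in @torsion (homology f g : zmodType).
  by apply/asboolP; exists m => //; rewrite -hclassMn; apply/hclass_eq0; rewrite raddfMn.
exists (Tor xt), (Ker IYk), Y; split=> //=.
by rewrite subrr; exists 0; rewrite raddf0.
Qed.

Lemma tor_homology_iso : exists phi : {additive tor H -> V}, bijective phi.
Proof.
have fun_rel h : {w | tor_rel h w} by apply/cid/tor_rel_total.
have inv_rel w : {h | tor_rel h w} by apply/cid/tor_rel_surj.
pose phi h := sval (fun_rel h).
have uniq_w h w : tor_rel h w -> phi h = w.
  move=> hw; apply/eqP; rewrite -subr_eq0; apply/eqP/tor_rel0.
  by rewrite -(subrr h); apply: tor_relB (svalP (fun_rel h)) hw.
have phiB : zmod_morphism phi.
  by move=> h h1; apply: uniq_w; apply: tor_relB (svalP _) (svalP _).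
pose phiM := GRing.isZmodMorphism.Build _ _ phi phiB.
pose phiA : {additive tor H -> V} := HB.pack phi phiM.
exists phiA; exists (fun w => sval (inv_rel w)) => [h|w].
  apply/eqP; rewrite -subr_eq0; apply/eqP/tor_rel_inj.
  rewrite -(subrr (phi h)); apply: tor_relB (svalP (inv_rel _)) (svalP (fun_rel h)).
exact: uniq_w (svalP (inv_rel w)).
Qed.
End TorHomology.

(** * Planar maps *)

Section Classes.
Variable T : finType.
Implicit Types (e : rel T) (s : {perm T}).

Lemma connect_min e (R : T -> T -> Prop) :
  (forall x, R x x) -> (forall x y z, R x y -> R y z -> R x z) ->
  (forall x y, e x y -> R x y) -> forall x y, connect e x y -> R x y.
Proof.
move=> R0 Rt eR x y /connectP[p xp ->]; elim: p x xp => //= z p IH x /andP[xz zp].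
by apply: Rt (eR _ _ xz) (IH _ zp).
Qed.

Definition eclass e x : {set T} := [set y | connect e x y].
Definition eclasses e : {set {set T}} := eclass e @: T.

Lemma eq_eclass e x y : connect_sym e ->
  (eclass e x == eclass e y) = connect e x y.
Proof.
move=> sym_e; apply/eqP/idP => [/setP/(_ y)|xy].
  by rewrite !inE connect0.
by apply/setP=> z; rewrite !inE (same_connect sym_e xy).
Qed.

Lemma n_compE e : connect_sym e -> n_comp e T = #|eclasses e|.
Proof.
move=> sym_e; have -> : eclasses e = [set eclass e x | x in roots e].
  apply/setP=> C; apply/imsetP/imsetP=> -[x _ ->]; last by exists x.
  exists (fingraph.root e x); first exact: roots_root.
  by apply/eqP; rewrite eq_eclass // connect_root.
rewrite card_in_imset => [|x y]; first by apply: eq_card => x; rewrite !inE andbT.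
by rewrite !inE => /eqP rx /eqP ry /eqP; rewrite eq_eclass // => /(fingraph.rootP sym_e); rewrite rx ry.
Qed.

Lemma fconnect_porbit s x y : fconnect s x y = (y \in porbit s x).
Proof.
apply/idP/porbitP => [/iter_findex <-|[i ->]].
  by exists (findex s x y); rewrite permX.
by rewrite permX fconnect_iter.
Qed.

Lemma card_porbits s : #|porbits s| = fcard s T.
Proof.
rewrite n_compE; last exact: fconnect_sym (@perm_inj _ s).
congr #|pred_of_set _|; apply: eq_imset => x; apply/setP=> y.
by rewrite !inE fconnect_porbit.
Qed.

(** Sending a class of [e] to the class of [e'] that contains it is onto. It is injective if [x] and
    [y] are already connected, and otherwise after the class of [x] is left out. *)
Lemma eclasses_add_edge e x y : connect_sym e ->
  let e' := relU e [rel u v | (u == x) && (v == y) || (u == y) && (v == x)] in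
  connect_sym e' /\ #|eclasses e| <= #|eclasses e'| + ~~ connect e x y.
Proof.
move=> sym_e; set e0 := [rel u v | _] => e'.
have sym_e' : connect_sym e'.
  apply: relU_sym => //; apply: sym_connect_sym => u v /=.
  by rewrite orbC; congr (_ || _); apply: andbC.
split=> //; have sub: subrel (connect e) (connect e').
  by apply: connect_sub => u v uv; apply: connect1; rewrite /e' /= uv.
pose h := fun C : {set T} => [set w | [exists z in C, connect e' z w]].
have hE z : h (eclass e z) = eclass e' z.
  apply/setP=> w; rewrite !inE; apply/exists_inP/idP => [[u]|zw].
    by rewrite inE => /sub zu /(connect_trans zu).
  by exists z => //; rewrite inE connect0.
have img: eclasses e' = h @: eclasses e.
  by rewrite /eclasses -imset_comp; apply: eq_imset => z; rewrite /= hE.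
have R u v : connect e' u v -> connect e u v \/
   (connect e x u || connect e y u) && (connect e x v || connect e y v).
  move: u v; apply: connect_min => [u|u v w|u v].
  - by left; apply: connect0.
  - case=> [uv|/andP[ux vx]] [vw|/andP[vx' wx]].
    + by left; apply: connect_trans uv vw.
    + by right; rewrite !(same_connect_r sym_e uv) vx'.
    + by right; rewrite -!(same_connect_r sym_e vw) ux.
    + by right; rewrite ux.
  - case/orP=> [uv|]; first by left; apply: connect1.
    by case/orP=> /andP[/eqP-> /eqP->]; right; rewrite !connect0 !orbT.
case: (boolP (connect e x y)) => [xy|nxy]; rewrite /= ?addn0 ?addn1.
  rewrite img [leqRHS]card_in_imset // => _ _ /imsetP[u _ ->] /imsetP[v _ ->].
  rewrite !hE => /eqP; rewrite eq_eclass // => /R uv; apply/eqP; rewrite eq_eclass //.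
  case: uv => //; rewrite -!(same_connect sym_e xy) !orbb => /andP[xu xv].
  by rewrite -(same_connect sym_e xu).
have xin: eclass e x \in eclasses e by apply: imset_f.
rewrite (cardsD1 (eclass e x)) xin add1n ltnS.
have <- : #|h @: (eclasses e :\ eclass e x)| = #|eclasses e :\ eclass e x|.
  apply: card_in_imset => C1 C2 /setD1P[nu /imsetP[u _ eu]] /setD1P[nv /imsetP[v _ ev]].
  move: nu nv; rewrite eu ev !hE ![_ == eclass e x]eq_sym !eq_eclass // => nu nv.
  move=> /eqP; rewrite eq_eclass // => /R uv; apply/eqP; rewrite eq_eclass //.
  case: uv => //; rewrite (negPf nu) (negPf nv) /= => /andP[xu xv].
  by rewrite -(same_connect sym_e xu).
by rewrite img subset_leq_card // imsetS // subsetDl.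
Qed.

Definition pair_rel (l : seq (T * T)) : rel T :=
  [rel u v | ((u, v) \in l) || ((v, u) \in l)].

Lemma pair_rel_sym l : connect_sym (pair_rel l).
Proof. by apply: sym_connect_sym => u v; apply: orbC. Qed.

Definition tperm_prod (l : seq (T * T)) : {perm T} :=
  foldr (fun p a => tperm p.1 p.2 * a)%g 1%g l.

Lemma tperm_prod_connect l u : connect (pair_rel l) u (tperm_prod l u).
Proof.
elim: l u => [|[b c] l IHl] u /=; first by rewrite perm1.
rewrite permM /=; apply: (@connect_trans _ _ (tperm b c u)).
  case: tpermP => [->|->|]; rewrite ?connect0 //; apply: connect1.
    by rewrite /pair_rel /= mem_head.
  by rewrite /pair_rel /= mem_head orbT.
apply: connect_sub (IHl _) => p q /orP[] pq; apply: connect1;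
  by rewrite /pair_rel /= !in_cons pq !orbT.
Qed.

(* The map with vertices the cycles of s and edges the pairs in l has
   nonnegative genus. *)
Lemma euler_le s (l : seq (T * T)) : all (fun p => p.1 != p.2) l ->
  #|porbits (tperm_prod l * s)| + #|porbits s|
    <= size l + 2 * #|eclasses (relU (frel s) (pair_rel l))|.
Proof.
elim: l => [_|[x y] l IH /= /andP[xy /IH{}IH]].
  rewrite mul1g addnn -mul2n leq_mul2l /= card_porbits.
  rewrite n_compE; last exact: fconnect_sym (@perm_inj _ s).
  suff -> : eclasses (frel s) = eclasses (relU (frel s) (pair_rel [::])) by [].
  apply: eq_imset => u; apply/setP=> v; rewrite !inE; apply: eq_connect => a b /=.
  by rewrite orbF.
set a := tperm_prod l in IH *.
have -> : (tperm x y * a * s = tperm x y * (a * s))%g by rewrite mulgA.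
have sym_l : connect_sym (relU (frel s) (pair_rel l)).
  by apply: relU_sym; [apply: fconnect_sym (@perm_inj _ s)|apply: pair_rel_sym].
have [_] := eclasses_add_edge x y sym_l; set E' := relU (relU _ _) _.
have -> : eclasses (relU (frel s) (pair_rel ((x, y) :: l))) = eclasses E'.
  apply: eq_imset => u; apply/setP=> v; rewrite !inE; apply: eq_connect => b c /=.
  rewrite /pair_rel /= !in_cons !xpair_eqE [(c == x) && _]andbC.
  by do 4! case: (_ == _); do 2! case: (_ \in _); rewrite /= ?orbT ?orbF.
set e := relU _ _ in IH * => le.
have count := porbits_mul_tperm (a * s)%g x y; rewrite /= xy in count.
(* A transposition adds an orbit if [x] and [y] share one and removes one otherwise, while the bound
   gains 1 and loses at most 2, the latter only when two components merge. The one bad case, an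
   orbit split by a pair joining two components, cannot occur because orbits lie inside
   components. *)
suff: x \in porbit (a * s)%g y -> connect e x y.
  move: le IH count; case: (x \in porbit _ y); case: (connect e x y) => //= le IH;
    rewrite ?addn0 ?addn1 => Hi H; try (by move: (H isT)); clear H; lia.
rewrite porbit_sym -fconnect_porbit; apply: (@connect_min _ (fun u v => is_true (connect e u v))) => [u|u v w|].
- exact: connect0.
- exact: connect_trans.
move=> u v /= /eqP <-; rewrite permM.
apply: (@connect_trans _ _ (a u)); last by apply: connect1; rewrite /e /= eqxx.
apply: connect_sub (tperm_prod_connect l u) => b c bc; apply: connect1.
by rewrite /e /=; move: bc => /= ->; rewrite orbT.
Qed.
End Classes.

Section DoubleCover.
Variable T : finType.

Definition flip (p : T * bool) : T * bool := (p.1, ~~ p.2).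
Definition twist (t : T -> bool) (f : T -> T) (p : T * bool) : T * bool :=
  (f p.1, t p.1 (+) p.2).

Lemma twist_inj t f : injective f -> injective (twist t f).
Proof. by move=> fI [x b] [y c] [/fI <-] /addbI ->. Qed.

(* If t is the coboundary of g then the double cover twisted by t is trivial. *)
Lemma fcard_twist t f g : injective f -> (forall x, g (f x) = t x (+) g x) ->
  fcard (twist t f) {: T * bool} = 2 * fcard f T.
Proof.
move=> fI gf.
have iterE n p : iter n (twist t f) p =
    (iter n f p.1, g (iter n f p.1) (+) g p.1 (+) p.2).
  elim: n => [|n IH] /=; first by rewrite addbb; case: p.
  by rewrite IH /twist /= gf !addbA.
have conE p q : fconnect (twist t f) p q =
    fconnect f p.1 q.1 && (g p.1 (+) p.2 == g q.1 (+) q.2).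
  apply/idP/andP => [/iter_findex <-|[/iter_findex e1 /eqP e2]].
    rewrite iterE /= fconnect_iter; split=> //.
    by rewrite !addbA addbb.
  have <- : iter (findex f p.1 q.1) (twist t f) p = q.
    rewrite iterE e1 -addbA e2; case: q {e1} e2 => y c /= _.
    by rewrite addbA addbb.
  exact: fconnect_iter.
rewrite !n_compE; try exact: fconnect_sym fI; last exact: fconnect_sym (twist_inj fI).
have -> : eclasses (frel (twist t f)) =
  (fun q : {set T} * bool => [set p : T * bool | (p.1 \in q.1) && (g p.1 (+) p.2 == q.2)])
    @: setX (eclasses (frel f)) [set: bool].
  apply/setP=> C; apply/imsetP/imsetP => [[p _ ->]|[[D b] /setXP[/imsetP[x _ ->]] _ ->]].
    exists (eclass (frel f) p.1, g p.1 (+) p.2); first by rewrite in_setX in_setT andbT imset_f.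
    by apply/setP=> q; rewrite !inE conE /= eq_sym [in RHS]eq_sym eq_sym.
  exists (x, g x (+) b) => //; apply/setP=> q; rewrite !inE conE /=.
  by rewrite addbA addbb /= eq_sym.
rewrite card_in_imset ?cardsX ?cardsT ?card_bool ?[_ * 2]mulnC //.
move=> [C b] [D c] /setXP[/imsetP[x _ ->] _] /setXP[/imsetP[y _ ->] _] /= /setP eCD.
have := eCD (x, g x (+) b); have := eCD (y, g y (+) c).
rewrite !inE /= !connect0 !addbA !addbb /= !eqxx /= => /andP[xy /eqP <-] _.
by congr pair; apply/eqP; rewrite eq_eclass //; exact: fconnect_sym fI.
Qed.

Variables (c a : T -> T) (g : T -> bool).
Hypotheses (cI : injective c) (aK : involutive a) (a_neq : forall x, a x != x).
Hypothesis gc : forall x, g (c x) = ~~ g x.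
Let e := relU (frel c) (frel a).
Hypothesis planar : fcard c T + fcard (c \o a) T = fcard a T + 2 * n_comp e T.

Let c' := twist xpredT c.
Let a' := twist xpredT a.
Let e' := relU (frel c') (frel a').

Let sym_e : connect_sym e.
Proof. by apply: relU_sym; apply: fconnect_sym => //; apply: inv_inj. Qed.

Let c'I : injective c'. Proof. exact: twist_inj. Qed.
Let a'I : injective a'. Proof. exact/twist_inj/inv_inj. Qed.

Let sym_e' : connect_sym e'.
Proof. by apply: relU_sym; apply: fconnect_sym. Qed.

Let e'1 p q : e' p q -> [/\ q.2 = ~~ p.2, e p.1 q.1 & e' (flip p) (flip q)].
Proof.
by case/orP=> /eqP <-; split; rewrite /= ?eqxx ?orbT.
Qed.

Let flip_connect p q : connect e' p q -> connect e' (flip p) (flip q).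
Proof.
move: p q; apply: (@connect_min _ _ (fun u v => is_true (connect e' (flip u) (flip v)))).
- by move=> u; apply: connect0.
- by move=> u v w; apply: connect_trans.
- by move=> u v /e'1[_ _ uv]; apply: connect1.
Qed.

Let lift_connect x y b : connect e x y -> exists d, connect e' (x, b) (y, d).
Proof.
move=> xy; move: b; move: x y xy.
apply: (@connect_min _ _ (fun u v => forall b, exists d, connect e' (u, b) (v, d))).
- by move=> u b; exists b; apply: connect0.
- move=> u v w uv vw b; have [d ud] := uv b; have [f vf] := vw d.
  by exists f; apply: connect_trans ud vf.
- move=> u v uv b; exists (~~ b); apply: connect1.
  by case/orP: uv => /eqP <-; apply/orP; [left|right]; rewrite /= /c' /a' /twist /=.
Qed.

(* Every component of the double cover has Euler characteristic at most 2, and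
   planarity makes the characteristic of the cover equal to 4 per component of
   the map: the cover is trivial. *)
Let cover_comps : 2 * #|eclasses e| <= #|eclasses e'|.
Proof.
have aI : injective a := inv_inj aK.
(* Every edge of the cover has exactly one end on the sheet [true], because [a'] changes the sheet;
   this lists the edges once each. *)
pose l := [seq ((x, true), a' (x, true)) | x <- enum T].
have all_l : all (fun p => p.1 != p.2) l.
  by apply/allP=> _ /mapP[x _ ->]; rewrite /= /a' /twist /= xpair_eqE andbC.
have := euler_le (perm c'I) all_l.
have -> : size l = #|T| by rewrite size_map -cardE.
have tl p : tperm_prod l p = a' p.
  have key (s : seq T) q : uniq s ->
    tperm_prod [seq ((x, true), a' (x, true)) | x <- s] q =
    if (q.2 && (q.1 \in s)) || (~~ q.2 && (a q.1 \in s)) then a' q else q.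
    elim: s q => [|x s IH] q /=; first by rewrite perm1 !andbF.
    case/andP=> xs us; rewrite permM IH // {IH us} !in_cons /a' /twist /=.
    case: q => y b /=; case: tpermP => [[-> ->]|[-> ->]|] /=.
    - by rewrite aK (negPf xs) eqxx.
    - by rewrite (negPf xs) aK eqxx.
    case: b => /=.
      by move/eqP; rewrite xpair_eqE andbT => /negPf-> _; rewrite orbF.
    move=> _ /eqP; rewrite xpair_eqE andbT => /negPf ne.
    suff -> : (a y == x) = false by [].
    by rewrite -ne -(inj_eq aI) aK.
  rewrite key ?enum_uniq // !mem_enum !inE !andbT; by case: (p.2).
have -> : eclasses (relU (frel (perm c'I)) (pair_rel l)) = eclasses e'.
  apply: eq_imset => u; apply/setP=> v; rewrite !inE; apply: eq_connect => p q.
  rewrite /e' /= permE; congr (_ || _).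
  have memE u1 v1 : ((u1, v1) \in l) = u1.2 && (a' u1 == v1).
    apply/mapP/andP=> [[x _ [-> ->]]|[]]; first by rewrite eqxx.
    by case: u1 => x [] //= _ /eqP <-; exists x; rewrite ?mem_enum.
  rewrite /pair_rel /= !memE.
  have -> : (a' q == p) = (a' p == q).
    have a'K : involutive a'.
      by move=> [x b]; rewrite /a' /twist /= aK negbK.
    by rewrite -(inj_eq a'I) a'K eq_sym.
  case: eqP => [<-|]; last by rewrite !andbF.
  by rewrite /a' /twist /=; case: (p.2).
rewrite !card_porbits.
(* In a face the sheet changes of [c] and [a] cancel, so it lifts to two faces. A vertex also lifts
   to two, since [g] alternates around it and absorbs the sheet change. *)
have -> : fcard (tperm_prod l * perm c'I)%g {: T * bool} = 2 * fcard (c \o a) T.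
  rewrite -(@fcard_twist (xpred0) (c \o a) xpred0) //; last exact: inj_comp.
  apply: eq_n_comp; apply: eq_fconnect => p.
  by rewrite permM permE tl /a' /c' /twist /= negbK.
have -> : fcard (perm c'I) {: T * bool} = 2 * fcard c T.
  rewrite -(@fcard_twist xpredT c g) //.
  by apply: eq_n_comp; apply: eq_fconnect => p; rewrite permE.
have cardT : fcard a T * 2 = #|T|.
  rewrite fcard_order_set //; apply/subsetP=> x _; rewrite inE.
  have cyc : fcycle a [:: x; a x] by rewrite /= aK !eqxx.
  by rewrite (order_cycle cyc) ?mem_head //= inE andbT eq_sym.
by move: planar; rewrite (n_compE sym_e); lia.
Qed.

(** Such an [o] is a section of the double cover whose sheets are exchanged by both [c] and [a], and
    it exists as soon as the two lifts of each point lie in different components. For a plane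
    diagram it is the boundary orientation of a checkerboard colouring. *)
Lemma planar_orientation :
  exists o : T -> bool, (forall x, o (c x) = ~~ o x) /\ (forall x, o (a x) = ~~ o x).
Proof.
have split x : ~~ connect e' (x, true) (x, false).
  apply/negP=> xx; set r := fingraph.root e x.
  have rr : connect e' (r, true) (r, false).
    have [d xd] := lift_connect true (connect_root e x).
    have := flip_connect xd; rewrite /flip /= => xd'.
    have : connect e' (r, d) (r, ~~ d).
      by apply: connect_trans (connect_trans xx xd'); rewrite sym_e'.
    by case: (d) => //; rewrite sym_e'.
  (* Every component of the cover contains a lift of a root. If the two lifts of [r] were connected,
     one of them could be dropped, leaving fewer than [2 * #|eclasses e|] components. *)
  pose R := setX [set y | roots e y] [set: bool].
  have sub : eclasses e' \subset eclass e' @: (R :\ (r, false)).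
    apply/subsetP=> _ /imsetP[[y b] _ ->].
    have [d yd] := lift_connect b (connect_root e y).
    have -> : eclass e' (y, b) = eclass e' (fingraph.root e y, d).
      by apply/eqP; rewrite eq_eclass.
    case: (eqVneq (fingraph.root e y, d) (r, false)) => [[-> ->]|ne].
      have -> : eclass e' (r, false) = eclass e' (r, true).
        by apply/eqP; rewrite eq_eclass // sym_e'.
      by apply: imset_f; rewrite !inE xpair_eqE andbF /= roots_root.
    by apply: imset_f; rewrite in_setD1 ne !inE /= roots_root.
  have rR : (r, false) \in R by rewrite !inE roots_root.
  have cardR : #|R| = #|eclasses e| * 2.
    rewrite cardsX cardsT card_bool -n_compE //; congr (_ * _).
    by apply: eq_card => y; rewrite !inE andbT.
  have := leq_trans cover_comps (leq_trans (subset_leq_card sub) (leq_imset_card _ _)).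
  move: cardR; rewrite (cardsD1 (r, false) R) rR mulnC => <-.
  by rewrite add1n ltnn.
pose o x := connect e' (fingraph.root e x, true) (x, true).
have oE x y : e' (x, true) (y, false) -> fingraph.root e x = fingraph.root e y ->
    o y = ~~ o x.
  move=> xy rxy; have yx : e' (x, false) (y, true) by have [] := e'1 xy.
  rewrite /o -rxy; apply/idP/negP => [ry rx|nrx].
    case/negP: (split y); rewrite sym_e'; apply: connect_trans (connect_trans _ ry).
      by rewrite sym_e'; apply: connect_trans rx (connect1 _).
    by apply: connect0.
  have [d rd] := lift_connect true (connect_root e x).
  case: d rd => [rx|/flip_connect rx]; first by case: nrx; rewrite sym_e'.
  apply: (@connect_trans _ _ (x, false)); last exact: connect1.
  by rewrite sym_e'.
exists o; split=> x; apply: oE.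
- by rewrite /e' /= /c' /twist /= eqxx.
- by apply/(fingraph.rootP sym_e)/connect1; rewrite /e /= eqxx.
- by rewrite /e' /= /a' /twist /= eqxx orbT.
- by apply/(fingraph.rootP sym_e)/connect1; rewrite /e /= eqxx orbT.
Qed.
End DoubleCover.

(** * Circles of a state as orbits of a permutation *)

Section Orientation.
Variable D : link_diagram.
Local Notation n := (ncross D).
Implicit Types (s : kstate D) (x y : site D) (c f : 'I_n).

Lemma ccw_inj : injective (@ccw n).
Proof. by move=> [c i] [d j] [-> e]; congr pair; apply/ordS_inj/val_inj. Qed.

Lemma odd_ordS (k : 'I_4) : odd (ordS k) = ~~ odd k.
Proof. by case: k => [[|[|[|[|]]]]]. Qed.

Lemma diagram_orientation : exists o : halfedge n -> bool,
  (forall h, o (ccw h) = ~~ o h) /\ (forall h, o (arc_of h) = ~~ o h).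
Proof.
apply: (@planar_orientation (halfedge n) (@ccw n) (@arc_of D) (fun h => odd h.2)).
- exact: ccw_inj.
- exact: arc_ofK.
- exact: arc_of_neq.
- by move=> h; rewrite odd_ordS.
- exact: arc_of_planar.
Qed.

Lemma smoothingK s : involutive (smoothing s).
Proof.
move=> [c k]; rewrite /smoothing /=; congr pair; case: (s c).
all: by case: k => [[|[|[|[|]]]]] //= ?; apply: val_inj.
Qed.

Lemma smooth_adj_sym s : symmetric (smooth_adj s).
Proof.
move=> [h|i] [h'|i'] //=.
by rewrite -(inj_eq (inv_inj (@arc_ofK D))) -(inj_eq (inv_inj (smoothingK s)) h')
  arc_ofK smoothingK !(eq_sym h).
Qed.

Lemma smooth_sym s : connect_sym (smooth_adj s).
Proof. exact/sym_connect_sym/smooth_adj_sym. Qed.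

Definition unmark s f : kstate D := [ffun c => (c != f) && s c].

(** Both smoothings pair neighbouring half-edges, and the B-partner of a half-edge is the A-partner
    of the opposite one. This is what turns a change of marker into a transposition. *)
Lemma smoothing_unmark s f h :
  s f -> h.1 = f -> smoothing (unmark s f) h = smoothing s (ccw (ccw h)).
Proof.
move=> sf; case: h => c k /= ->; rewrite /smoothing /ccw /= ffunE eqxx sf /=.
by congr pair; case: k => [[|[|[|[|]]]]] //= ?; apply: val_inj.
Qed.

Lemma smoothing_unmark_neq s f h :
  h.1 != f -> smoothing (unmark s f) h = smoothing s h.
Proof. by move=> hf; rewrite /smoothing ffunE hf. Qed.

Section Oriented.
Variable o : halfedge n -> bool.
Hypotheses (occw : forall h, o (ccw h) = ~~ o h) (oarc : forall h, o (arc_of h) = ~~ o h).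

Lemma osmoothing s h : o (smoothing s h) = ~~ o h.
Proof.
rewrite /smoothing; case: ifP => _; last exact: occw.
rewrite -[h in RHS](_ : ccw (h.1, ord_pred h.2) = h) ?occw ?negbK //.
by case: h => c k; rewrite /ccw /= ord_predK.
Qed.

(** Half-edges with [o] true are read as entering their crossing: the smoothing leads to a leaving
    one, and its arc to the next entering one. Leaving half-edges are fixed, so this is a
    permutation of all sites; circles correspond to its orbits on entering half-edges and free
    circles. *)
Definition advance s x : site D :=
  match x with
  | inl h => if o h then inl (arc_of (smoothing s h)) else inl h
  | inr i => inr i
  end.

Lemma advance_inj s : injective (advance s).
Proof.
move=> [h|i] [k|j] //=; try by case: ifP.
case: ifP => oh; case: ifP => ok [] // e.
- by rewrite (inv_inj (@smoothingK s) (inv_inj (@arc_ofK D) e)).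
- by move: ok; rewrite -e oarc osmoothing negbK oh.
- by move: oh; rewrite e oarc osmoothing negbK ok.
by rewrite e.
Qed.

Definition rho s := perm (@advance_inj s).

Definition inward x : site D :=
  match x with inl h => if o h then inl h else inl (arc_of h) | inr i => inr i end.

Lemma inward_connect s x : connect (smooth_adj s) x (inward x).
Proof.
case: x => [h|i] /=; last exact: connect0.
by case: ifP => _; [apply: connect0 | apply: connect1; rewrite /= eqxx].
Qed.

Lemma connect_rho s x y :
  connect (smooth_adj s) x y = (inward y \in porbit (rho s) (inward x)).
Proof.
rewrite -fconnect_porbit; apply/idP/idP.
  apply: (@connect_min _ _ (fun u v => is_true (fconnect (rho s) (inward u) (inward v)))).
  - by move=> u; apply: connect0.
  - by move=> u v w; apply: connect_trans.
  move=> [h|i] [k|j] //= /orP[] /eqP ->.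
    by rewrite oarc; case: (o h); rewrite /= ?arc_ofK connect0.
  rewrite osmoothing; case: ifP => oh /=.
    by apply: connect1; rewrite /= permE /= oh.
  rewrite fconnect_sym; last exact: perm_inj.
  by apply: connect1; rewrite /= permE /= osmoothing oh /= smoothingK.
move=> xy; rewrite (same_connect (@smooth_sym s) (inward_connect s x)).
rewrite (same_connect_r (@smooth_sym s) (inward_connect s y)).
move: xy; move: (inward x) (inward y).
apply: (@connect_min _ _ (fun u v => is_true (connect (smooth_adj s) u v))).
- by move=> u; apply: connect0.
- by move=> u v w; apply: connect_trans.
move=> [h|i] v /= /eqP <-; rewrite permE /=; last exact: connect0.
case: ifP => _; last exact: connect0.
by apply: (@connect_trans _ _ (inl (smoothing s h))); apply: connect1; rewrite /= eqxx ?orbT.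
Qed.

Lemma rho_unmark s f p : s f -> p.1 = f -> o p ->
  rho (unmark s f) = (tperm (inl p) (inl (ccw (ccw p))) * rho s)%g.
Proof.
move=> sf pf op.
have c4 (h : halfedge n) : ccw (ccw (ccw (ccw h))) = h.
  by case: h => c k; congr pair; apply: val_inj; case: k => [[|[|[|[|]]]]].
have oq : o (ccw (ccw p)) by rewrite !occw negbK.
have sp : smoothing (unmark s f) p = smoothing s (ccw (ccw p)) by rewrite smoothing_unmark.
have sq : smoothing (unmark s f) (ccw (ccw p)) = smoothing s p by rewrite smoothing_unmark ?c4.
have pE h : h.1 = f -> o h -> (h == p) || (h == ccw (ccw p)).
  move=> hf oh.
  have : [|| h == p, h == ccw p, h == ccw (ccw p) | h == ccw (ccw (ccw p))].
    move: hf; rewrite -pf; case: (h) (p) => a i [b j] /= ->.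
    rewrite /ccw /= !xpair_eqE !eqxx /= -!val_eqE /=.
    by case: i j => [[|[|[|[|]]]]] //= ? [[|[|[|[|]]]]].
  by case/or4P=> /eqP eh; rewrite eh ?eqxx ?orbT //; move: oh; rewrite eh !occw op.
move: (ccw (ccw p)) oq sp sq pE => q oq sp sq pE.
apply/permP=> x; rewrite permM [LHS]permE [RHS]permE /=.
case: (tpermP (inl p) (inl q) x) => [->|->|] /=.
- by rewrite op oq sp.
- by rewrite op oq sq.
case: x => [h|i] //= hp hq; case: ifP => // oh; rewrite smoothing_unmark_neq //.
by apply/eqP=> hf; case/orP: (pE h hf oh) => /eqP eh; [case: hp | case: hq]; rewrite eh.
Qed.

(** Multiplication by a transposition changes the number of orbits by one, up or down according to
    whether the two points share an orbit. Applying this in both directions and adding, the two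
    points share an orbit for exactly one of the two markers. *)
Lemma toggle_oriented s f : s f ->
  connect (smooth_adj (unmark s f)) (Defs.half f 0%R) (Defs.half f (inord 2))
  = ~~ connect (smooth_adj s) (Defs.half f 0%R) (Defs.half f (inord 2)).
Proof.
move=> sf.
(* One of the half-edges 0 and 1 enters the crossing. With its opposite it represents the same two
   strands as 0 and 2, whatever the smoothing at [f]. *)
have [p [pf op ep]] : exists p : halfedge n, [/\ p.1 = f, o p &
    forall s, connect (smooth_adj s) (Defs.half f 0%R) (Defs.half f (inord 2)) =
        connect (smooth_adj s) (inl p) (inl (ccw (ccw p)))].
  case o0: (o (f, 0%R)).
    exists (f, 0%R); split=> // s'; congr (connect _ _ (inl (_, _))).
    by apply: val_inj; rewrite /= inordK.
  exists (f, inord 1); split=> //.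
    have -> : (f, inord 1) = ccw (f, 0%R) :> halfedge n.
      by congr pair; apply: val_inj; rewrite /= inordK.
    by rewrite occw o0.
  move=> s'; set x := Defs.half f 0%R; set y := Defs.half f _; set z := inl _; set w := inl _.
  have adjE (k l : 'I_4) : (if odd k == s' f then ord_pred k else ordS k) = l ->
      connect (smooth_adj s') (Defs.half f k) (Defs.half f l).
    by move=> <-; apply: connect1; rewrite /= /smoothing eqxx orbT.
  have e2 : inord 2 = Ordinal (isT : 2 < 4) :> 'I_4 by apply: val_inj; rewrite /= inordK.
  have e1 : inord 1 = Ordinal (isT : 1 < 4) :> 'I_4 by apply: val_inj; rewrite /= inordK.
  case sf': (s' f).
    have xz : connect (smooth_adj s') x z.
      by apply: adjE; rewrite sf' e1; apply: val_inj.
    have yw : connect (smooth_adj s') y w.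
      by apply: adjE; rewrite sf' e1 e2; apply: val_inj.
    by rewrite (same_connect (@smooth_sym s') xz) (same_connect_r (@smooth_sym s') yw).
  have yz : connect (smooth_adj s') y z.
    by apply: adjE; rewrite sf' e1 e2; apply: val_inj.
  have xw : connect (smooth_adj s') x w.
    by apply: adjE; rewrite sf' e1; apply: val_inj.
  rewrite (same_connect (@smooth_sym s') xw) (same_connect_r (@smooth_sym s') yz).
  exact: smooth_sym.
rewrite !ep !connect_rho /= !occw negbK op.
set q := ccw _; rewrite (rho_unmark sf pf op) -/q.
have pq : inl p != inl q :> site D.
  apply/eqP=> -[] /(congr1 (fun h : halfedge n => val h.2)).
  by rewrite /q; case: (p) => a [[|[|[|[|]]]]].
have := porbits_mul_tperm (rho s) (inl p) (inl q); rewrite /= pq.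
have := porbits_mul_tperm (tperm (inl p) (inl q) * rho s)%g (inl p) (inl q).
rewrite /= pq mulgA tperm2 mul1g porbit_sym [inl p \in porbit (rho s) _]porbit_sym.
move: (#|_|) (#|_|) => a b; case: (_ \in porbit (_ * _)%g _); case: (_ \in _) => /=; lia.
Qed.
End Oriented.

(* Resmoothing a crossing either merges two circles or splits one: the circles
   of a state of a planar diagram can be oriented so that all smoothings
   respect the orientation. *)
Lemma toggle s f : s f ->
  connect (smooth_adj (unmark s f)) (Defs.half f 0%R) (Defs.half f (inord 2))
  = ~~ connect (smooth_adj s) (Defs.half f 0%R) (Defs.half f (inord 2)).
Proof. by have [o [oc oa]] := diagram_orientation; apply: toggle_oriented oc oa _ _. Qed.
End Orientation.

(** * Circles and enhanced states *)

Section Circles.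
Variable D : link_diagram.
Local Notation n := (ncross D).
Implicit Types (s t : kstate D) (x y : site D) (c f : 'I_n) (C : {set site D}).

Definition end0 c : site D := Defs.half c 0%R.
Definition end2 c : site D := Defs.half c (inord 2).

Lemma mem_circle_at s x y : (y \in circle_at s x) = connect (smooth_adj s) x y.
Proof. by rewrite inE. Qed.

Lemma circle_at_id s x : x \in circle_at s x.
Proof. by rewrite inE connect0. Qed.

Lemma eq_circle_at s x y :
  (circle_at s x == circle_at s y) = connect (smooth_adj s) x y.
Proof. exact/eq_eclass/smooth_sym. Qed.

Lemma circle_atP s x y : reflect (circle_at s x = circle_at s y) (y \in circle_at s x).
Proof. by rewrite inE -eq_circle_at; apply: eqP. Qed.

Lemma circle_at_in s x : circle_at s x \in circles s.
Proof. exact: imset_f. Qed.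

Lemma circlesP s C x : C \in circles s -> x \in C -> C = circle_at s x.
Proof. by move=> /imsetP[y _ ->] /circle_atP. Qed.

Lemma circle_neq0 s C : C \in circles s -> exists x, x \in C.
Proof. by move=> /imsetP[y _ ->]; exists y; apply: circle_at_id. Qed.

Lemma half_ends s c (k : 'I_4) :
  Defs.half c k \in circle_at s (end0 c) \/ Defs.half c k \in circle_at s (end2 c).
Proof.
have e2 : inord 2 = Ordinal (isT : 2 < 4) :> 'I_4 by apply: val_inj; rewrite /= inordK.
have adjE (i j : 'I_4) : (if odd i == s c then ord_pred i else ordS i) = j ->
    Defs.half c j \in circle_at s (Defs.half c i).
  by move=> <-; rewrite inE; apply: connect1; rewrite /= /smoothing eqxx orbT.
case: k => [[|[|[|[|//]]]]] ltk.
- by left; rewrite (_ : Ordinal ltk = 0%R) ?circle_at_id //; apply: val_inj.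
- case sc: (s c); [left | right]; apply: adjE; rewrite sc ?e2; exact: val_inj.
- by right; rewrite (_ : Ordinal ltk = inord 2) ?circle_at_id // e2; apply: val_inj.
- case sc: (s c); [right | left]; apply: adjE; rewrite sc ?e2; exact: val_inj.
Qed.

Lemma touchesE s c C : C \in circles s -> touches C c = (end0 c \in C) || (end2 c \in C).
Proof.
move=> /imsetP[x _ ->]; apply/existsP/orP => [[k]|[] ?]; last by exists (inord 2).
  rewrite [_ \in circle_at s x]inE -eq_circle_at => /eqP ->.
  by have [] := half_ends s c k => /circle_atP <-; rewrite circle_at_id; [left|right].
by exists 0%R.
Qed.

Lemma touches_circle_at s c x :
  touches (circle_at s x) c = (circle_at s x == circle_at s (end0 c))
                           || (circle_at s x == circle_at s (end2 c)).
Proof. by rewrite (@touchesE s) ?circle_at_in // !inE !eq_circle_at. Qed.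

Definition agree_off f s t := forall c, c != f -> s c = t c.

Lemma agree_offC f s t : agree_off f s t -> agree_off f t s.
Proof. by move=> st c cf; rewrite st. Qed.

Lemma unmark_agree s f : agree_off f s (unmark s f).
Proof. by move=> c cf; rewrite ffunE cf. Qed.

Lemma untouched_circle_at f s t x : agree_off f s t ->
  ~~ touches (circle_at s x) f -> circle_at t x = circle_at s x.
Proof.
move=> st /existsPn nf.
have nf' h : inl h \in circle_at s x -> h.1 != f.
  by case: h => c k h; apply: contraTneq h => /= ->; apply: nf.
have adjE u v : u \in circle_at s x -> smooth_adj s u v = smooth_adj t u v.
  case: u v => [h|i] [h'|j] //= /nf' hf; rewrite /smoothing.
  by rewrite (st _ hf).
apply/setP=> y; rewrite !mem_circle_at; apply/idP/idP => /connectP[p xp ->{y}].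
  apply/connectP; exists p => //; move: (circle_at_id s x) xp.
  elim: p {1 3 4}x => //= z p IH u us /andP[uz zp].
  rewrite adjE // uz /=; apply: IH => //.
  by rewrite -adjE // in uz; move: us; rewrite !mem_circle_at => us; apply: connect_trans us (connect1 uz).
apply/connectP; exists p => //; move: (circle_at_id s x) xp.
elim: p {1 3 4}x => //= z p IH u us /andP[uz zp].
rewrite -adjE // uz /=; apply: IH => //.
by move: us; rewrite !mem_circle_at => us; apply: connect_trans us (connect1 uz).
Qed.

Section Refine.
Variables (f : 'I_n) (s t : kstate D).
Hypotheses (st : agree_off f s t) (joined : end2 f \in circle_at s (end0 f)).

(** All four half-edges at [f] lie on a single circle of [s], so a step of [t] at [f] joins sites
    already joined in [s], however [t] smooths [f]. *)
Lemma circle_at_refine x : circle_at t x \subset circle_at s x.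
Proof.
have joinE k : Defs.half f k \in circle_at s (end0 f).
  by have [//|] := half_ends s f k; rewrite -(circle_atP _ _ _ joined).
apply/subsetP=> y; rewrite !mem_circle_at; apply: connect_sub => u v.
case: u v => [[c k]|i] [h'|j] //= /orP[/eqP->|/eqP->].
  by apply: connect1; rewrite /= eqxx.
case: (eqVneq c f) => [->|cf].
  rewrite /smoothing /= -mem_circle_at -(circle_atP _ _ _ (joinE _)); exact: joinE.
by apply: connect1; rewrite /= /smoothing /= (st cf) eqxx orbT.
Qed.

Lemma sub_circle_at C x : C \in circles s ->
  (circle_at t x \subset C) = (x \in C).
Proof.
move=> Cs; apply/idP/idP => [/subsetP/(_ x)|xC]; first by rewrite circle_at_id => ->.
by rewrite (circlesP Cs xC) circle_at_refine.
Qed.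

Hypothesis split : end2 f \notin circle_at t (end0 f).

Lemma card_circles_split : #|circles t| = #|circles s|.+1.
Proof.
rewrite (cardsD1 (circle_at t (end0 f)) (circles t)) circle_at_in.
rewrite (cardsD1 (circle_at t (end2 f))) !inE circle_at_in andbT.
rewrite (cardsD1 (circle_at s (end0 f)) (circles s)) circle_at_in.
rewrite eq_sym eq_circle_at -mem_circle_at split /= !add1n; congr _.+2.
have js : circle_at s (end2 f) = circle_at s (end0 f) by apply/esym/circle_atP.
apply: eq_card => C; rewrite !inE; apply/and3P/andP => [[C2 C0 /imsetP[x _ eC]]|[C0 /imsetP[x _ eC]]].
  have nC : ~~ touches (circle_at t x) f.
    by rewrite touches_circle_at -eC (negPf C0) (negPf C2).
  have e := untouched_circle_at (agree_offC st) nC; rewrite eC -e circle_at_in; split=> //.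
  apply: contraNneq nC => e0; rewrite -e e0; apply/existsP; exists 0%R; exact: circle_at_id.
have nC : ~~ touches (circle_at s x) f by rewrite touches_circle_at js -eC orbb.
have e := untouched_circle_at st nC; rewrite eC -e circle_at_in.
split=> //; apply: contraNneq nC => e0; rewrite -e e0; apply/existsP.
  by exists (inord 2); apply: circle_at_id.
by exists 0%R; apply: circle_at_id.
Qed.
End Refine.

Definition splits s f : bool := end2 f \in circle_at s (end0 f).

Lemma unmark_ends s f : s f ->
  (end2 f \in circle_at (unmark s f) (end0 f)) = ~~ splits s f.
Proof. by move=> sf; rewrite /splits !mem_circle_at toggle. Qed.

Lemma card_circles_unmark s f : s f ->
  if splits s f then #|circles (unmark s f)| = #|circles s|.+1
  else #|circles s| = #|circles (unmark s f)|.+1.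
Proof.
move=> sf; have E := unmark_ends sf; case: ifP => spl; rewrite spl in E.
  exact: card_circles_split (@unmark_agree s f) spl (negbT E).
exact: card_circles_split (agree_offC (@unmark_agree s f)) E (negbT spl).
Qed.
End Circles.

Section Estates.
Variable D : link_diagram.
Local Notation n := (ncross D).
Implicit Types (s t : kstate D) (c f : 'I_n) (C : {set site D}) (S : estate D).

(** In degrees [n - 2] and [n - 4] at most one circle is negative, which makes the complement of
    [positive] the convenient datum. *)
Definition negative S : {set {set site D}} := circles (markers S) :\: positive S.
Definition nneg s : nat := #|[set c | ~~ s c]|.

Lemma sigmaE S : sigma S = (n%:Z - 2 * (nneg (markers S))%:Z)%R.
Proof.
rewrite -[n in RHS]card_ord -sum1_card /nneg -sum1_card -!natz !natr_sum mulr_sumr.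
rewrite [X in (_ - X)%R]big_mkcond -sumrB; apply: eq_bigr => c _.
by rewrite inE; case: (markers S c).
Qed.

Lemma negative_sub S : negative S \subset circles (markers S).
Proof. exact: subsetDl. Qed.

Lemma tauE S : tau S = (#|circles (markers S)|%:Z - 2 * #|negative S|%:Z)%R.
Proof.
have sub : positive S \subset circles (markers S) by apply: (valP S).
rewrite /tau -/(negative S) -(cardsID (positive S) (circles (markers S))).
rewrite (setIidPr sub) -/(negative S); lia.
Qed.

Lemma jdeg_eq S S' : (jdeg S == jdeg S') =
  (#|circles (markers S)| + nneg (markers S') + 2 * #|negative S'|
   == #|circles (markers S')| + nneg (markers S) + 2 * #|negative S|).
Proof. by rewrite /jdeg !sigmaE !tauE; apply/eqP/eqP; lia. Qed.

Lemma estate_inj S S' : markers S = markers S' -> negative S = negative S' -> S = S'.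
Proof.
have posE S0 : positive S0 = circles (markers S0) :\: negative S0.
  by rewrite setDDr setDv set0U; apply/esym/setIidPr; apply: (valP S0).
move=> em en; apply: val_inj; rewrite (surjective_pairing (val S)) (surjective_pairing (val S')).
by rewrite -![(val _).1]/(markers _) -![(val _).2]/(positive _) !posE em en.
Qed.

Lemma estate_exists s (M : {set {set site D}}) : M \subset circles s ->
  exists S, markers S = s /\ negative S = M.
Proof.
move=> Ms; have sub : (s, circles s :\: M).2 \subset circles (s, circles s :\: M).1.
  exact: subsetDl.
exists (Sub (s, circles s :\: M) sub); rewrite /negative /markers /positive SubK /=.
by split=> //; rewrite setDDr setDv set0U; apply/setIidPr.
Qed.

Lemma nneg_unmark s c : s c -> nneg (unmark s c) = (nneg s).+1.
Proof.
move=> sc; rewrite /nneg (cardsD1 c) inE ffunE eqxx add1n; congr _.+1.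
by apply: eq_card => d; rewrite !inE ffunE; case: eqVneq => [->|] //=; rewrite sc.
Qed.

Definition same_untouched S S' c := [forall C in circles (markers S),
  ~~ touches C c ==> ((C \in negative S) == (C \in negative S'))].

Lemma incidentE S S' c : incident S S' c =
  [&& markers S c, markers S' == unmark (markers S) c, jdeg S' == jdeg S
    & same_untouched S S' c].
Proof.
rewrite /incident.
have diffE : markers S c ->
  [forall c', (markers S c' != markers S' c') == (c' == c)] = (markers S' == unmark (markers S) c).
  move=> sc; apply/forallP/eqP => [H|-> d].
    apply/ffunP=> d; rewrite ffunE; move/eqP: (H d).
    by case: (eqVneq d c) => [->|_] /=; [rewrite sc|]; case: (markers S' _); case: (markers S _).
  by rewrite ffunE; case: (eqVneq d c) => [->|] /=; rewrite ?sc ?eqxx.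
have untE : markers S' = unmark (markers S) c ->
    [forall C in circles (markers S), ~~ touches C c ==> ((C \in positive S) == (C \in positive S'))]
    = same_untouched S S' c.
  move=> e; apply: eq_forallb => C; apply: implyb_id2l => Cs; apply: implyb_id2l => nC.
  suff Cs' : C \in circles (markers S') by rewrite !inE Cs Cs' !andbT; do 2 case: (_ \in _).
  move: nC; case/imsetP: Cs => x _ -> nC.
  by rewrite -(untouched_circle_at (@unmark_agree _ _ c) nC) -e circle_at_in.
case sc: (markers S c) => /=.
  rewrite diffE //; case: (markers S' =P _) => [e|_] /=; last by rewrite !andbF.
  rewrite untE // !sigmaE e nneg_unmark //.
  by rewrite (_ : _ == _ = true) //; apply/eqP; lia.
apply/negP=> /and4P[/eqP sg _ /forallP H _].
have := H c; rewrite sc eqxx eqb_id; case sc': (markers S' c) => // _.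
have e : markers S = unmark (markers S') c.
  apply/ffunP=> d; rewrite ffunE; move/eqP: (H d).
  by case: (eqVneq d c) => [->|_] /=; [rewrite sc|]; case: (markers S' _); case: (markers S _).
by move: sg; rewrite !sigmaE e nneg_unmark //; lia.
Qed.

(** If [C] is the circle being split, exactly one half is negative and either choice is allowed;
    otherwise [C] persists. Circles of a state being disjoint, both cases amount to inclusion. *)
Lemma incident_split S S' c C C' : markers S c -> splits (markers S) c ->
  markers S' = unmark (markers S) c -> negative S = [set C] -> negative S' = [set C'] ->
  incident S S' c = (C' \subset C).
Proof.
move=> sc spl mS' nS nS'.
have Cs : C \in circles (markers S) by apply: (subsetP (negative_sub S)); rewrite nS set11.
have Cs' : C' \in circles (markers S').
  by apply: (subsetP (negative_sub S')); rewrite nS' set11.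
have card := card_circles_unmark sc; rewrite spl in card.
have ag : agree_off c (markers S) (markers S') by rewrite mS'; apply: unmark_agree.
rewrite incidentE sc mS' eqxx eq_sym jdeg_eq nS nS' !cards1 mS' nneg_unmark // card.
rewrite (_ : _ == _ = true) /=; last by apply/eqP; lia.
rewrite /same_untouched nS nS'.
have refine := circle_at_refine ag spl.
apply/forallP/idP => [H|C'C Z].
  case tC: (touches C c); last first.
    by have := H C; rewrite Cs tC /= !inE eqxx => /eqP/esym/eqP <-.
  case tC': (touches C' c); last first.
    have [x xC'] := circle_neq0 Cs'.
    have eC' := circlesP Cs' xC'; move/negbT: tC'; rewrite eC' => tC'.
    have eZ := untouched_circle_at (agree_offC ag) tC'.
    have := H C'; rewrite eC' -eZ circle_at_in eZ tC' -eC' /= !inE eqxx => /eqP/eqP->.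
    exact: subxx.
  have [x xC'] := circle_neq0 Cs'.
  have eC : C = circle_at (markers S) (end0 c).
    have := tC; rewrite (touchesE _ Cs) => /orP[] h; first exact: circlesP h.
    by rewrite (circlesP Cs h); apply/esym/circle_atP.
  have := tC'; rewrite (touchesE _ Cs') => /orP[] h; rewrite (circlesP Cs' h) eC //.
  by rewrite (circle_atP _ _ _ spl).
apply/implyP=> Zs; apply/implyP=> nZ; rewrite !inE; apply/eqP.
have [x xC'] := circle_neq0 Cs'.
apply/idP/idP => /eqP eZ.
  rewrite eZ in nZ *; have xC := subsetP C'C _ xC'.
  rewrite (circlesP Cs xC) in nZ *; rewrite (circlesP Cs' xC').
  by rewrite (untouched_circle_at ag nZ).
by rewrite (circlesP Zs (x := x)) ?eZ // (circlesP Cs (subsetP C'C _ xC')).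
Qed.

(** A negative circle away from [c] would survive in [S'], where all circles are positive; one at
    [c] is absorbed by the positive circle it merges with. *)
Lemma incident_merge S S' c C : markers S c -> ~~ splits (markers S) c ->
  markers S' = unmark (markers S) c -> negative S = [set C] -> negative S' = set0 ->
  incident S S' c = touches C c.
Proof.
move=> sc /negbTE spl mS' nS nS'.
have Cs : C \in circles (markers S) by apply: (subsetP (negative_sub S)); rewrite nS set11.
have card := card_circles_unmark sc; rewrite spl in card.
rewrite incidentE sc mS' eqxx eq_sym jdeg_eq nS nS' cards0 cards1 mS' nneg_unmark // card.
rewrite (_ : _ == _ = true) /=; last by apply/eqP; lia.
rewrite /same_untouched nS nS'.
apply/forallP/idP => [H|tC Z].
  by apply: contraT => tC; have := H C; rewrite Cs tC !inE eqxx.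
apply/implyP=> Zs; apply/implyP=> nZ; rewrite !inE; apply/eqP/negbTE.
by apply: contraNneq nZ => ->.
Qed.

Lemma incident_positive S S' c : markers S c -> splits (markers S) c ->
  markers S' = unmark (markers S) c -> negative S = set0 -> negative S' = set0 ->
  incident S S' c.
Proof.
move=> sc spl mS' nS nS'.
have card := card_circles_unmark sc; rewrite spl in card.
rewrite incidentE sc mS' eqxx eq_sym jdeg_eq nS nS' cards0 mS' nneg_unmark // card.
rewrite (_ : _ == _ = true) /=; last by apply/eqP; lia.
apply/forallP=> Z; apply/implyP=> _; apply/implyP=> _; by rewrite nS nS' !inE.
Qed.

Section Degree.
Variables i j : int.
Notation mk := (fun S : estate_deg D i j => markers (val S)).
Notation ng := (fun S : estate_deg D i j => negative (val S)).

Lemma estate_deg_inj (S S' : estate_deg D i j) : mk S = mk S' -> ng S = ng S' -> S = S'.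
Proof. by move=> em en; apply/val_inj/estate_inj. Qed.

Variables (t : kstate D) (m : nat).
Hypotheses (it : (n%:Z - 2 * (nneg t)%:Z)%R = i)
  (jt : (i + 2 * #|circles t|%:Z - 4 * m%:Z)%R = j).

Lemma card_negative_deg (S : estate_deg D i j) : mk S = t -> #|ng S| = m.
Proof.
move=> e; have /andP[_ /eqP jS] := valP S; move: jS jt it; rewrite /jdeg tauE sigmaE e; lia.
Qed.

Lemma estate_deg_exists (M : {set {set site D}}) : M \subset circles t -> #|M| = m ->
  exists S : estate_deg D i j, mk S = t /\ ng S = M.
Proof.
move=> /estate_exists[S [eS nS]] cM.
have deg : (sigma S == i) && (jdeg S == j).
  by rewrite /jdeg tauE sigmaE nS eS cM it eqxx /= -jt; apply/eqP; ring.
by exists (Sub S deg); rewrite !SubK.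
Qed.

(** The bidegree fixes the number of negative circles once the markers are given, so sums over
    enhanced states become sums over sets of circles of one state. *)
Lemma sum_estates (R : nmodType) (F : {set {set site D}} -> R) :
  (\sum_(S : estate_deg D i j | mk S == t) F (ng S)
   = \sum_(M : {set {set site D}} | (M \subset circles t) && (#|M| == m)) F M)%R.
Proof.
rewrite (partition_big ng (fun M => (M \subset circles t) && (#|M| == m))) /=; last first.
  move=> S /eqP eS; rewrite -[X in _ \subset circles X]eS negative_sub /=.
  by rewrite card_negative_deg.
apply: eq_bigr => M /andP[Ms /eqP cM]; have [S [eS nS]] := estate_deg_exists Ms cM.
rewrite (big_pred1 S) ?nS // => S'; apply/andP/eqP => [[/eqP e1 /eqP e2]|->].
  by apply: estate_deg_inj; rewrite ?e1 ?e2 ?eS ?nS.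
by rewrite eS nS.
Qed.
End Degree.

Lemma sum_estates0 i j t (R : nmodType) (F : {set {set site D}} -> R) :
  (n%:Z - 2 * (nneg t)%:Z)%R = i -> (i + 2 * #|circles t|%:Z)%R = j ->
  (\sum_(S : estate_deg D i j | markers (val S) == t) F (negative (val S)) = F set0)%R.
Proof.
move=> it jt; rewrite (sum_estates (m := 0) it) ?mulr0 ?subr0 // (big_pred1 set0) // => M.
by rewrite /= cards_eq0 andbC; case: eqP => // ->; rewrite sub0set.
Qed.

Lemma sum_estates1 i j t (R : nmodType) (F : {set {set site D}} -> R) :
  (n%:Z - 2 * (nneg t)%:Z)%R = i -> (i + 2 * #|circles t|%:Z - 4)%R = j ->
  (\sum_(S : estate_deg D i j | markers (val S) == t) F (negative (val S))
   = \sum_(C in circles t) F [set C])%R.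
Proof.
move=> it jt; rewrite (sum_estates (m := 1) it) //.
rewrite (eq_bigl (fun M => M \in set1 @: circles t)).
  by rewrite big_imset //= => C C' _ _; apply: set1_inj.
move=> M; apply/andP/imsetP => [[Ms /cards1P[C eM]]|[C Ct ->]].
  by exists C => //; apply: (subsetP Ms); rewrite eM set11.
by rewrite sub1set Ct cards1.
Qed.
End Estates.

(** * The square of the differential *)

Section SquareZero.
Variable D : link_diagram.
Local Notation n := (ncross D).
Implicit Types (s t : kstate D) (c f : 'I_n) (C : {set site D}).

Lemma sum_nat_eq (I : finType) (A : {set I}) (a : I) (F : I -> nat) : a \in A ->
  \sum_(x in A) (x == a) * F x = F a.
Proof.
move=> aA; rewrite (bigD1 a) //= eqxx mul1n big1 ?addn0 // => x /andP[_ /negPf->].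
by rewrite mul0n.
Qed.

(** The number of strands of the crossing lying on [C]. It is 2 when both do, and this multiplicity
    counts the intermediate states below. *)
Definition nends C c : nat := (end0 c \in C) + (end2 c \in C).

Lemma touches_nends s C c : C \in circles s -> ~~ splits s c -> touches C c = nends C c :> nat.
Proof.
move=> Cs nspl; rewrite (touchesE _ Cs) /nends.
case e0: (end0 c \in C) => //; case e2: (end2 c \in C) => //.
by case/negP: nspl; rewrite /splits -(circlesP Cs e0).
Qed.

Variables (i j : int) (S S'' : estate D) (C : {set site D}).
Hypotheses (iS : (sigma S - 2)%R = i) (jS : jdeg S = j) (jS'' : jdeg S'' = j).
Hypothesis nS : negative S = [set C].
Local Notation s := (markers S).

Let Cs : C \in circles s.
Proof. by apply: (subsetP (negative_sub S)); rewrite nS set11. Qed.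

(** Intermediate enhanced states when [c] is flipped before [c'], counted without sign. The two
    orders carry opposite signs, so the vanishing of the square of the differential amounts to the
    symmetry of this number. *)
Definition paths c c' : nat :=
  \sum_(S' : estate_deg D i j) (incident S (val S') c && incident (val S') S'' c').

Section Count.
Variables c c' : 'I_n.
Hypotheses (sc : s c) (sc' : s c') (cc' : c != c').
Hypothesis mS'' : markers S'' = unmark (unmark s c) c'.
Let t := unmark s c.

Let tc' : t c'. Proof. by rewrite ffunE eq_sym cc'. Qed.

Let it : (n%:Z - 2 * (nneg t)%:Z)%R = i.
Proof. by rewrite /t nneg_unmark // -iS sigmaE; lia. Qed.

Lemma paths_restrict :
  paths c c' = \sum_(S' : estate_deg D i j | markers (val S') == t)
                 (incident S (val S') c && incident (val S') S'' c').
Proof.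
rewrite [RHS]big_mkcond; apply: eq_bigr => S' _; case: ifP => // /negbT ne.
by rewrite incidentE (negPf ne) andbF.
Qed.

Lemma paths_split_gen (g : {set site D} -> bool) : splits s c ->
  (forall (S' : estate D) C', markers S' = t -> negative S' = [set C'] ->
     C' \in circles t -> incident S' S'' c' = g C') ->
  paths c c' = \sum_(C' in circles t) ((C' \subset C) && g C').
Proof.
move=> spl gE; rewrite paths_restrict.
have card := card_circles_unmark sc; rewrite spl -/t in card.
have jt : (i + 2 * #|circles t|%:Z - 4)%R = j.
  by rewrite -iS -jS /jdeg tauE nS cards1 card; lia.
transitivity (\sum_(C' in circles t) \sum_(Z in [set C']) ((Z \subset C) && g Z : nat)); last first.
  by apply: eq_bigr => C' _; rewrite big_set1.
rewrite -(sum_estates1 (fun M => \sum_(Z in M) ((Z \subset C) && g Z)) it jt).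
apply: eq_bigr => S' /eqP mS'.
have /eqP/cards1P[C' nS'] : #|negative (val S')| = 1.
  by apply: (card_negative_deg it _ mS'); rewrite -jt; lia.
have Ct : C' \in circles t.
  by rewrite -mS'; apply: (subsetP (negative_sub _)); rewrite nS' set11.
by rewrite nS' big_set1 (incident_split sc spl mS' nS nS') (gE _ _ mS' nS' Ct).
Qed.

Lemma paths_split_split C'' : splits s c -> splits t c' -> negative S'' = [set C''] ->
  paths c c' = (C'' \subset C).
Proof.
move=> spl spl' nS''; rewrite (paths_split_gen (g := fun C' => C'' \subset C')) //; last first.
  by move=> S' C' mS' nS' _; apply: incident_split => //; rewrite mS'.
have Cs'' : C'' \in circles (markers S'').
  by apply: (subsetP (negative_sub S'')); rewrite nS'' set11.
have [x xC''] := circle_neq0 Cs''.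
have ag : agree_off c' t (markers S'') by rewrite mS''; apply: unmark_agree.
have sub1 := circle_at_refine (@unmark_agree _ s c) spl.
have sub2 := circle_at_refine ag spl'.
transitivity (\sum_(C' in circles t) (C' == circle_at t x) * (C' \subset C)).
  apply: eq_bigr => C' Ct; rewrite andbC -mulnb; congr (_ * _)%N.
  congr nat_of_bool; apply/idP/eqP => [/subsetP/(_ x xC'')|->]; first exact: circlesP.
  by rewrite (circlesP Cs'' xC'').
rewrite (sum_nat_eq (fun C' => C' \subset C : nat)) ?circle_at_in //; congr nat_of_bool.
apply/idP/idP => [|/subsetP/(_ x xC'') xC]; last first.
  by rewrite (circlesP Cs xC) sub1.
by apply: subset_trans; rewrite (circlesP Cs'' xC'').
Qed.

Lemma paths_split_merge : splits s c -> ~~ splits t c' -> negative S'' = set0 ->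
  paths c c' = nends C c'.
Proof.
move=> spl nspl' nS''; rewrite (paths_split_gen (g := fun C' => touches C' c')) //; last first.
  by move=> S' C' mS' nS' _; apply: incident_merge => //; rewrite mS'.
have ag := @unmark_agree _ s c.
transitivity (\sum_(C' in circles t) ((C' == circle_at t (end0 c')) * (C' \subset C)
     + (C' == circle_at t (end2 c')) * (C' \subset C))).
  apply: eq_bigr => C' Ct; rewrite andbC -mulnb -mulnDl; congr (_ * _)%N.
  rewrite (touches_nends Ct nspl') /nends.
  have tE y : (y \in C') = (C' == circle_at t y).
    by apply/idP/eqP => [/(circlesP Ct)|->] //; apply: circle_at_id.
  by rewrite !tE.
rewrite big_split /= !(sum_nat_eq (fun C' => C' \subset C : nat)) ?circle_at_in //.
by rewrite !(sub_circle_at ag spl).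
Qed.

Lemma paths_merge_split : ~~ splits s c -> splits t c' -> negative S'' = set0 ->
  paths c c' = nends C c.
Proof.
move=> nspl spl' nS''; rewrite paths_restrict -(touches_nends Cs nspl).
have card := card_circles_unmark sc; rewrite (negPf nspl) -/t in card.
have jt : (i + 2 * #|circles t|%:Z)%R = j.
  by rewrite -iS -jS /jdeg tauE nS cards1 card; lia.
rewrite -[RHS](sum_estates0 (fun _ => (touches C c : nat)) it jt).
apply: eq_bigr => S' /eqP mS'.
have nS' : negative (val S') = set0.
  apply/eqP; rewrite -cards_eq0; apply/eqP.
  by apply: (card_negative_deg it _ mS'); rewrite -jt; lia.
rewrite (incident_merge sc nspl mS' nS nS') (incident_positive _ _ _ nS' nS'') ?andbT //.
- by rewrite mS'.
- by rewrite mS'.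
- by rewrite mS'' mS'.
Qed.

Lemma paths_card : #|circles s| + 2 * #|negative S''| = #|circles (markers S'')|.
Proof.
have /eqP : jdeg S == jdeg S'' by rewrite jS jS''.
move/eqP; rewrite jdeg_eq nS cards1 mS'' !nneg_unmark //; lia.
Qed.
End Count.

Lemma unmarkC c c' : unmark (unmark s c) c' = unmark (unmark s c') c.
Proof. by apply/ffunP=> d; rewrite !ffunE; do 2!case: (d == _). Qed.

Lemma paths0 c c' :
  ~~ [&& s c, s c', c != c' & markers S'' == unmark (unmark s c) c'] -> paths c c' = 0.
Proof.
move=> H; rewrite /paths big1 // => S' _; apply/eqP; rewrite eqb0.
apply: contra H => /andP[]; rewrite !incidentE => /and4P[-> /eqP -> _ _].
by rewrite ffunE => /and4P[/andP[ne ->] -> _ _]; rewrite eq_sym ne.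
Qed.

(** For [c'] to turn from merging to splitting when [c] is flipped, both circles at [c'] must touch
    [c]: the two crossings join the same pair of circles. *)
Lemma nends_merge_merge c c' : ~~ splits s c -> ~~ splits s c' -> s c ->
  splits (unmark s c) c' -> nends C c = nends C c'.
Proof.
move=> nspl nspl' sc spl'; set t := unmark s c in spl'.
have ag := @unmark_agree _ s c.
have touched x y : x \in circle_at t y -> x \notin circle_at s y -> touches (circle_at s y) c.
  move=> xy nxy; apply: contraT => nt.
  by move: nxy; rewrite -(untouched_circle_at ag nt) xy.
have T0 := touched _ _ spl' nspl'.
have T2 : touches (circle_at s (end2 c')) c.
  apply: (touched (end0 c')); first by apply/circle_atP/esym/circle_atP.
  by apply: contra nspl' => /circle_atP e; apply/circle_atP.
have memE x y : (x \in circle_at s y) = (circle_at s y == circle_at s x).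
  by apply/circle_atP/eqP.
have [y eC] : exists y, C = circle_at s y by case/imsetP: Cs => y _ ->; exists y.
move: nspl nspl' T0 T2; rewrite /nends /splits !touches_circle_at eC !memE.
move: (circle_at s (end0 c)) (circle_at s (end2 c)) => A B.
move: (circle_at s (end0 c')) (circle_at s (end2 c')) => A' B'.
move=> AB A'B' /orP[] /eqP e1 /orP[] /eqP e2; move: A'B'; rewrite e1 e2 ?eqxx // => _.
by rewrite addnC.
Qed.

(** For [c'] to turn from splitting to merging, its circle must be the one cut at [c]: all strands
    of the two crossings lie on one circle. *)
Lemma nends_split_split c c' : splits s c -> splits s c' -> s c ->
  ~~ splits (unmark s c) c' -> nends C c = nends C c'.
Proof.
move=> spl spl' sc nspl'; set t := unmark s c in nspl'.
have ag := @unmark_agree _ s c.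
have T0 : touches (circle_at s (end0 c')) c.
  apply: contraT => nt; case/negP: nspl'.
  by rewrite /splits (untouched_circle_at ag nt).
have memE x y : (x \in circle_at s y) = (circle_at s y == circle_at s x).
  by apply/circle_atP/eqP.
have [y eC] : exists y, C = circle_at s y by case/imsetP: Cs => y _ ->; exists y.
move: T0; rewrite touches_circle_at /nends eC !memE.
rewrite -(circle_atP _ _ _ spl) -(circle_atP _ _ _ spl') orbb => /eqP ->.
by [].
Qed.

Lemma pathsC c c' : paths c c' = paths c' c.
Proof.
case: (boolP [&& s c, s c', c != c' & markers S'' == unmark (unmark s c) c']); last first.
  move=> H; rewrite !paths0 //; move: H; rewrite unmarkC [c' == c]eq_sym.
  by apply: contra => /and4P[-> -> -> ->].
case/and4P=> sc sc' cc' /eqP mS''.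
have mS''C : markers S'' = unmark (unmark s c') c by rewrite unmarkC.
have c'c : c' != c by rewrite eq_sym.
have tc : unmark s c c' by rewrite ffunE c'c.
have tc' : unmark s c' c by rewrite ffunE cc'.
(* Each flip changes the number of circles by one, and the bidegree then makes the number of splits
   exceed the number [m] of negative circles of [S''] by one. Hence [m] is 0 or 1 and two successive
   merges never occur. *)
have arith (p q r m : nat) (b1 b2 : bool) :
    (if b1 then q = p.+1 else p = q.+1) -> (if b2 then r = q.+1 else q = r.+1) ->
    p + 2 * m = r -> b1 + b2 = m.+1.
  by case: b1; case: b2 => /=; lia.
have E1 := arith _ _ _ _ _ _ (card_circles_unmark sc) (card_circles_unmark tc).
have E2 := arith _ _ _ _ _ _ (card_circles_unmark sc') (card_circles_unmark tc').
rewrite -mS'' in E1; rewrite -mS''C in E2.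
have := paths_card sc sc' cc' mS'' => E3; have {}E1 := E1 _ E3; have {E3}E2 := E2 _ E3.
have {arith}E m : #|negative S''| = m -> splits s c + splits (unmark s c) c' = m.+1 /\
    splits s c' + splits (unmark s c') c = m.+1 by move=> <-; split.
have cards := erefl #|negative S''|; move: {2}#|negative S''| cards => [|[|m]] cards.
- have nS'' : negative S'' = set0 by apply/eqP; rewrite -cards_eq0 cards.
  have [] := E _ cards; case spl: (splits s c); case spl': (splits s c');
    case spt: (splits (unmark s c) c'); case spt': (splits (unmark s c') c) => //= _ _.
  + rewrite (paths_split_merge sc sc' cc' mS'' spl (negbT spt) nS'').
    rewrite (paths_split_merge sc' sc c'c mS''C spl' (negbT spt') nS'').
    exact/esym/(nends_split_split spl spl' sc (negbT spt)).
  + rewrite (paths_split_merge sc sc' cc' mS'' spl (negbT spt) nS'').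
    by rewrite (paths_merge_split sc' sc c'c mS''C (negbT spl') spt' nS'').
  + rewrite (paths_merge_split sc sc' cc' mS'' (negbT spl) spt nS'').
    by rewrite (paths_split_merge sc' sc c'c mS''C spl' (negbT spt') nS'').
  rewrite (paths_merge_split sc sc' cc' mS'' (negbT spl) spt nS'').
  rewrite (paths_merge_split sc' sc c'c mS''C (negbT spl') spt' nS'').
  exact: nends_merge_merge (negbT spl) (negbT spl') sc spt.
- have /eqP/cards1P[C'' nS''] := cards.
  have [] := E _ cards; case spl: (splits s c); case spl': (splits s c');
    case spt: (splits (unmark s c) c'); case spt': (splits (unmark s c') c) => //= _ _.
  by rewrite (paths_split_split sc sc' cc' mS'' spl spt nS'')
             (paths_split_split sc' sc c'c mS''C spl' spt' nS'').
by have [+ _] := E _ cards; case: splits; case: splits.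
Qed.

Lemma tsign_unmark s' c c' : s' c ->
  #|[set d : 'I_n | ~~ unmark s' c d & (c' < d)%N]|
  = ((c' < c) + #|[set d : 'I_n | ~~ s' d & (c' < d)%N]|)%N.
Proof.
move=> sc; rewrite (cardsD1 c) !inE ffunE eqxx /=; congr (_ + _)%N.
apply: eq_card => d; rewrite !inE ffunE.
by case: (eqVneq d c) => [->|] //=; rewrite sc.
Qed.

Lemma dcoef_dcoef :
  (\sum_(S' : estate_deg D i j) dcoef S (val S') * dcoef (val S') S'' = 0 :> int)%R.
Proof.
pose sg c c' := ((-1) ^+ tsign S c *
   (-1) ^+ #|[set d : 'I_n | ~~ unmark s c d & (c' < d)%N]| : int)%R.
transitivity (\sum_c \sum_c' sg c c' * (paths c c')%:R)%R.
  under eq_bigr => S' _.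
    rewrite /dcoef (big_mkcond (incident S _)) (big_mkcond (incident _ S'')) big_distrlr /=.
    over.
  rewrite exchange_big; apply: eq_bigr => c _; rewrite exchange_big; apply: eq_bigr => c' _.
  rewrite /paths natr_sum mulr_sumr; apply: eq_bigr => S' _.
  case i1: (incident S _ c); rewrite ?mul0r ?mulr0 //=.
  case i2: (incident _ S'' c'); rewrite ?mulr0 //= mulr1 /sg.
  move: i1; rewrite incidentE => /and4P[_ /eqP <- _ _]; by [].
(* Exchanging the roles of [c] and [c'] will reproduce the sum with the opposite sign. *)
have selfN (x : int) : x = (- x)%R -> x = 0%R by lia.
apply: selfN.
rewrite [RHS]raddf_sum exchange_big /=; apply: eq_bigr => c _.
rewrite raddf_sum; apply: eq_bigr => c' _ /=; rewrite pathsC -mulNr.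
case: (boolP [&& s c, s c', c != c' & markers S'' == unmark (unmark s c) c']); last first.
  by move/paths0->; rewrite !mulr0.
case/and4P=> sc sc' cc' _; congr (_ * _)%R; rewrite /sg !tsign_unmark // !exprD.
rewrite -![#|[set d | _ & _]|]/(tsign S _).
have [lt|lt|/val_inj e] := ltngtP c c'; last by rewrite e eqxx in cc'.
  by rewrite expr0 expr1 mul1r mulN1r mulrN mulrC.
by rewrite expr0 expr1 mul1r mulN1r mulrN opprK mulrC.
Qed.
End SquareZero.

(** * The complex in degrees n - 2 and n - 4 *)

Section Boundary.
Variable D : link_diagram.
Local Notation n := (ncross D).
Hypothesis adequate : plus_adequate D.
Implicit Types (e f c : 'I_n) (C : {set site D}).

Notation s0 := (splus D).
Definition mark1 e := unmark s0 e.
Definition mark2 e f := unmark (mark1 e) f.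
Definition ends e : {set {set site D}} := mends (state_graph s0) e.

Lemma endsE e : ends e = [set circle_at s0 (end0 e); circle_at s0 (end2 e)].
Proof. by []. Qed.

Lemma splusE e : s0 e. Proof. by rewrite ffunE. Qed.

Lemma plus_nsplits e : ~~ splits s0 e.
Proof.
move/forallP/(_ e): adequate; apply: contra => /circle_atP eC.
by rewrite -/(ends e) endsE eC setUid cards1.
Qed.

Lemma mark1E e c : mark1 e c = (c != e). Proof. by rewrite !ffunE andbT. Qed.

Lemma nneg_mark1 e : nneg (mark1 e) = 1.
Proof.
rewrite nneg_unmark ?splusE //; congr _.+1.
by apply: eq_card0 => c; rewrite !inE ffunE.
Qed.

Lemma nneg_mark2 e f : e != f -> nneg (mark2 e f) = 2.
Proof. by move=> ef; rewrite nneg_unmark ?nneg_mark1 // mark1E eq_sym. Qed.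

Lemma card_mark1 e : #|circles s0| = #|circles (mark1 e)|.+1.
Proof. by have := card_circles_unmark (splusE e); rewrite (negPf (plus_nsplits e)). Qed.

Lemma mark2C e f : mark2 e f = mark2 f e.
Proof. by apply/ffunP=> c; rewrite !ffunE !andbT andbC. Qed.

Lemma merge_coarsen e x y : connect (smooth_adj s0) x y -> connect (smooth_adj (mark1 e)) x y.
Proof.
have ag := agree_offC (@unmark_agree _ s0 e).
have join : end2 e \in circle_at (mark1 e) (end0 e).
  by rewrite unmark_ends ?splusE ?plus_nsplits.
rewrite -!mem_circle_at; exact: (subsetP (circle_at_refine ag join x)).
Qed.

(** Adequacy puts the two strands of [f] on different circles of [s0]; flipping [e] merges just two
    circles, so it brings the strands together only when these are the circles at [e]. *)
Lemma splits_mark1 e f : splits (mark1 e) f = (ends e == ends f).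
Proof.
have ag := @unmark_agree _ s0 e.
have AB : circle_at s0 (end0 e) != circle_at s0 (end2 e).
  by rewrite eq_circle_at -mem_circle_at plus_nsplits.
have A'B' : circle_at s0 (end0 f) != circle_at s0 (end2 f).
  by rewrite eq_circle_at -mem_circle_at plus_nsplits.
apply/idP/eqP => [spl|].
  have touched x y : x \in circle_at (mark1 e) y -> x \notin circle_at s0 y ->
      touches (circle_at s0 y) e.
    move=> xy nxy; apply: contraT => nt.
    by move: nxy; rewrite -(untouched_circle_at ag nt) xy.
  have T0 := touched _ _ spl (plus_nsplits f).
  have T2 : touches (circle_at s0 (end2 f)) e.
    apply: (touched (end0 f)); first by apply/circle_atP/esym/circle_atP.
    by apply: contra (plus_nsplits f) => /circle_atP h; apply/circle_atP.
  move: A'B' T0 T2; rewrite !touches_circle_at !endsE.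
  by move=> A'B' /orP[] /eqP e1 /orP[] /eqP e2; move: A'B'; rewrite e1 e2 ?eqxx // setUC.
have join : connect (smooth_adj (mark1 e)) (end0 e) (end2 e).
  by rewrite -mem_circle_at unmark_ends ?splusE ?plus_nsplits.
have con x : circle_at s0 x \in ends e -> connect (smooth_adj (mark1 e)) (end0 e) x.
  rewrite endsE !inE !eq_circle_at => /orP[] h.
    by rewrite smooth_sym merge_coarsen.
  by apply: connect_trans join _; rewrite smooth_sym merge_coarsen.
move=> ef; rewrite /splits mem_circle_at.
have := con (end0 f); have := con (end2 f); rewrite ef endsE set21 set22.
by move=> /(_ isT) h2 /(_ isT) h0; apply: connect_trans h2; rewrite smooth_sym.
Qed.

Definition jdeg0 : int := (n%:Z + 2 * #|circles s0|%:Z - 8)%R.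
Notation chain1 := (chain D (n%:Z - 4 + 2)%R jdeg0).
Notation chain2 := (chain D (n%:Z - 4)%R jdeg0).

Lemma deg1 e : (n%:Z - 2 * (nneg (mark1 e))%:Z = n%:Z - 4 + 2)%R.
Proof. by rewrite nneg_mark1; lia. Qed.

Lemma jdeg1 e : (n%:Z - 4 + 2 + 2 * #|circles (mark1 e)|%:Z - 4 = jdeg0)%R.
Proof. by rewrite /jdeg0 (card_mark1 e); lia. Qed.

Lemma deg2 e f : e != f -> (n%:Z - 2 * (nneg (mark2 e f))%:Z = n%:Z - 4)%R.
Proof. by move=> ef; rewrite nneg_mark2. Qed.

Lemma card_mark2 e f : e != f -> (#|circles (mark2 e f)|.+2 = #|circles s0| + 2 * (ends e == ends f))%N.
Proof.
move=> ef; have me : mark1 e f by rewrite mark1E eq_sym.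
have := card_circles_unmark me; rewrite splits_mark1 (card_mark1 e) -/(mark2 e f).
by case: eqP => _; lia.
Qed.

Lemma marker_nneg1 (s : kstate D) : nneg s = 1 -> exists e, s = mark1 e.
Proof.
move/eqP/cards1P=> [e ee]; exists e; apply/ffunP=> c; rewrite mark1E.
by move/setP/(_ c): ee; rewrite !inE; case: eqP => _; case: (s c).
Qed.

Lemma marker_nneg2 (s : kstate D) : nneg s = 2 -> exists e f, (e < f)%N /\ s = mark2 e f.
Proof.
move/eqP/cards2P=> [e [f [ef eE]]].
have sE e' f' : [set c | ~~ s c] = [set e'; f'] -> s = mark2 e' f'.
  move=> E; apply/ffunP=> c; rewrite ffunE mark1E.
  by move/setP/(_ c): E; rewrite !inE; do 2 case: eqP => _; case: (s c).
have [lt|lt|/val_inj h] := ltngtP e f; last by rewrite h eqxx in ef.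
  by exists e, f; split=> //; apply: sE.
by exists f, e; split=> //; apply: sE; rewrite setUC.
Qed.

Lemma estate1 (S : estate_deg D (n%:Z - 4 + 2)%R jdeg0) :
  exists e C, [/\ markers (val S) = mark1 e, negative (val S) = [set C] & C \in circles (mark1 e)].
Proof.
have [e me] : exists e, markers (val S) = mark1 e.
  by apply: marker_nneg1; have /andP[/eqP + _] := valP S; rewrite sigmaE; lia.
have /eqP/cards1P[C nS] : #|negative (val S)| = 1.
  apply: (card_negative_deg (deg1 e) _ me); rewrite -(jdeg1 e); lia.
exists e, C; split=> //; rewrite -me; apply: (subsetP (negative_sub _)).
by rewrite nS set11.
Qed.

Lemma estate2 (S : estate_deg D (n%:Z - 4)%R jdeg0) :
  exists e f, [/\ (e < f)%N, markers (val S) = mark2 e f &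
    if ends e == ends f then exists2 C, negative (val S) = [set C] & C \in circles (mark2 e f)
    else negative (val S) = set0].
Proof.
have [e [f [ef me]]] : exists e f, (e < f)%N /\ markers (val S) = mark2 e f.
  by apply: marker_nneg2; have /andP[/eqP + _] := valP S; rewrite sigmaE; lia.
exists e, f; split=> //.
have ef' : e != f by apply: contraTneq ef => ->; rewrite ltnn.
have cN := card_mark2 ef'.
have cS : #|negative (val S)| = (ends e == ends f).
  apply: (card_negative_deg (deg2 ef') _ me); move: cN; rewrite /jdeg0.
  by case: eqP => _ /=; lia.
case: ifP cS => par /= cS.
  have /eqP/cards1P[C nS] := cS.
  exists C => //; rewrite -me; apply: (subsetP (negative_sub _)); by rewrite nS set11.
by apply/eqP; rewrite -cards_eq0 cS.
Qed.

Definition circle_const e (N : site D -> int) :=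
  forall x y, connect (smooth_adj (mark1 e)) x y -> N x = N y.

(** Values are indexed by sites rather than circles: the states [mark1 e] have different circles for
    different [e], whereas a site makes sense in all of them and lets the rows of [N] be
    compared. *)
Definition represents (y : chain1) (N : 'I_n -> site D -> int) :=
  forall S e C z, markers (val S) = mark1 e -> negative (val S) = [set C] -> z \in C ->
    y S = N e z.

Lemma mark1_inj e f : mark1 e = mark1 f -> e = f.
Proof. by move/ffunP/(_ e); rewrite !mark1E eqxx; case: eqP. Qed.

Lemma represents_fun y : exists2 N, (forall e, circle_const e (N e)) & represents y N.
Proof.
(* At most one term: the only state counted is the one whose negative circle passes through [z]. The
   sum spares choosing it. *)
exists (fun e z => (\sum_(S : estate_deg D (n%:Z - 4 + 2)%R jdeg0 |
    (markers (val S) == mark1 e) && (z \in cover (negative (val S)))) y S)%R).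
  move=> e x z xz; apply: eq_bigl => S; case: eqP => //= me.
  have [e' [C [me' -> Ce']]] := estate1 S.
  rewrite cover1 -(mark1_inj (etrans (esym me) me')) in Ce' *.
  case/imsetP: Ce' => w _ ->; rewrite !mem_circle_at.
  exact: (same_connect_r (@smooth_sym _ _) xz).
move=> S e C z me nS zC; rewrite (big_pred1 S) // => S'.
apply/andP/eqP => [[/eqP me' zS']|->]; last by rewrite me nS cover1.
apply: estate_deg_inj; rewrite ?me ?me' //.
have [e1 [C1 [me1 nS1 C1e]]] := estate1 S'; rewrite nS1 cover1 in zS' *; rewrite nS.
have {me1} e1e := mark1_inj (etrans (esym me1) me'); rewrite {e1}e1e in C1e.
have Ce : C \in circles (mark1 e).
  by rewrite -me; apply: (subsetP (negative_sub _)); rewrite nS set11.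
by rewrite (circlesP C1e zS') (circlesP Ce zC).
Qed.

Lemma represents_chain N : (forall e, circle_const e (N e)) -> exists y, represents y N.
Proof.
move=> Nc; pose y : {ffun estate_deg D (n%:Z - 4 + 2)%R jdeg0 -> int} := [ffun S =>
  if [pick p : 'I_n * site D | (markers (val S) == mark1 p.1) && (p.2 \in cover (negative (val S)))]
  is Some p then N p.1 p.2 else 0%R].
exists y => S e C z me nS zC; rewrite ffunE; case: pickP => [[e' z'] /=|/(_ (e, z))]; last first.
  by rewrite /= me nS cover1 zC eqxx.
rewrite me nS cover1 => /andP[/eqP/mark1_inj <- z'C].
have Ce : C \in circles (mark1 e).
  by rewrite -me; apply: (subsetP (negative_sub _)); rewrite nS set11.
by apply: Nc; rewrite -mem_circle_at -(circlesP Ce z'C).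
Qed.

Section Diff.
Variables (y : chain1) (N : 'I_n -> site D -> int).
Hypotheses (Nc : forall e, circle_const e (N e)) (yN : represents y N).
Notation dy := (@diff D (n%:Z - 4 + 2)%R (n%:Z - 4)%R jdeg0 y).

Definition circle_value e C : int := if [pick z in C] is Some z then N e z else 0%R.

Lemma circle_valueE e z : circle_value e (circle_at (mark1 e) z) = N e z.
Proof.
rewrite /circle_value; case: pickP => [z'|/(_ z)]; last by rewrite circle_at_id.
by rewrite mem_circle_at => zz'; apply/esym/Nc.
Qed.

Definition partial S' e f : int :=
  (\sum_(S : estate_deg D (n%:Z - 4 + 2)%R jdeg0 | markers (val S) == mark1 e)
    y S * (incident (val S) S' f)%:R)%R.

Lemma partialE (S' : estate D) e f (g : {set site D} -> bool) :
  (forall S C, markers S = mark1 e -> negative S = [set C] -> C \in circles (mark1 e) ->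
     incident S S' f = g C) ->
  partial S' e f = (\sum_(C in circles (mark1 e)) (g C)%:R * circle_value e C)%R.
Proof.
move=> gE; transitivity (\sum_(C in circles (mark1 e)) \sum_(Z in [set C]) (g Z)%:R * circle_value e Z)%R; last first.
  by apply: eq_bigr => C _; rewrite big_set1.
rewrite -(sum_estates1 (fun M => \sum_(Z in M) (g Z)%:R * circle_value e Z)%R (deg1 e) (jdeg1 e)).
apply: eq_bigr => S /eqP mS; have [e' [C [mS' nS Ce]]] := estate1 S.
have ee := mark1_inj (etrans (esym mS') mS); rewrite {e' mS'}ee in Ce.
rewrite nS big_set1 (gE _ _ mS nS Ce) mulrC; congr (_ * _)%R.
have [z zC] := circle_neq0 Ce; rewrite (yN mS nS zC) (circlesP Ce zC).
by rewrite circle_valueE.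
Qed.

Lemma sum_circle_eq e z (F : {set site D} -> int) :
  (\sum_(C in circles (mark1 e)) (C == circle_at (mark1 e) z)%:R * F C
   = F (circle_at (mark1 e) z))%R.
Proof.
rewrite (bigD1 (circle_at (mark1 e) z)) ?circle_at_in //= eqxx mul1r big1 ?addr0 //.
by move=> C /andP[_ /negPf->]; rewrite mul0r.
Qed.

Lemma partial_merge (S' : estate D) e f : e != f -> ends e != ends f ->
  markers S' = mark2 e f -> negative S' = set0 ->
  partial S' e f = (N e (end0 f) + N e (end2 f))%R.
Proof.
move=> ef npar mS' nS'.
have mf : mark1 e f by rewrite mark1E eq_sym.
have nspl : ~~ splits (mark1 e) f by rewrite splits_mark1.
rewrite (partialE (g := fun C => touches C f)); last first.
  by move=> S C mS nS _; apply: incident_merge; rewrite ?mS.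
transitivity (\sum_(C in circles (mark1 e))
    ((C == circle_at (mark1 e) (end0 f))%:R * circle_value e C
     + (C == circle_at (mark1 e) (end2 f))%:R * circle_value e C))%R.
  apply: eq_bigr => C Ce; rewrite -mulrDl; congr (_ * _)%R.
  rewrite (touches_nends Ce nspl) /nends natrD.
  have tE z : (z \in C) = (C == circle_at (mark1 e) z).
    by apply/idP/eqP => [/(circlesP Ce)|->] //; apply: circle_at_id.
  by rewrite !tE.
by rewrite big_split /= !sum_circle_eq !circle_valueE.
Qed.

Lemma partial_split (S' : estate D) e f C' z : e != f -> ends e = ends f ->
  markers S' = mark2 e f -> negative S' = [set C'] -> z \in C' ->
  partial S' e f = N e z.
Proof.
move=> ef par mS' nS' zC'.
have mf : mark1 e f by rewrite mark1E eq_sym.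
have spl : splits (mark1 e) f by rewrite splits_mark1 par.
have Cs' : C' \in circles (mark2 e f).
  by rewrite -mS'; apply: (subsetP (negative_sub S')); rewrite nS' set11.
rewrite (partialE (g := fun C => C' \subset C)); last first.
  by move=> S C mS nS _; apply: incident_split; rewrite ?mS.
rewrite -circle_valueE -sum_circle_eq; apply: eq_bigr => C Ce; congr (_%:R * _)%R.
congr nat_of_bool; apply/idP/eqP => [/subsetP/(_ z zC')|->]; first exact: circlesP.
by rewrite (circlesP Cs' zC') (circle_at_refine (@unmark_agree _ (mark1 e) f) spl).
Qed.

(** The target is reached by flipping either [f] or [e] last. Only when [e] is flipped last is there
    a negative marker above the flipped crossing, namely [f], whence the minus sign. *)
Lemma diff_partial S' e f : (e < f)%N -> markers (val S') = mark2 e f ->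
  dy S' = (partial (val S') e f - partial (val S') f e)%R.
Proof.
move=> ef mS'; have nef : e != f by apply: contraTneq ef => ->; rewrite ltnn.
rewrite ffunE.
transitivity (\sum_c \sum_(S : estate_deg D (n%:Z - 4 + 2)%R jdeg0)
   y S * ((incident (val S) (val S') c)%:R * (-1) ^+ tsign (val S) c))%R.
  rewrite exchange_big; apply: eq_bigr => S _; rewrite /dcoef -mulr_sumr; congr (_ * _)%R.
  rewrite big_mkcond; apply: eq_bigr => c _.
  by case: (incident _ _ _); rewrite ?mul0r ?mul1r.
have incE (S : estate D) c : incident S (val S') c -> mark2 e f = unmark (markers S) c /\ markers S c.
  by rewrite incidentE => /and4P[? /eqP <-].
have termE c g : c != g -> mark2 c g = mark2 e f ->
    (\sum_(S : estate_deg D (n%:Z - 4 + 2)%R jdeg0)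
      y S * ((incident (val S) (val S') g)%:R * (-1) ^+ tsign (val S) g)
    = (-1) ^+ (g < c)%N * partial (val S') c g :> int)%R.
  move=> cg mcg; rewrite /partial mulr_sumr [RHS]big_mkcond; apply: eq_bigr => S _.
  have [C1 [C2 [mS _ _]]] := estate1 S.
  case: eqP => [mSc|ne].
    rewrite mulrA [RHS]mulrC; congr (_ * _ ^+ _)%R.
    rewrite /tsign mSc.
    rewrite (_ : [set _ | _ & _] = if (g < c)%N then [set c] else set0); last first.
      apply/setP=> d; rewrite !inE mark1E negbK; case: eqP => [->|nd]; case: ifP => //=;
      by rewrite ?inE ?eqxx //; case: eqP nd.
    by case: ifP; rewrite ?cards1 ?cards0.
  case inc: (incident _ _ _); rewrite ?mul0r ?mulr0 //.
  have [em mg] := incE _ _ inc; case: ne; rewrite mS; congr mark1.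
  rewrite mS -mcg in em mg; apply/eqP; apply: contraT => ne.
  have /= := congr1 (fun s : kstate D => s c) em; rewrite !ffunE /= !andbT cg eqxx /=.
  by move: ne; rewrite eq_sym => ->.
rewrite (bigD1 e) //= (bigD1 f) /=; last by rewrite eq_sym.
rewrite [X in (_ + (_ + X))%R]big1 => [|c /andP[ce cf]]; last first.
  apply: big1 => S _; case inc: (incident _ _ _); rewrite ?mul0r ?mulr0 //.
  have [em mg] := incE _ _ inc.
  have /= := congr1 (fun s : kstate D => s c) em; rewrite !ffunE /= !andbT eqxx ce cf.
  by [].
have nfe : f != e by rewrite eq_sym.
rewrite addr0 (termE f e nfe (mark2C f e)) (termE e f nef erefl).
by rewrite ef ltnNge (ltnW ef) /= expr0 expr1 mul1r mulN1r addrC.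
Qed.
End Diff.

Definition boundary_form (x : chain2) (N : 'I_n -> site D -> int) :=
  forall S' e f, (e < f)%N -> markers (val S') = mark2 e f ->
   (ends e != ends f ->
      x S' = ((N e (end0 f) + N e (end2 f)) - (N f (end0 e) + N f (end2 e)))%R) /\
   (forall C z, ends e = ends f -> negative (val S') = [set C] -> z \in C -> x S' = (N e z - N f z)%R).

Lemma diff_boundary_form y N : (forall e, circle_const e (N e)) -> represents y N ->
  boundary_form (@diff D (n%:Z - 4 + 2)%R (n%:Z - 4)%R jdeg0 y) N.
Proof.
move=> Nc yN S' e f ef mS'; have nef : e != f by apply: contraTneq ef => ->; rewrite ltnn.
have nfe : f != e by rewrite eq_sym.
have [e1 [f1 [ef1 mS1 nS1]]] := estate2 S'.
have [ee ff] : e = e1 /\ f = f1.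
  have := mS1; rewrite mS' => /ffunP E.
  have := E e; have := E f; rewrite !ffunE !eqxx !andbT /= !andbF => /esym/negbT + /esym/negbT.
  rewrite !negb_and !negbK => /orP[] /eqP ? /orP[] /eqP ?; subst=> //.
  - by rewrite eqxx in nef.
  - by move: ef1; rewrite ltnNge (ltnW ef).
  - by rewrite eqxx in nef.
move: nS1; rewrite -ee -ff => nS1.
split=> [npar|C z par nS zC].
  rewrite (diff_partial _ ef mS'); rewrite (negPf npar) in nS1.
  by rewrite !(partial_merge Nc yN) // 1?eq_sym // mark2C.
rewrite (diff_partial _ ef mS') (partial_split Nc yN nef par mS' nS zC).
by rewrite (partial_split Nc yN nfe (esym par) _ nS zC) // mark2C.
Qed.

Lemma im_diffP (x : chain2) :
  (exists y : chain1, @diff D (n%:Z - 4 + 2)%R (n%:Z - 4)%R jdeg0 y = x) <->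
  (exists2 N, (forall e, circle_const e (N e)) & boundary_form x N).
Proof.
split=> [[y <-]|[N Nc xN]].
  by have [N Nc yN] := represents_fun y; exists N => //; apply: diff_boundary_form.
have [y yN] := represents_chain Nc; exists y; apply/ffunP=> S'.
have [e [f [ef mS' nS']]] := estate2 S'.
have [H1 H2] := diff_boundary_form Nc yN ef mS'; have [H3 H4] := xN S' e f ef mS'.
case: eqP nS' => [par [C nS Cc]|/eqP npar _]; last by rewrite H1 // H3.
by have [z zC] := circle_neq0 Cc; rewrite (H2 C z) // (H4 C z).
Qed.
End Boundary.

(** * From chains to the edge lattice of a simple graph *)

Section IncidenceLattice.
Variables (T : finType) (G : graph T).
Local Notation nv := #|verts G|.
Local Notation ne := #|edges G|.

Definition simple_graph := forall P, P \in edges G ->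
  exists x y, [/\ x != y, x \in verts G, y \in verts G & P = [set x; y]].

Definition vtx (v : 'I_nv) : T := enum_val v.
Definition edg (e : 'I_ne) : {set T} := enum_val e.

Definition inc_mx (R : pzRingType) : 'M[R]_(nv, ne) :=
  (\matrix_(v, e) (vtx v \in edg e)%:R)%R.

Definition edge_const (R : Type) (N : 'M[R]_(ne, nv)) :=
  forall e v w, vtx v \in edg e -> vtx w \in edg e -> N e v = N e w.

(** Symmetry of the difference says that [Y] and [N B] have the same skew part; the symmetric
    matrices are put into the lattice because chains only see [Y P Q - Y Q P]. *)
Definition in_lattice (Y : 'M[int]_ne) := exists2 N : 'M[int]_(ne, nv),
  edge_const N & ((Y - N *m inc_mx int)^T = Y - N *m inc_mx int)%R.

(* The torsion of the quotient of the integer matrices by in_lattice is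
   elementary abelian of rank k. *)
Definition torsion_rank (k : nat) :=
  exists theta : {additive 'M[int]_ne -> 'rV['Z_2]_k},
  [/\ forall Y, in_lattice Y -> theta Y = 0%R,
      forall Y m, (0 < m)%N -> in_lattice (Y *+ m)%R -> theta Y = 0%R -> in_lattice Y
    & forall w, exists Y, theta Y = w /\ exists2 m, (0 < m)%N & in_lattice (Y *+ m)%R].

End IncidenceLattice.

Section Reduction.
Variable D : link_diagram.
Local Notation n := (ncross D).
Hypothesis adequate : plus_adequate D.
Implicit Types (e f c : 'I_n).

Notation s0 := (splus D).
Notation cl := (circle_at s0).
Notation G := (simplify (state_graph s0)).
Notation nv := #|verts G|.
Notation ne := #|edges G|.
Notation B := (inc_mx G int).

Fact ends_edge e : ends e \in edges G. Proof. exact: imset_f. Qed.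
Fact circle_vert x : cl x \in verts G. Proof. exact: circle_at_in. Qed.

Definition eidx e : 'I_ne := enum_rank_in (ends_edge e) (ends e).
Definition vidx x : 'I_nv := enum_rank_in (circle_vert x) (cl x).

Lemma edg_eidx e : edg (eidx e) = ends e.
Proof. by rewrite /edg enum_rankK_in ?ends_edge. Qed.

Lemma vtx_vidx x : vtx (vidx x) = cl x.
Proof. by rewrite /vtx enum_rankK_in ?circle_vert. Qed.

Lemma eidx_eq e f : (eidx e == eidx f) = (ends e == ends f).
Proof. by rewrite -!edg_eidx (inj_eq enum_val_inj). Qed.

Lemma vidx_eq x y : (vidx x == vidx y) = (cl x == cl y).
Proof. by rewrite -!vtx_vidx (inj_eq enum_val_inj). Qed.

Lemma eidx_surj (P : 'I_ne) : exists e, P = eidx e.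
Proof.
have /imsetP[e _ eP] := enum_valP P; exists e; apply: enum_val_inj.
by rewrite eP -[RHS]/(edg _) edg_eidx.
Qed.

Lemma vidx_surj (v : 'I_nv) : exists x, v = vidx x.
Proof.
have /imsetP[x _ ev] := enum_valP v; exists x; apply: enum_val_inj.
by rewrite ev -[RHS]/(vtx _) vtx_vidx.
Qed.

Lemma state_graph_simple : simple_graph G.
Proof.
move=> P /imsetP[e _ ->]; exists (cl (end0 e)), (cl (end2 e)); split=> //.
- by rewrite eq_circle_at -mem_circle_at plus_nsplits.
- exact: circle_vert.
- exact: circle_vert.
Qed.

Lemma mul_incE (N : 'M[int]_(ne, nv)) P f :
  ((N *m B) P (eidx f) = N P (vidx (end0 f)) + N P (vidx (end2 f)))%R.
Proof.
have ne02 : vidx (end2 f) != vidx (end0 f).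
  by rewrite vidx_eq eq_sym eq_circle_at -mem_circle_at plus_nsplits.
rewrite mxE (bigD1 (vidx (end0 f))) //= (bigD1 (vidx (end2 f))) //=.
rewrite !mxE edg_eidx !vtx_vidx endsE set21 set22 !mulr1 big1 ?addr0 // => v /andP[v0 v2].
rewrite mxE edg_eidx endsE !inE -!vtx_vidx /vtx !(inj_eq enum_val_inj).
by rewrite (negPf v0) (negPf v2) mulr0.
Qed.

Lemma connect_mark1 e x y : connect (smooth_adj (mark1 e)) x y <->
  cl x = cl y \/ cl x \in ends e /\ cl y \in ends e.
Proof.
have ag := @unmark_agree _ s0 e.
have tE z : touches (cl z) e = (cl z \in ends e) by rewrite touches_circle_at endsE !inE.
split=> [xy|[/eqP|[xe ye]]].
- case xe: (cl x \in ends e); last first.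
    left; have := untouched_circle_at ag (negbT (etrans (tE x) xe)).
    by move=> E; apply/circle_atP; rewrite -E mem_circle_at.
  case ye: (cl y \in ends e); first by right.
  left; have := untouched_circle_at ag (negbT (etrans (tE y) ye)).
  by move=> E; apply/esym/circle_atP; rewrite -E mem_circle_at smooth_sym.
- by rewrite eq_circle_at; apply: merge_coarsen.
have join : connect (smooth_adj (mark1 e)) (end0 e) (end2 e).
  by rewrite -mem_circle_at unmark_ends ?splusE ?plus_nsplits.
have con z : cl z \in ends e -> connect (smooth_adj (mark1 e)) (end0 e) z.
  rewrite endsE !inE !eq_circle_at => /orP[] h.
    by rewrite smooth_sym merge_coarsen.
  by apply: connect_trans join _; rewrite smooth_sym merge_coarsen.
by apply: connect_trans (con y ye); rewrite smooth_sym con.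
Qed.

Notation jdeg0 := (jdeg0 D).
Notation deg_1 := (n%:Z - 4 + 2)%R.
Notation deg_2 := (n%:Z - 4)%R.
Notation chain1 := (chain D deg_1 jdeg0).
Notation chain2 := (chain D deg_2 jdeg0).
Notation d1 := (@diff D deg_1 deg_2 jdeg0).
Notation d2 := (@diff D deg_2 (deg_2 - 2)%R jdeg0).

Definition is_boundary (x : chain2) := exists y : chain1, d1 y = x.

Lemma d2_d1 (y : chain1) : d2 (d1 y) = 0%R.
Proof.
apply/ffunP=> S''; rewrite !ffunE.
transitivity (\sum_(S : estate_deg D deg_1 jdeg0) y S *
   \sum_(S' : estate_deg D deg_2 jdeg0) dcoef (val S) (val S') * dcoef (val S') (val S''))%R.
  under eq_bigr => S' _ do rewrite ffunE mulr_suml.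
  rewrite exchange_big; apply: eq_bigr => S _; rewrite mulr_sumr.
  by apply: eq_bigr => S' _; rewrite mulrA.
apply: big1 => S _; have [e [C [_ nS _]]] := estate1 adequate S.
have /andP[/eqP iS /eqP jS] := valP S; have /andP[_ /eqP jS''] := valP S''.
by rewrite (dcoef_dcoef _ jS jS'' nS) ?mulr0 // iS; ring.
Qed.


Lemma mark2_inj e f e' f' : (e < f)%N -> (e' < f')%N ->
  mark2 e f = mark2 e' f' -> e = e' /\ f = f'.
Proof.
move=> ef ef1 /ffunP E; have nef : e != f by apply: contraTneq ef => ->; rewrite ltnn.
have := E e; have := E f; rewrite !ffunE !eqxx !andbT /= !andbF => /esym/negbT + /esym/negbT.
rewrite !negb_and !negbK => /orP[] /eqP ? /orP[] /eqP ?; subst=> //.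
- by rewrite eqxx in nef.
- by move: ef1; rewrite ltnNge (ltnW ef).
- by rewrite eqxx in nef.
Qed.

(* On the states of two parallel crossings the indices coincide and the value
   is 0. *)
Definition skew_chain (Y : 'M[int]_ne) : chain2 := [ffun S : estate_deg D deg_2 jdeg0 =>
  (if [pick p : 'I_n * 'I_n | (p.1 < p.2)%N && (markers (val S) == mark2 p.1 p.2)]
   is Some p then Y (eidx p.1) (eidx p.2) - Y (eidx p.2) (eidx p.1) else 0 : int)%R].

Lemma skew_chainE Y S e f : (e < f)%N -> markers (val S) = mark2 e f ->
  skew_chain Y S = (Y (eidx e) (eidx f) - Y (eidx f) (eidx e))%R.
Proof.
move=> ef mS; rewrite ffunE; case: pickP => [[e' f'] /= /andP[ef' /eqP mS']|/(_ (e, f))].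
  by have [-> ->] := mark2_inj ef' ef (etrans (esym mS') mS).
by rewrite /= ef mS eqxx.
Qed.

Lemma skew_chainP (x : chain2) (Y : 'M[int]_ne) :
  (forall S e f, (e < f)%N -> markers (val S) = mark2 e f ->
     x S = (Y (eidx e) (eidx f) - Y (eidx f) (eidx e))%R) -> x = skew_chain Y.
Proof.
move=> H; apply/ffunP=> S; have [e [f [ef mS _]]] := estate2 adequate S.
by rewrite (H S e f) // (skew_chainE _ ef mS).
Qed.

Lemma skew_chainB Y Z : skew_chain (Y - Z)%R = (skew_chain Y - skew_chain Z)%R.
Proof.
apply/esym/skew_chainP => S e f ef mS.
have -> : ((skew_chain Y - skew_chain Z) S = skew_chain Y S - skew_chain Z S)%R.
  by move: (skew_chain Y) (skew_chain Z) => u v; rewrite !ffunE.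
by rewrite !(skew_chainE _ ef mS) !mxE; ring.
Qed.

Lemma skew_chainMn Y m : skew_chain (Y *+ m)%R = (skew_chain Y *+ m)%R.
Proof.
apply/esym/skew_chainP => S e f ef mS.
by rewrite ffunMnE (skew_chainE _ ef mS) !mulmxnE mulrnBl.
Qed.

Lemma boundary_skew Y : in_lattice Y -> is_boundary (skew_chain Y).
Proof.
move=> [N Nc NY]; apply/(im_diffP adequate).
exists (fun e z => N (eidx e) (vidx z)).
  move=> e x y /connect_mark1[/eqP|[xe ye]].
    by rewrite -vidx_eq => /eqP ->.
  by apply: Nc; rewrite edg_eidx vtx_vidx.
move=> S e f ef mS; split=> [npar|C z par _ _]; rewrite (skew_chainE _ ef mS); last first.
  have /eqP -> : eidx e == eidx f by rewrite eidx_eq par.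
  by rewrite !subrr.
rewrite -!mul_incE; move: (N *m B)%R NY => Z /matrixP/(_ (eidx e) (eidx f)).
have aux (a b c d : int) : (a - c = b - d -> b - a = d - c)%R by lia.
by rewrite !mxE; apply: aux.
Qed.

Lemma estate_npar e f : e != f -> ends e != ends f ->
  exists S : estate_deg D deg_2 jdeg0, markers (val S) = mark2 e f.
Proof.
move=> ef npar; have cN := card_mark2 adequate ef; rewrite (negPf npar) in cN.
have jE : (deg_2 + 2 * #|circles (mark2 e f)|%:Z - 4 * 0%:Z = jdeg0)%R.
  by rewrite /jdeg0; lia.
have [S [mS _]] := estate_deg_exists (deg2 ef) jE (sub0set _) (cards0 _).
by exists S.
Qed.

Lemma estate_par e f z : e != f -> ends e = ends f ->
  exists S : estate_deg D deg_2 jdeg0, markers (val S) = mark2 e f /\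
    negative (val S) = [set circle_at (mark2 e f) z].
Proof.
move=> ef par; have cN := card_mark2 adequate ef; rewrite par eqxx in cN.
have jE : (deg_2 + 2 * #|circles (mark2 e f)|%:Z - 4 * 1%:Z = jdeg0)%R.
  by rewrite /jdeg0; lia.
apply: (estate_deg_exists (deg2 ef) jE); last exact: cards1.
by rewrite sub1set circle_at_in.
Qed.

Lemma class_fun (N : 'I_n -> site D -> int) :
  (forall e, circle_const e (N e)) -> (forall e f z, ends e = ends f -> N e z = N f z) ->
  exists2 M : 'M[int]_(ne, nv), edge_const M & forall e z, M (eidx e) (vidx z) = N e z.
Proof.
move=> Nc Np; pose M : 'M[int]_(ne, nv) := (\matrix_(P, v)
  if [pick p : 'I_n * site D | (eidx p.1 == P) && (vidx p.2 == v)] is Some p then N p.1 p.2 else 0)%R.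
have ME e z : M (eidx e) (vidx z) = N e z.
  rewrite mxE; case: pickP => [[e' z'] /= /andP[]|/(_ (e, z))]; last by rewrite /= !eqxx.
  rewrite eidx_eq vidx_eq => /eqP /Np -> /eqP cz.
  by apply: Nc; apply/connect_mark1; left.
exists M => // P v w; have [e ->] := eidx_surj P; have [x ->] := vidx_surj v.
have [y ->] := vidx_surj w; rewrite edg_eidx !vtx_vidx !ME => xe ye.
by apply: Nc; apply/connect_mark1; right.
Qed.

Lemma skew_boundary Y : is_boundary (skew_chain Y) -> in_lattice Y.
Proof.
move=> /(im_diffP adequate)[N Nc xN].
(* The chain vanishes at two parallel crossings, and every site lies on the negative circle of some
   state there; so the rows of [N] at parallel crossings agree. *)
have Nlt e f z : (e < f)%N -> ends e = ends f -> N e z = N f z.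
  move=> ef par; have nef : e != f by apply: contraTneq ef => ->; rewrite ltnn.
  have [S [mS nS]] := estate_par z nef par.
  have := proj2 (xN S e f ef mS) _ _ par nS (circle_at_id _ _).
  rewrite (skew_chainE _ ef mS); have /eqP -> : eidx e == eidx f by rewrite eidx_eq par.
  by rewrite subrr; lia.
have Np e f z : ends e = ends f -> N e z = N f z.
  move=> par; have [lt|lt|/val_inj -> //] := ltngtP e f; first exact: Nlt.
  by apply/esym/Nlt.
have [M Mc ME] := class_fun Nc Np; exists M => //.
have main e f : (e < f)%N -> ends e != ends f ->
    ((Y - M *m B) (eidx f) (eidx e) = (Y - M *m B) (eidx e) (eidx f))%R.
  move=> ef npar; have nef : e != f by apply: contraTneq ef => ->; rewrite ltnn.
  have [S mS] := estate_npar nef npar.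
  have := proj1 (xN S e f ef mS) npar; rewrite (skew_chainE _ ef mS) -!ME -!mul_incE.
  have aux (a b c d : int) : (a - b = c - d -> b - d = a - c)%R by lia.
  by move: (M *m B)%R => Z; rewrite !mxE; apply: aux.
apply/matrixP=> P Q; rewrite mxE; have [e ->] := eidx_surj P; have [f ->] := eidx_surj Q.
case: (eqVneq (ends e) (ends f)) => [/eqP|npar]; first by rewrite -eidx_eq => /eqP ->.
have [lt|lt|/val_inj h] := ltngtP e f; first exact: main.
  by apply/esym/main; rewrite // eq_sym.
by rewrite h eqxx in npar.
Qed.

Definition rep e : 'I_n := odflt e [pick f | ends f == ends e].

Lemma ends_rep e : ends (rep e) = ends e.
Proof. by rewrite /rep; case: pickP => [f /eqP //|]. Qed.

Lemma eq_rep e f : ends e = ends f -> rep e = rep f.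
Proof.
move=> par; rewrite /rep par; case: pickP => [//|/(_ e)].
by rewrite par eqxx.
Qed.

(* Parallel crossings contribute only a free summand. *)
Lemma torsion_skew (x : chain2) m : (0 < m)%N -> is_boundary (x *+ m)%R ->
  exists Y, is_boundary (x - skew_chain Y)%R.
Proof.
move=> m0 /(im_diffP adequate)[N Nc xN].
have mulmn (a : int) : (a *+ m = a * m%:Z)%R by rewrite -mulr_natr natz.
have mnz : (m%:Z != 0)%R by rewrite -lt0n.
have Nlt e f z : (e < f)%N -> ends e = ends f -> ((N e z - N f z)%R \in dvdz m%:Z).
  move=> ef par; have nef : e != f by apply: contraTneq ef => ->; rewrite ltnn.
  have [S [mS nS]] := estate_par z nef par.
  have <- := proj2 (xN S e f ef mS) _ _ par nS (circle_at_id _ _).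
  by rewrite ffunMnE mulmn dvdz_mull.
have Np e f z : ends e = ends f -> ((N e z - N f z)%R \in dvdz m%:Z).
  move=> par; have [lt|lt|/val_inj -> //] := ltngtP e f; first exact: Nlt.
    by rewrite -opprB rpredN Nlt.
  by rewrite subrr rpred0.
(* [N] is its row at the representative plus [m] times [M]. Once the boundary given by [M] is
   removed from [x], the remainder times [m] is the boundary of a function of parallel classes,
   which vanishes at parallel crossings. *)
pose M e z : int := divz (N e z - N (rep e) z)%R m%:Z.
have NM e z : (N e z = N (rep e) z + M e z *+ m)%R.
  by rewrite mulmn divzK ?Np ?ends_rep //; ring.
have Nrc e : circle_const e (N (rep e)).
  move=> z w /connect_mark1 zw; apply: Nc; apply/connect_mark1.
  by rewrite ends_rep.
have Mc e : circle_const e (M e).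
  by move=> z w zw; rewrite /M (Nc e z w zw) (Nrc e z w zw).
have [y yM] := represents_chain Mc; have dyM := diff_boundary_form adequate Mc yM.
have [W Wc WE] : exists2 W : 'M[int]_(ne, nv), edge_const W &
    forall e z, W (eidx e) (vidx z) = N (rep e) z.
  by apply: class_fun => // e f z /eq_rep ->.
pose A P Q : int := ((W *m B) P Q - (W *m B) Q P)%R.
(* Only the skew part matters; placing it above the diagonal realises it without a division by 2. *)
pose Y : 'M[int]_ne := (\matrix_(P, Q) if (P < Q)%N then divz (A P Q) m%:Z else 0)%R.
exists Y; suff <- : (x - d1 y)%R = skew_chain Y by exists y; rewrite subKr.
apply: skew_chainP => S e f ef mS; have nef : e != f by apply: contraTneq ef => ->; rewrite ltnn.
have [x1 x2] := xN S e f ef mS; have [y1 y2] := dyM S e f ef mS.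
rewrite ffunMnE in x1 x2.
have -> : ((x - d1 y) S = x S - d1 y S)%R by move: (d1 y) => u; rewrite !ffunE.
have cancel_m (a b : int) : (a *+ m = b *+ m -> a = b)%R.
  by rewrite !mulmn => /(mulIf mnz).
have [e1 [f1 [ef1 mS1 nS1]]] := estate2 adequate S.
have [ee ff] := mark2_inj ef1 ef (etrans (esym mS1) mS); subst e1 f1.
case: eqP nS1 => [par [C nS Cc]|/eqP npar _].
  have [z zC] := circle_neq0 Cc.
  have /eqP -> : eidx e == eidx f by rewrite eidx_eq par.
  rewrite subrr; apply: cancel_m; rewrite mulrnBl (x2 C z) // (y2 C z) // (NM e) (NM f).
  by rewrite (eq_rep par) mulrnBl mul0rn; ring.
have AE : (A (eidx e) (eidx f) = (x S - d1 y S) *+ m)%R.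
  rewrite /A !mul_incE !WE mulrnBl x1 // y1 // (NM e) (NM f) (NM e (end2 _)) (NM f (end2 _)).
  by rewrite !(mulrnBl, mulrnDl); ring.
have AC : (A (eidx f) (eidx e) = - A (eidx e) (eidx f))%R by rewrite /A opprB.
rewrite !mxE; have [lt|lt|/val_inj h] := ltngtP (eidx e) (eidx f).
- by rewrite AE mulmn mulzK // subr0.
- by rewrite AC AE mulmn -mulNr mulzK // sub0r opprK.
by move/eqP: h; rewrite eidx_eq (negPf npar).
Qed.

HB.instance Definition _ :=
  GRing.isZmodMorphism.Build 'M[int]_ne chain2 skew_chain skew_chainB.

Lemma tor_khovanov k : torsion_rank G k ->
  exists phi : {additive tor (khovanov D deg_2 jdeg0) -> 'rV['Z_2]_k}, bijective phi.
Proof.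
move=> [theta [th0 thI thS]].
apply: (@tor_homology_iso _ _ _ d1 d2 d2_d1 _ _ _ skew_chain theta) => //.
- move=> c m m0 /ffunP cm; apply/ffunP=> S; have := cm S; rewrite ffunMnE !ffunE.
  have int0 (a : int) : (a *+ m = 0 -> a = 0)%R by rewrite -mulr_natr natz; nia.
  exact: int0.
- exact: torsion_skew.
- by move=> Y /skew_boundary/th0.
- move=> Y m m0; rewrite -skew_chainMn => /skew_boundary Ym tY.
  by apply/boundary_skew/(thI Y m).
move=> w; have [Y [tY [m m0 Ym]]] := thS w; exists Y; split=> //.
by exists m => //; rewrite -skew_chainMn; apply: boundary_skew.
Qed.
End Reduction.

Local Open Scope ring_scope.

(** * Smith normal form and dimensions *)

Section RankDiagonal.
Variables (F : fieldType) (q p : nat) (c : nat -> F).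

Lemma mxrank_diagonal :
  \rank (\matrix_(i < q, j < p) (c i *+ (i == j :> nat)))
  = #|[set j : 'I_p | (j < q)%N && (c j != 0)]|.
Proof.
set A := \matrix_(i, j) _; set J := [set j | _].
pose h (l : 'I_#|J|) : 'I_p := enum_val l.
have ltq (l : 'I_#|J|) : (enum_val l < q)%N.
  by have := enum_valP l; rewrite inE => /andP[].
have cn0 (l : 'I_#|J|) : c (enum_val l) != 0.
  by have := enum_valP l; rewrite inE => /andP[].
apply/eqP; rewrite eqn_leq; apply/andP; split.
  have -> : A = (\matrix_(i < q, l < #|J|) (c i *+ (i == h l :> nat)))
                *m (\matrix_(l < #|J|, j < p) (h l == j)%:R).
    apply/matrixP=> i j; rewrite !mxE; case: eqP => [eij|nij]; last first.
      rewrite big1 // => l _; rewrite !mxE; case: eqP => [e1|]; last by rewrite mulr0n mul0r.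
      by case: eqP => [e2|]; [case: nij; rewrite e1 e2 | rewrite mulr0].
    case: (boolP (j \in J)) => jJ.
      rewrite (bigD1 (enum_rank_in jJ j)) //= !mxE /h enum_rankK_in // eij !eqxx mulr1 big1 ?addr0 //.
      move=> l nl; rewrite !mxE; case: (h l =P j) => [e|]; last by rewrite mulr0.
      by case/eqP: nl; apply: enum_val_inj; rewrite enum_rankK_in.
    have c0 : c i = 0.
      by move: jJ; rewrite inE -eij ltn_ord /= negbK => /eqP.
    by rewrite c0 mul0rn big1 // => l _; rewrite !mxE c0 mul0rn mul0r.
  exact: mulmx_max_rank.
pose U : 'M[F]_(#|J|, q) := \matrix_(l, i) ((c i)^-1 *+ (i == h l :> nat)).
pose V : 'M[F]_(p, #|J|) := \matrix_(j, l) (j == h l)%:R.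
have UAV : U *m A *m V = 1%:M.
  apply/matrixP=> l m; rewrite !mxE (bigD1 (h m)) //= !mxE eqxx mulr1.
  rewrite [X in _ + X]big1 ?addr0; last by move=> j /negPf nj; rewrite !mxE nj mulr0.
  rewrite (bigD1 (Ordinal (ltq l))) //= !mxE eqxx mulr1n big1 ?addr0; last first.
    move=> i nl; rewrite !mxE; case: eqP => [e|]; last by rewrite mulr0n mul0r.
    by case/eqP: nl; apply: val_inj.
  rewrite (inj_eq (@ord_inj p)) /h (inj_eq (enum_val_inj (A := J))) eq_sym; case: eqP => [_|].
    by rewrite !mulr1n mulVf // cn0.
  by rewrite !mulr0n mulr0.
rewrite -[leqLHS](mxrank1 F #|J|) -UAV.
exact: leq_trans (mxrankM_maxl _ _) (mxrankM_maxr _ _).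
Qed.
End RankDiagonal.

Section ElementaryTorsion.
Variables (q p : nat) (M : 'M[int]_(q, p)).
Implicit Types x : 'rV[int]_p.

Definition in_rows x := exists y : 'rV[int]_q, y *m M = x.

Definition rank_over (F : fieldType) : nat := \rank (map_mx (intr : int -> F) M).

Lemma unitmx_map_intr (R : comUnitRingType) m (A : 'M[int]_m) :
  A \in unitmx -> map_mx (intr : int -> R) A \in unitmx.
Proof.
move=> Au; apply: (@proj1 _ (map_mx intr (invmx A) \in unitmx)); apply: mulmx1_unit.
by rewrite -map_mxM mulmxV // map_mx1.
Qed.

Hypothesis tor2 : forall x m, (0 < m)%N -> in_rows (x *+ m) -> in_rows (x *+ 2).

Lemma smith_torsion : exists (R : 'M[int]_p) (delta : 'I_p -> int),
  [/\ R \in unitmx,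
      forall x, in_rows x <-> forall j, ((x *m invmx R) 0 j \in dvdz (delta j)),
      forall j, delta j != 0 -> (2 \in dvdz (delta j))
    & forall F : fieldType, rank_over F = #|[set j | (delta j)%:~R != 0 :> F]|].
Proof.
have [L uL [R uR [d _ eM]]] := int_Smith_normal_form M.
(* Columns past the last row get the invariant 0, since lattice vectors have coordinate 0 there in
   the new basis. *)
pose delta (j : 'I_p) : int := if (j < q)%N then d`_j else 0.
set Dm := \matrix_(i, j) _ in eM.
pose z x : 'rV[int]_p := x *m invmx R.
have DmE i j : Dm i j = d`_i *+ (i == j :> nat) by rewrite mxE.
have mulDm (y : 'rV[int]_q) j : (y *m Dm) 0 j =
    (if insub (j : nat) is Some i then y 0 i * d`_j else 0).
  rewrite mxE; case: insubP => [i _ ij|/negbTE jq]; last first.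
    rewrite big1 // => i _; rewrite DmE; case: eqP => [e|]; last by rewrite mulr0n mulr0.
    by move: jq; rewrite -e ltn_ord.
  rewrite (bigD1 i) //= DmE ij eqxx mulr1n big1 ?addr0 // => k ni.
  rewrite DmE; case: eqP => [e|]; last by rewrite mulr0n mulr0.
  by case/eqP: ni; apply: val_inj; rewrite /= e -ij.
have rowsP x : in_rows x <-> forall j, (z x 0 j \in dvdz (delta j)).
  split=> [[y <-] j|H].
    rewrite /z eM -!mulmxA mulmxV // mulmx1 mulmxA mulDm /delta.
    by case: insubP => [i -> _|/negbTE ->]; rewrite ?dvdz0 ?dvdz_mull.
  pose y : 'rV[int]_q := \row_i (if insub (i : nat) is Some j then divz (z x 0 j) (d`_i) else 0).
  exists (y *m invmx L); rewrite eM !mulmxA mulmxKV //.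
  suff -> : y *m Dm = z x by rewrite /z mulmxKV.
  apply/rowP=> j; rewrite mulDm; have := H j; rewrite /delta.
  case: insubP => [i -> ij|/negbTE ->]; last by rewrite dvd0z => /eqP.
  move=> zj; rewrite mxE; case: insubP => [k _ ek|]; last by rewrite /= [nat_of_ord i]ij ltn_ord.
  have -> : k = j by apply: val_inj; rewrite ek.
  by rewrite [nat_of_ord i]ij divzK.
have zMn x m j : z (x *+ m) 0 j = z x 0 j * m%:Z.
  by rewrite /z -scaler_nat -scalemxAl mxE mulrC natz.
have zinv y : z (y *m R) = y by rewrite /z mulmxK.
have delta2 j : delta j != 0 -> (2 \in dvdz (delta j)).
  move=> dj; have : in_rows ((delta_mx 0 j *m R) *+ `|delta j|%N).
    apply/rowsP=> i; rewrite zMn zinv !mxE /=; case: (i =P j) => [->|_]; last by rewrite mul0r dvdz0.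
    by rewrite mul1r dvdzE absz_nat.
  move=> /tor2; rewrite lt0n absz_eq0 dj => /(_ isT)/rowsP/(_ j).
  by rewrite zMn zinv !mxE !eqxx mul1r.
have rankE (F : fieldType) : rank_over F = #|[set j | (delta j)%:~R != 0 :> F]|.
  rewrite /rank_over eM !map_mxM mxrankMfree; last first.
    by rewrite row_free_unit unitmx_map_intr.
  rewrite -mxrank_tr trmx_mul mxrankMfree ?mxrank_tr; last first.
    by rewrite row_free_unit unitmx_tr unitmx_map_intr.
  have -> : map_mx intr Dm = \matrix_(i < q, j < p) ((d`_i)%:~R *+ (i == j :> nat)) :> 'M[F]_(q, p).
    by apply/matrixP=> i j; rewrite !mxE rmorphMn.
  rewrite (mxrank_diagonal q p (fun i => (d`_i)%:~R : F)); apply: eq_card => j; rewrite !inE /delta.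
  by case: ifP => //; rewrite eqxx.
by exists R, delta; split.
Qed.

(** All nonzero invariants divide 2, so each cyclic torsion summand has order 2 and comes from a
    nonzero even invariant: one that counts for the rank over the rationals but not over ['F_2]. The
    map [theta] reads the corresponding coordinates modulo 2. *)
Lemma elementary_torsion :
  exists2 k, (k + rank_over 'F_2 = rank_over rat)%N &
  exists theta : {additive 'rV[int]_p -> 'rV['Z_2]_k},
  [/\ forall x, in_rows x -> theta x = 0,
      forall x m, (0 < m)%N -> in_rows (x *+ m) -> theta x = 0 -> in_rows x
    & forall w, exists x, theta x = w /\ in_rows (x *+ 2)].
Proof.
have [R [delta [uR rowsP delta2 rankE]]] := smith_torsion.
pose z x : 'rV[int]_p := x *m invmx R.
have zMn x m j : z (x *+ m) 0 j = z x 0 j * m%:Z.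
  by rewrite /z -scaler_nat -scalemxAl mxE mulrC natz.
have zinv y : z (y *m R) = y by rewrite /z mulmxK.
pose J := [set j | (delta j != 0) && (delta j \in dvdz 2)].
have oddE (R0 : nzRingType) (a : int) : 2%N \in [pchar R0] -> (a%:~R == 0 :> R0) = (a \in dvdz 2).
  move=> ch2; rewrite dvdzE /=; case: a => m; first by rewrite -pmulrn -(dvdn_pcharf ch2).
  by rewrite NegzE abszN absz_nat mulrNz oppr_eq0 -pmulrn -(dvdn_pcharf ch2).
have ch2 : 2%N \in [pchar 'F_2] by apply: pchar_Fp.
exists #|J|.
  rewrite !rankE -[RHS](cardsID J) setIC; congr (_ + _)%N; apply: eq_card => j; rewrite !inE ?intr_eq0.
    by case: (delta j != 0); rewrite ?andbF ?andbT.
  by rewrite (oddE 'F_2) //; case: (eqVneq (delta j) 0) => [->|_] /=; rewrite ?andbT ?andbF ?dvdz0.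
pose th x : 'rV['Z_2]_#|J| := \row_l (z x 0 (enum_val l))%:~R.
have thE x l : th x 0 l = (z x 0 (enum_val l))%:~R by rewrite mxE.
have thB : zmod_morphism th.
  move=> x y; apply/rowP=> l; rewrite [RHS]mxE [X in _ = _ + X]mxE !thE.
  by rewrite -rmorphB; congr _%:~R; rewrite /z mulmxBl [LHS]mxE [X in _ + X = _]mxE.
pose thM := GRing.isZmodMorphism.Build _ _ th thB.
pose theta : {additive 'rV[int]_p -> 'rV['Z_2]_#|J|} := HB.pack th thM.
have th0 x (l : 'I_#|J|) : th x = 0 -> z x 0 (enum_val l) \in dvdz 2.
  by move=> /rowP/(_ l); rewrite thE [RHS]mxE => /eqP; rewrite (oddE 'Z_2 _ ch2).
have dvd_m (m : nat) (i : 'I_p) (a : int) : (0 < m)%N -> delta i = 0 -> a * m%:Z \in dvdz (delta i) -> a = 0.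
  by move=> m0 -> ; rewrite dvd0z mulf_eq0 orbC; case: eqP => [[m0']|_ /eqP //]; rewrite m0' in m0.
exists theta; split.
- move=> x /rowsP xr; apply/rowP=> l; rewrite [LHS]thE [RHS]mxE; apply/eqP; rewrite (oddE 'Z_2 _ ch2).
  have := enum_valP l; rewrite inE => /andP[_ d2]; exact: dvdz_trans d2 (xr _).
- move=> x m m0 /rowsP xm /th0 tx; apply/rowsP=> j; have := xm j; rewrite zMn.
  case: (eqVneq (delta j) 0) => [d0|dn0]; first by move/(dvd_m m j _ m0 d0) ->; rewrite dvdz0.
  case: (boolP (j \in J)) => [jJ _|].
    have := tx (enum_rank_in jJ j); rewrite enum_rankK_in //.
    by apply: dvdz_trans; apply: delta2.
  rewrite inE dn0 /= => odd_d _.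
  suff d1 : `|delta j|%N = 1%N by rewrite dvdzE d1 dvd1n.
  have := delta2 j dn0; move: odd_d; rewrite !dvdzE /=.
  by case: `|delta j|%N => [|[|[|k]]] // _ /(dvdn_leq isT).
move=> w.
pose y : 'rV[int]_p := \row_j \sum_(l < #|J|) (val (w 0 l))%:Z *+ (j == enum_val l).
have yE l : y 0 (enum_val l) = (val (w 0 l))%:Z.
  rewrite mxE (bigD1 l) //= eqxx mulr1n big1 ?addr0 // => i il.
  by rewrite (inj_eq enum_val_inj) eq_sym (negPf il) mulr0n.
exists (y *m R); split.
  by apply/rowP=> l; rewrite [LHS]thE zinv yE -pmulrn natr_Zp.
apply/rowsP=> j; rewrite zMn zinv; case: (boolP (j \in J)) => jJ.
  apply: dvdz_mull; apply: delta2; by move: jJ; rewrite inE => /andP[].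
rewrite mxE big1 ?mul0r ?dvdz0 // => l _; case: eqP => [e|]; last by rewrite mulr0n.
by move: jJ; rewrite e enum_valP.
Qed.
End ElementaryTorsion.

(** * Dimensions of solution spaces *)

Section HasDim.
Variable F : fieldType.

(** Dimension as a linear parametrisation: it applies directly to sets of matrices given by
    predicates, without encoding them as row spaces. *)
Definition has_dim (V : lmodType F) (P : V -> Prop) (d : nat) :=
  exists phi : {linear 'rV[F]_d -> V}, injective phi /\ forall x, P x <-> exists c, phi c = x.

Lemma has_dim_ext (V : lmodType F) (P Q : V -> Prop) d :
  (forall x, P x <-> Q x) -> has_dim P d -> has_dim Q d.
Proof. by move=> PQ [phi [inj im]]; exists phi; split=> // x; rewrite -PQ. Qed.

Lemma linear_inj (V W : lmodType F) (f : {linear V -> W}) :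
  (forall x, f x = 0 -> x = 0) -> injective f.
Proof.
by move=> f0 x y fxy; apply/eqP; rewrite -subr_eq0; apply/eqP/f0; rewrite linearB fxy subrr.
Qed.

Lemma has_dim_rank p q (M : 'M[F]_(p, q)) d :
  has_dim (fun w : 'rV_p => w *m M = 0) d -> (\rank M + d = p)%N.
Proof.
move=> [phi [inj im]]; pose K := lin1_mx phi.
have KE c : c *m K = phi c by rewrite mul_rV_lin1.
have Kfree : row_free K.
  rewrite -kermx_eq0; apply/eqP/row_matrixP => i; rewrite row0.
  by apply: inj; rewrite linear0 -KE -row_mul mulmx_ker row0.
have eK : (K :=: kermx M)%MS.
  apply/eqmxP/andP; split.
    by apply/sub_kermxP/row_matrixP => i; rewrite row_mul row0 rowE KE; apply/im; exists (delta_mx 0 i).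
  apply/row_subP => i; have /im[c <-] : row i (kermx M) *m M = 0 by rewrite -row_mul mulmx_ker row0.
  by rewrite -KE submxMl.
have := mxrank_ker M; rewrite -eK.
by move: Kfree; rewrite /row_free => /eqP -> ->; rewrite subnKC // rank_leq_row.
Qed.

Lemma has_dim_ker p q (M : 'M[F]_(p, q)) :
  has_dim (fun w : 'rV_p => w *m M = 0) (p - \rank M).
Proof.
rewrite -mxrank_ker; set K := row_base (kermx M).
exists (mulmxr K); split=> [|x] /=.
  by apply: linear_inj => x /= /eqP; rewrite mulmx_free_eq0 ?row_base_free // => /eqP.
split=> [/sub_kermxP|[c <-]].
  by rewrite -(eq_row_base (kermx M)) => /submxP[c ->]; exists c.
rewrite -mulmxA; have /sub_kermxP -> : (K <= kermx M)%MS by rewrite eq_row_base.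
by rewrite mulmx0.
Qed.

Lemma has_dim_inj (V W : lmodType F) (f : {linear V -> W}) (P : V -> Prop) (Q : W -> Prop) d :
  injective f -> (forall y, Q y <-> exists2 x, P x & f x = y) -> has_dim P d -> has_dim Q d.
Proof.
move=> fI QE [phi [inj im]]; exists (f \o phi); split=> [|y]; first exact: inj_comp.
rewrite QE; split=> [[x /im[c <-] <-]|[c <-]]; first by exists c.
by exists (phi c) => //; apply/im; exists c.
Qed.

(* A short exact sequence with a linear splitting h. *)
Lemma has_dim_add (V U : lmodType F) (P : V -> Prop) (Q : U -> Prop) (f : {linear V -> U})
    (h : {linear U -> V}) a b :
  (forall x y, P x -> P y -> P (x + y)) -> (forall x y, P x -> P y -> P (x - y)) ->
  (forall x, P x -> Q (f x)) -> (forall u, Q u -> P (h u) /\ f (h u) = u) ->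
  has_dim (fun x => P x /\ f x = 0) a -> has_dim Q b -> has_dim P (a + b).
Proof.
move=> PD PB Pf Qh [phi [phiI phiE]] [psi [psiI psiE]].
pose g (c : 'rV[F]_(a + b)) := phi (lsubmx c) + h (psi (rsubmx c)).
have gL : linear g.
  by move=> k x y; rewrite /g !linearP /= scalerDr addrACA.
pose gM := GRing.isLinear.Build _ _ _ _ g gL.
pose G : {linear 'rV[F]_(a + b) -> V} := HB.pack g gM.
have GE c : G c = phi (lsubmx c) + h (psi (rsubmx c)) by [].
have psiQ c : Q (psi c) by apply/psiE; exists c.
have phiP c : P (phi c) /\ f (phi c) = 0 by apply/phiE; exists c.
exists G; split=> [|x].
  apply: linear_inj => c; rewrite GE => c0.
  have r0 : rsubmx c = 0.
    apply: psiI; rewrite linear0 -[LHS](proj2 (Qh _ (psiQ _))).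
    by have := congr1 f c0; rewrite linearD linear0 (proj2 (phiP _)) add0r.
  move: c0; rewrite r0 !linear0 addr0 => c0; have l0 : lsubmx c = 0 by apply: phiI; rewrite c0 linear0.
  by rewrite -[c]hsubmxK l0 r0 row_mx0.
split=> [Px|[c <-]].
  have [d fd] := iffLR (psiE _) (Pf _ Px).
  have [Phd fhd] := Qh _ (psiQ d).
  have [e ed] : exists e, phi e = x - h (psi d).
    by apply/phiE; split; [apply: PB | rewrite linearB fhd fd subrr].
  by exists (row_mx e d); rewrite GE row_mxKl row_mxKr ed subrK.
by rewrite GE; apply: PD; [have [] := phiP (lsubmx c) | have [] := Qh _ (psiQ (rsubmx c))].
Qed.

(* In characteristic 2 this is stronger than Z^T = - Z: the diagonal is 0. *)
Definition alternating d (Z : 'M[F]_d) := exists W : 'M[F]_d, Z = W - W^T.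

Lemma alternating_tr d (Z : 'M[F]_d) : alternating Z -> Z^T = - Z.
Proof. by move=> [W ->]; rewrite linearB /= trmxK opprB. Qed.

Lemma alternating_diag d (Z : 'M[F]_d) i : alternating Z -> Z i i = 0.
Proof. by move=> [W ->]; rewrite !mxE subrr. Qed.

Lemma alternatingP d (Z : 'M[F]_d) : Z^T = - Z -> (forall i, Z i i = 0) -> alternating Z.
Proof.
move=> Zt Z0; exists (\matrix_(i, j) (if (i < j)%N then Z i j else 0)).
apply/matrixP=> i j; have /matrixP/(_ i j) := Zt; rewrite !mxE => Zji.
case: ltngtP => [_|_|/val_inj ->]; rewrite ?subr0 ?sub0r ?Z0 //.
by rewrite Zji opprK.
Qed.

Lemma alternatingB d (Y Z : 'M[F]_d) : alternating Y -> alternating Z -> alternating (Y - Z).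
Proof.
move=> [W ->] [X ->]; exists (W - X); rewrite [(W - X)^T]linearB /= !opprB.
by rewrite [X^T - X]addrC [X^T - _]addrC addrACA.
Qed.

Lemma alternatingN d (Y : 'M[F]_d) : alternating Y -> alternating (- Y).
Proof. by move=> [W ->]; exists W^T; rewrite opprB trmxK. Qed.

Lemma alternatingD d (Y Z : 'M[F]_d) : alternating Y -> alternating Z -> alternating (Y + Z).
Proof. by move=> Ya Za; rewrite -[Z]opprK; apply/alternatingB/alternatingN. Qed.

Lemma alternating_congr d e (A : 'M[F]_(e, d)) (Z : 'M[F]_d) :
  alternating Z -> alternating (A *m Z *m A^T).
Proof.
move=> [W ->]; exists (A *m W *m A^T).
by rewrite !trmx_mul trmxK mulmxBr mulmxBl !mulmxA.
Qed.

Lemma card_ltn_pairs d : #|[set p : 'I_d * 'I_d | (p.1 < p.2)%N]| = 'C(d, 2).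
Proof.
rewrite -sum1_card (eq_bigl (fun p : 'I_d * 'I_d => (p.1 < p.2)%N)); last by move=> p; rewrite inE.
rewrite -(pair_big_dep xpredT (fun i j : 'I_d => (i < j)%N) (fun _ _ => 1%N)) /=.
rewrite (exchange_big_dep xpredT) //= -bin2_sum big_mkord; apply: eq_bigr => j _.
by rewrite -(big_ord_widen d (fun=> 1%N) (ltnW (ltn_ord j))) sum1_card card_ord.
Qed.

Lemma has_dim_alternating d : has_dim (@alternating d) 'C(d, 2).
Proof.
rewrite -card_ltn_pairs; set J := [set p | _].
pose up (c : 'rV[F]_#|J|) : 'M[F]_d :=
  \matrix_(i, j) \sum_(l < #|J|) c 0 l *+ (enum_val l == (i, j)).
have upE c l : up c (enum_val l).1 (enum_val l).2 = c 0 l.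
  rewrite mxE (bigD1 l) //= -surjective_pairing eqxx mulr1n big1 ?addr0 // => k kl.
  by rewrite (inj_eq enum_val_inj) (negPf kl) mulr0n.
have up0 c (i j : 'I_d) : ~~ (i < j)%N -> up c i j = 0.
  move=> ij; rewrite mxE big1 // => l _; case: eqP => [e|]; last by rewrite mulr0n.
  by have := enum_valP l; rewrite e inE /= (negPf ij).
pose g c := up c - (up c)^T.
have upL : linear up.
  move=> k x y; apply/matrixP=> i j; rewrite !mxE mulr_sumr -big_split /=.
  by apply: eq_bigr => l _; rewrite !mxE mulrnDl mulrnAr.
have gL : linear g.
  move=> k x y; rewrite /g upL linearP /= opprD addrACA -scalerBr //.
pose gM := GRing.isLinear.Build _ _ _ _ g gL.
pose G : {linear 'rV[F]_#|J| -> 'M[F]_d} := HB.pack g gM.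
exists G; split=> [|Z].
  apply: linear_inj => c /matrixP c0; apply/rowP=> l; rewrite [RHS]mxE -upE.
  have lt : ((enum_val l).1 < (enum_val l).2)%N by have := enum_valP l; rewrite inE.
  have := c0 (enum_val l).1 (enum_val l).2; rewrite [LHS]mxE [X in _ + X]mxE [X in _ - X]mxE.
  by rewrite [RHS]mxE (up0 c (enum_val l).2) ?subr0 // -leqNgt ltnW.
split=> [Za|[c <-]]; last by exists (up c).
exists (\row_l Z (enum_val l).1 (enum_val l).2); set c := \row_l _.
have upZ (i j : 'I_d) : (i < j)%N -> up c i j = Z i j.
  move=> ij; have ijJ : (i, j) \in J by rewrite inE.
  have := upE c (enum_rank_in ijJ (i, j)); rewrite enum_rankK_in //= => ->.
  by rewrite mxE enum_rankK_in.
have /matrixP Zt := alternating_tr Za.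
apply/matrixP=> i j; rewrite [LHS]mxE [X in _ + X]mxE [X in _ - X]mxE.
have [ij|ij|/val_inj ->] := ltngtP i j.
- by rewrite (upZ i j ij) (up0 c j i) ?subr0 // -leqNgt ltnW.
- rewrite (up0 c i j) ?sub0r; last by rewrite -leqNgt ltnW.
  by rewrite (upZ j i ij); have := Zt i j; rewrite !mxE => ->; rewrite opprK.
by rewrite subrr alternating_diag.
Qed.
End HasDim.

(** * Alternating forms on the edges of a graph *)

Section LocallyConstant.
Variables (F : fieldType) (nv : nat) (e : rel 'I_nv) (X : {set 'I_nv}) (s : 'I_nv -> F).
Hypotheses (sym_e : connect_sym e) (X_closed : forall v w, e v w -> (v \in X) = (w \in X)).
Hypothesis s_neq0 : forall v, s v != 0.

(** One free parameter per class. The weights [s] cover both uses: [s = 1] gives functions constant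
    on components, and the sign of a proper colouring gives functions that alternate along edges. *)
Lemma has_dim_locally_constant : has_dim (fun t : 'rV[F]_nv =>
    (forall v, v \notin X -> t 0 v = 0) /\
    (forall v w, v \in X -> e v w -> s v * t 0 v = s w * t 0 w))
  #|eclass e @: X|.
Proof.
set J := eclass e @: X.
pose g (c : 'rV[F]_#|J|) : 'rV[F]_nv :=
  \row_v \sum_(l < #|J|) c 0 l * ((s v)^-1 *+ ((v \in X) && (enum_val l == eclass e v))).
have gX c v l : v \in X -> enum_val l = eclass e v -> g c 0 v = c 0 l / s v.
  move=> vX el; rewrite mxE (bigD1 l) //= vX el eqxx mulr1n big1 ?addr0 // => k kl.
  by rewrite -el (inj_eq enum_val_inj) (negPf kl) mulr0n mulr0.
have rep (l : 'I_#|J|) : exists2 v, v \in X & enum_val l = eclass e v :> {set 'I_nv}.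
  by apply/imsetP; exact: enum_valP.
have cls v : v \in X -> exists l : 'I_#|J|, enum_val l = eclass e v.
  move=> vX; have vJ : eclass e v \in J by apply: imset_f.
  by exists (enum_rank_in vJ (eclass e v)); rewrite enum_rankK_in.
have gL : linear g.
  move=> k x y; apply/rowP=> v; rewrite !mxE mulr_sumr -big_split /=.
  by apply: eq_bigr => l _; rewrite !mxE mulrDl mulrA.
pose gM := GRing.isLinear.Build _ _ _ _ g gL.
pose G : {linear 'rV[F]_#|J| -> 'rV[F]_nv} := HB.pack g gM.
exists G; split=> [|t].
  apply: linear_inj => c /rowP c0; apply/rowP=> l; rewrite [RHS]mxE.
  have [v vX el] := rep l; have := c0 v; rewrite [LHS](gX _ _ _ vX el) [RHS]mxE => /eqP.
  by rewrite mulf_eq0 invr_eq0 (negPf (s_neq0 v)) orbF => /eqP.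
split=> [[t0 te]|[c <-]]; last first.
  split=> [v /negPf vX|v w vX vw].
    by rewrite mxE big1 // => l _; rewrite vX mulr0n mulr0.
  have [l el] := cls v vX; have wX : w \in X by rewrite -(X_closed vw).
  have ew : enum_val l = eclass e w.
    by rewrite el; apply/eqP; rewrite eq_eclass // connect1.
  rewrite [G c 0 v](gX _ _ _ vX el) [G c 0 w](gX _ _ _ wX ew).
  by rewrite mulrCA mulfV // mulrCA mulfV.
have [r rX rE] := fin_all_exists2 rep.
have const v w : connect e v w ->
    (v \in X) = (w \in X) /\ (v \in X -> s v * t 0 v = s w * t 0 w).
  move: v w; apply: (@connect_min _ _ (fun v w =>
    (v \in X) = (w \in X) /\ (v \in X -> s v * t 0 v = s w * t 0 w))) => //.
    move=> v w z [vw evw] [wz ewz]; split=> [|vX]; first by rewrite vw.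
    by rewrite evw // ewz // -vw.
  by move=> v w vw; split=> [|vX]; [apply: X_closed | apply: te].
exists (\row_l (s (r l) * t 0 (r l))); apply/rowP=> v.
case: (boolP (v \in X)) => vX; last first.
  by rewrite t0 // mxE big1 // => l _; rewrite (negPf vX) mulr0n mulr0.
have [l el] := cls v vX; rewrite [LHS](gX _ _ _ vX el) mxE.
have [|_ ->] := const (r l) v; first by rewrite -eq_eclass // -rE el.
  by rewrite mulrAC mulfV ?mul1r.
exact: rX.
Qed.
End LocallyConstant.

Section OrientedGraph.
Variables (nv ne : nat) (src tgt : 'I_ne -> 'I_nv).
Hypothesis src_tgt : forall e, src e != tgt e.

Definition incidence (R : pzRingType) : 'M[R]_(nv, ne) :=
  \matrix_(v, e) ((v == src e) || (v == tgt e))%:R.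
Definition coboundary (R : pzRingType) : 'M[R]_(nv, ne) :=
  \matrix_(v, e) ((v == tgt e)%:R - (v == src e)%:R).

Lemma mul_delta_row (R : pzRingType) (t : 'rV[R]_nv) a : \sum_v t 0 v * (v == a)%:R = t 0 a.
Proof.
rewrite (bigD1 a) //= eqxx mulr1 big1 ?addr0 // => v /negPf->.
by rewrite mulr0.
Qed.

Lemma incidenceE (R : pzRingType) v e : incidence R v e = (v == src e)%:R + (v == tgt e)%:R.
Proof.
rewrite mxE; case: (eqVneq v (src e)) => [->|_] /=; last by rewrite add0r.
by rewrite (negPf (src_tgt e)) addr0.
Qed.

Lemma mul_incidence (R : pzRingType) (t : 'rV[R]_nv) e :
  (t *m incidence R) 0 e = t 0 (src e) + t 0 (tgt e).
Proof.
rewrite mxE; under eq_bigr => v _ do rewrite incidenceE mulrDr.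
by rewrite big_split /= !mul_delta_row.
Qed.

Lemma mul_coboundary (R : pzRingType) (t : 'rV[R]_nv) e :
  (t *m coboundary R) 0 e = t 0 (tgt e) - t 0 (src e).
Proof.
rewrite mxE; under eq_bigr => v _ do rewrite mxE mulrBr.
by rewrite sumrB !mul_delta_row.
Qed.

Section Subgraph.
Variable S : {set 'I_ne}.

Definition adj_in : rel 'I_nv := fun v w => [exists e in S,
  (v == src e) && (w == tgt e) || (v == tgt e) && (w == src e)].

Lemma adj_in_sym : connect_sym adj_in.
Proof.
apply: sym_connect_sym => v w; apply/exists_inP/exists_inP => -[e eS H]; exists e => //;
by rewrite orbC [X in X || _]andbC [X in _ || X]andbC.
Qed.

(** The cycles are the kernel of the transposed coboundary matrix restricted to [S]. Its rank
    follows from the left kernel of the coboundary matrix, the functions constant on the components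
    of [S]. *)
Lemma has_dim_cycles (F : fieldType) : exists2 d,
  has_dim (fun u : 'rV[F]_ne => u *m (coboundary F)^T = 0 /\ forall e, e \notin S -> u 0 e = 0) d
  & (d + nv = #|S| + #|eclasses adj_in|)%N.
Proof.
pose h (l : 'I_#|S|) : 'I_ne := enum_val l.
pose C := colsub h (coboundary F).
have CE (t : 'rV_nv) l : (t *m C) 0 l = t 0 (tgt (h l)) - t 0 (src (h l)).
  by rewrite mulmx_colsub mxE mul_coboundary.
have rC : (\rank C + #|eclasses adj_in| = nv)%N.
  apply: has_dim_rank.
  have -> : #|eclasses adj_in| = #|eclass adj_in @: [set: 'I_nv]|.
    congr #|pred_of_set _|; apply/setP=> Z; apply/imsetP/imsetP => -[x _ ->]; exists x => //.
  apply: has_dim_ext (has_dim_locally_constant adj_in_sym _ (fun=> oner_neq0 F)); last first.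
    by move=> v w _; rewrite !inE.
  move=> t; split=> [[_ H]|/rowP H].
    apply/rowP=> l; rewrite CE [RHS]mxE; apply/eqP; rewrite subr_eq0; apply/eqP.
    have := H (tgt (h l)) (src (h l)) (in_setT _); rewrite !mul1r; apply.
    by apply/exists_inP; exists (h l); [exact: enum_valP | rewrite !eqxx orbT].
  split=> [v|v w _ /exists_inP[e eS vw]]; first by rewrite inE.
  have := H (enum_rank_in eS e); rewrite CE [RHS]mxE /h enum_rankK_in // => /eqP.
  rewrite subr_eq0 => /eqP te; rewrite !mul1r.
  by case/orP: vw => /andP[/eqP-> /eqP->].
have dk := has_dim_ker C^T; rewrite mxrank_tr in dk.
exists (#|S| - \rank C)%N; last by have := rank_leq_col C; lia.
pose E : 'M[F]_(#|S|, ne) := rowsub h 1%:M.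
have EE (u : 'rV_#|S|) e : (u *m E) 0 e = \sum_l u 0 l * (h l == e)%:R.
  by rewrite mxE; apply: eq_bigr => l _; rewrite !mxE.
have Eh (u : 'rV_#|S|) l : (u *m E) 0 (h l) = u 0 l.
  rewrite EE (bigD1 l) //= eqxx mulr1 big1 ?addr0 // => k kl.
  by rewrite (inj_eq enum_val_inj) (negPf kl) mulr0.
have EC : E *m (coboundary F)^T = C^T.
  by rewrite mul_rowsub_mx mul1mx; apply/matrixP=> i j; rewrite !mxE.
apply: (has_dim_inj (f := mulmxr E)) dk => [|u].
  by apply: linear_inj => u /= /rowP u0; apply/rowP=> l; rewrite -Eh u0 !mxE.
split=> [[uC uS]|[x xC <-]].
  have uE : (\row_l u 0 (h l)) *m E = u.
    apply/rowP=> e; case: (boolP (e \in S)) => eS.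
      have -> : e = h (enum_rank_in eS e) by rewrite /h enum_rankK_in.
      by rewrite Eh mxE.
    rewrite uS // EE big1 // => l _; case: eqP => [el|]; last by rewrite mulr0.
    by case/negP: eS; rewrite -el; apply: enum_valP.
  by exists (\row_l u 0 (h l)); rewrite //= -EC mulmxA uE.
rewrite /= -mulmxA EC; split=> // e eS; rewrite EE big1 // => l _.
case: eqP => [el|]; last by rewrite mulr0.
by case/negP: eS; rewrite -el; apply: enum_valP.
Qed.
End Subgraph.
End OrientedGraph.

Section Forms.
Variables (nv ne : nat) (src tgt : 'I_ne -> 'I_nv).
Hypothesis src_tgt : forall e, src e != tgt e.
Variable F : fieldType.
Notation B := (incidence src tgt F).
Notation C := (coboundary src tgt F).

(* The forms that vanish on the lattice [oriented_lattice] below. *)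
Definition edge_form (Om : 'M[F]_ne) :=
  alternating Om /\ exists u : 'rV_ne, Om *m B^T = diag_mx u *m C^T.

(** The two obstructions to finding a form over [u]: the diagonal of [B *m Om *m B^T] is [u *m C^T],
    so it must vanish; and a [t] killed by [B] gives [Om *m B^T *m t^T = 0]. *)
Definition liftable (u : 'rV[F]_ne) := u *m C^T = 0 /\
  forall t : 'rV_nv, t *m B = 0 -> forall e, u 0 e * (t 0 (tgt e) - t 0 (src e)) = 0.

Lemma diag_coboundaryE (u : 'rV[F]_ne) e v :
  (diag_mx u *m C^T) e v = u 0 e * ((v == tgt e)%:R - (v == src e)%:R).
Proof. by rewrite mul_diag_mx !mxE. Qed.

(** Off the diagonal an edge contributes [u e] at its source and target and [- u e] at the
    transposed place. The diagonal is [u *m C^T], which is 0 for a cycle. *)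
Lemma alternating_incidence (u : 'rV[F]_ne) : u *m C^T = 0 -> alternating (B *m (diag_mx u *m C^T)).
Proof.
move=> uC; exists (\matrix_(v, w) \sum_e u 0 e * ((v == src e)%:R * (w == tgt e)%:R)).
apply/matrixP=> v w; rewrite !mxE -sumrB.
have uCv : \sum_e u 0 e * ((v == tgt e)%:R - (v == src e)%:R) = 0.
  transitivity ((u *m C^T) 0 v); last by rewrite uC mxE.
  by rewrite mxE; apply: eq_bigr => e _; rewrite !mxE.
transitivity ((\sum_e u 0 e * ((v == tgt e)%:R - (v == src e)%:R)) * (v == w)%:R
  + \sum_e (u 0 e * ((v == src e)%:R * (w == tgt e)%:R) - u 0 e * ((w == src e)%:R * (v == tgt e)%:R))).
  rewrite mulr_suml -big_split; apply: eq_bigr => e _ /=.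
  rewrite incidenceE // diag_coboundaryE (eq_sym v w).
  case: (eqVneq v (src e)) => [vs|vs].
    have -> : (v == tgt e) = false by rewrite vs; apply/negbTE.
    rewrite (eq_sym w v); case: (eqVneq v w) => [<-|vw].
      rewrite vs eqxx (negPf (src_tgt e)) /=.
      by rewrite /= ?mulr1n ?mulr0n !(mulr0, mulr1, mul1r, mul0r, addr0, add0r, subr0, sub0r, oppr0).
    have -> : (w == src e) = false by rewrite -vs eq_sym; apply/negbTE.
    by rewrite /= ?mulr1n ?mulr0n !(mulr0, mulr1, mul1r, mul0r, addr0, add0r, subr0, sub0r, oppr0).
  case: (eqVneq v (tgt e)) => [vt|vt]; last first.
    by rewrite /= ?mulr1n ?mulr0n !(mulr0, mulr1, mul1r, mul0r, addr0, add0r, subr0, sub0r, oppr0).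
  rewrite (eq_sym w v); case: (eqVneq v w) => [<-|vw].
    rewrite vt eqxx eq_sym (negPf (src_tgt e)) /=.
    by rewrite /= ?mulr1n ?mulr0n !(mulr0, mulr1, mul1r, mul0r, addr0, add0r, subr0, sub0r, oppr0).
  have -> : (w == tgt e) = false by rewrite -vt eq_sym; apply/negbTE.
  by rewrite /= ?mulr1n ?mulr0n !(mulr0, mulr1, mul1r, mul0r, addr0, add0r, subr0, sub0r, oppr0) ?mulrN.
by rewrite uCv mul0r add0r.
Qed.

(** The rows of such an [Om] lie in the kernel of [B^T], and by skew symmetry so do its columns;
    hence [Om = K^T *m Z *m K] for a basis [K] of that kernel and an alternating [Z]. *)
Lemma has_dim_alternating_ker :
  has_dim (fun Om : 'M[F]_ne => alternating Om /\ Om *m B^T = 0) 'C(ne - \rank B, 2).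
Proof.
rewrite -mxrank_tr -mxrank_ker.
have [K Kfree eK] : exists2 K : 'M[F]_(\rank (kermx B^T), ne), row_free K & (K :=: kermx B^T)%MS.
  by exists (row_base (kermx B^T)); [apply: row_base_free | apply: eq_row_base].
have [K' KK'] := row_freeP Kfree.
have KB : K *m B^T = 0 by apply/sub_kermxP; rewrite eK.
pose g (Z : 'M[F]_(\rank (kermx B^T))) : 'M[F]_ne := K^T *m Z *m K.
have gL : linear g.
  by move=> k x y; rewrite /g mulmxDr mulmxDl -scalemxAr -scalemxAl.
pose gM := GRing.isLinear.Build _ _ _ _ g gL.
pose G : {linear 'M[F]_(\rank (kermx B^T)) -> 'M[F]_ne} := HB.pack g gM.
have GE Z : G Z = K^T *m Z *m K by [].
have K'K : K'^T *m K^T = 1%:M by rewrite -trmx_mul KK' trmx1.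
have Ginv Z : K'^T *m G Z *m K' = Z.
  by rewrite GE -!mulmxA KK' mulmx1 mulmxA K'K mul1mx.
apply: (has_dim_inj (f := G)) (has_dim_alternating F _) => [|Om].
  by apply: (@can_inj _ _ _ (fun M => K'^T *m M *m K')) => Z; apply: Ginv.
split=> [[Oa OB]|[Z Za <-]]; last first.
  rewrite GE; split; last by rewrite -mulmxA KB mulmx0.
  by rewrite -{2}[K]trmxK; apply: alternating_congr.
have /submxP[Q OQ] : (Om <= K)%MS by rewrite eK; apply/sub_kermxP.
have OK : Om *m K' *m K = Om by rewrite OQ -(mulmxA Q) KK' mulmx1.
exists (K'^T *m Om *m K').
  by rewrite -{2}[K']trmxK; apply: alternating_congr.
rewrite GE -!mulmxA [Om *m _]mulmxA OK !mulmxA.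
have Ot := alternating_tr Oa.
have -> : K^T *m K'^T *m Om = (Om^T *m K' *m K)^T by rewrite !trmx_mul trmxK mulmxA.
by rewrite Ot !mulNmx OK linearN /= Ot opprK.
Qed.

Lemma form_liftable Om u : alternating Om -> Om *m B^T = diag_mx u *m C^T -> liftable u.
Proof.
move=> Oa OB; split.
  apply/rowP=> v; rewrite [RHS]mxE.
  have Ba : alternating (B *m Om *m B^T) by apply: alternating_congr.
  rewrite -(alternating_diag v Ba) -mulmxA OB [LHS]mxE [RHS]mxE.
  apply: eq_bigr => e _; rewrite incidenceE // diag_coboundaryE [C^T e v]mxE [C v e]mxE mulrCA.
  congr (_ * _); case: (eqVneq v (src e)) => [->|_] /=.
    by rewrite (negPf (src_tgt e)) /= mulr0n addr0 mul1r.
  by rewrite add0r subr0; case: (v == tgt e); rewrite /= ?mulr1n ?mulr0n ?mul1r ?mul0r.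
move=> t tB e; have : (Om *m B^T *m t^T) e 0 = 0.
  by rewrite -mulmxA -trmx_mul tB trmx0 mulmx0 mxE.
rewrite OB => OBt; rewrite -[RHS]OBt [RHS]mxE.
transitivity (\sum_v (u 0 e * (t 0 v * (v == tgt e)%:R) - u 0 e * (t 0 v * (v == src e)%:R))).
  by rewrite sumrB -!mulr_sumr !mul_delta_row mulrBr.
apply: eq_bigr => v _; rewrite diag_coboundaryE [t^T v 0]mxE -mulrBr -mulrBr -mulrA; congr (_ * _).
by rewrite mulrC.
Qed.

(* A solution of Om *m B^T = U, where U = diag_mx u *m C^T; the last term
   makes it alternating, as B *m U is. *)
Definition lift_form (u : 'rV[F]_ne) : 'M[F]_ne :=
  let U := diag_mx u *m C^T in let p := pinvmx B in
  U *m p^T - p *m U^T - p *m (B *m U) *m p^T.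

Lemma lift_form_linear : linear lift_form.
Proof.
move=> k x y; rewrite /lift_form linearP /= mulmxDl -scalemxAl.
set V := _ *m C^T; set W := _ *m C^T; set p := pinvmx B.
rewrite [(k *: V + W)^T]linearP /= !(mulmxDl, mulmxDr) -!(scalemxAl, scalemxAr) ?mulmxDl -?scalemxAl. 
by rewrite !scalerBr !opprD [RHS]addrACA [X in _ = X + _]addrACA.
Qed.

Lemma lift_formP u : liftable u -> alternating (lift_form u) /\ lift_form u *m B^T = diag_mx u *m C^T.
Proof.
move=> [uC uker]; rewrite /lift_form; set U := diag_mx u *m C^T; set p := pinvmx B.
have Ba : alternating (B *m U) by apply: alternating_incidence.
have BpB : B *m p *m B = B by apply: mulmxKpV.
(* The rows of [B *m p - 1] are killed by [B], so the second condition in [liftable] applies to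
   them. *)
have UBp : U *m (B *m p)^T = U.
  apply/eqP; rewrite -subr_eq0 -[X in _ - X]mulmx1 -[X in _ - _ *m X]trmx1 -mulmxBr -linearB /=.
  apply/eqP/matrixP=> e v; rewrite [RHS]mxE [LHS]mxE.
  pose t := row v (B *m p - 1%:M).
  have tB : t *m B = 0 by rewrite -row_mul mulmxBl BpB mul1mx subrr row0.
  transitivity (u 0 e * (t 0 (tgt e) - t 0 (src e))); last exact: uker.
  transitivity (\sum_w (u 0 e * (t 0 w * (w == tgt e)%:R) - u 0 e * (t 0 w * (w == src e)%:R))).
    apply: eq_bigr => w _; rewrite diag_coboundaryE [_^T w v]mxE [t 0 w]mxE -!mulrBr -mulrA; congr (_ * _).
    by rewrite mulrC.
  by rewrite sumrB -!mulr_sumr !mul_delta_row mulrBr.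
split.
  apply: alternatingB; last exact: alternating_congr.
  by exists (U *m p^T); rewrite [(U *m p^T)^T]trmx_mul trmxK.
rewrite !mulmxBl -[p *m U^T *m B^T]mulmxA -[U^T *m B^T]trmx_mul (alternating_tr Ba).
rewrite -[U *m p^T *m B^T]mulmxA -[p *m _ *m p^T *m B^T]mulmxA -[p^T *m B^T]trmx_mul UBp.
rewrite -[p *m (B *m U) *m _]mulmxA -[B *m U *m _]mulmxA UBp mulmxN opprK.
by rewrite addrK.
Qed.

(** The forms are an extension of the liftable [u] by the forms with [u = 0], split by [lift_form].
    The projection recovers [u e] as the entry of [Om *m B^T] at the target of [e]. *)
Lemma has_dim_forms b : has_dim liftable b -> has_dim edge_form ('C(ne - \rank B, 2) + b).
Proof.
move=> db.
pose f (Om : 'M[F]_ne) : 'rV[F]_ne := \row_e (Om *m B^T) e (tgt e).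
have fL : linear f.
  by move=> k x y; apply/rowP=> e; rewrite mxE mulmxDl -scalemxAl !mxE; congr (_ * _ + _);
     apply: eq_bigr => ? _; rewrite !mxE.
pose fM := GRing.isLinear.Build _ _ _ _ f fL.
pose f' : {linear 'M[F]_ne -> 'rV[F]_ne} := HB.pack f fM.
pose hM := GRing.isLinear.Build _ _ _ _ lift_form lift_form_linear.
pose h : {linear 'rV[F]_ne -> 'M[F]_ne} := HB.pack lift_form hM.
have fE Om u : Om *m B^T = diag_mx u *m C^T -> f Om = u.
  move=> OB; apply/rowP=> e; rewrite mxE OB diag_coboundaryE eqxx.
  by rewrite [tgt e == _]eq_sym (negPf (src_tgt e)) subr0 mulr1.
have formD x y : edge_form x -> edge_form y -> edge_form (x + y).
  move=> [xa [u xu]] [ya [w yw]]; split; first exact: alternatingD.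
  by exists (u + w); rewrite mulmxDl xu yw linearD mulmxDl.
have formB x y : edge_form x -> edge_form y -> edge_form (x - y).
  move=> [xa [u xu]] [ya [w yw]]; split; first exact: alternatingB.
  by exists (u - w); rewrite mulmxBl xu yw linearB mulmxBl.
apply: (has_dim_add (f := f') (h := h) formD formB (Q := liftable)) => //.
- by move=> Om [Oa [u Ou]]; rewrite [f' _](fE _ _ Ou); apply: form_liftable Ou.
- move=> u /lift_formP[ha hB]; split; last exact: fE.
  by split=> //; exists u.
apply: has_dim_ext has_dim_alternating_ker => Om; split=> [[Oa OB]|[[Oa [u Ou]] fO]].
  have Ou : Om *m B^T = diag_mx 0 *m C^T by rewrite OB linear0 mul0mx.
  by split; [split=> //; exists 0 | apply: fE].
split=> //; rewrite Ou; have -> : u = 0 by rewrite -(fE _ _ Ou).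
by rewrite linear0 mul0mx.
Qed.
End Forms.

(* The torsion of an exterior square is killed by 2 as soon as that of the
   module is: M is the presentation matrix of the module. *)
Lemma sym_torsion q p (M : 'M[int]_(q, p)) :
  (forall x m, (0 < m)%N -> in_rows M (x *+ m) -> in_rows M (x *+ 2)) ->
  forall (Y : 'M[int]_p) (N : 'M[int]_(p, q)) m, (0 < m)%N ->
    (Y *+ m - N *m M)^T = Y *+ m - N *m M ->
  exists N1, (Y *+ 2 - N1 *m M)^T = Y *+ 2 - N1 *m M.
Proof.
move=> tor2 Y N m m0 symN.
have [R [delta [uR rowsP delta2 _]]] := smith_torsion tor2.
have mulmn (a : int) k : a *+ k = a * k%:Z by rewrite -mulr_natr natz.
(* Congruence by the Smith basis preserves symmetry and makes the row lattice diagonal: column [j]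
   has to be divisible by [delta j]. *)
pose W := invmx R^T; have uRt : R^T \in unitmx by rewrite unitmx_tr.
pose cv (A : 'M[int]_p) := W *m A *m invmx R.
have cvt A : (cv A)^T = cv A^T.
  by rewrite /cv !trmx_mul /W -trmx_inv trmxK mulmxA trmx_inv.
have cvB A A' : cv (A - A') = cv A - cv A' by rewrite /cv mulmxBr mulmxBl.
have cvMn A k : cv (A *+ k) = cv A *+ k by rewrite /cv -!scaler_nat -scalemxAr -scalemxAl.
have symE A : (cv A)^T = cv A -> A^T = A.
  rewrite cvt => /(congr1 (fun Z => R^T *m Z *m R)); rewrite /cv !mulmxA !mulmxV // !mul1mx.
  by rewrite !mulmxKV.
have rowE A i : row i (cv A) = row i (W *m A) *m invmx R by rewrite /cv row_mul.
have [y ey] : exists y, y = cv Y by exists (cv Y).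
have [x ex] : exists x, x = cv (N *m M) by exists (cv (N *m M)).
have xd i j : x i j \in dvdz (delta j).
  have /rowsP/(_ j) : in_rows M (row i (W *m (N *m M))).
    by exists (row i (W *m N)); rewrite -row_mul mulmxA.
  by rewrite -rowE -ex mxE.
have yx i j : (y i j - y j i) * m%:Z = x i j - x j i.
  have := congr1 cv symN; rewrite -cvt cvB cvMn -ey -ex => /matrixP/(_ j i).
  have aux (a b c d k : int) : a * k - c = b * k - d -> (a - b) * k = c - d by nia.
  by rewrite !mxE !mulmxnE !mulmn; apply: aux.
(* The asymmetry [2 * (y i j - y j i)] is absorbed at one of the two transposed places, in a column
   whose invariant is nonzero and hence divides 2. If both invariants are 0, the relation for [m]
   shows that there is no asymmetry. *)
pose x1 : 'M[int]_p := \matrix_(i, j) (if (delta j != 0) && ((i < j)%N || (delta i == 0))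
   then 2 * (y i j - y j i) else 0).
have [N1 eN1] : exists N1, cv (N1 *m M) = x1.
  have rowx i : exists v : 'rV_q, v *m M = row i (R^T *m x1 *m R).
    have rowx j : (row i (R^T *m x1 *m R) *m invmx R) 0 j \in dvdz (delta j).
      rewrite -row_mul -mulmxA mulmxV // mulmx1 [X in X \in _]mxE [X in X \in _]mxE.
      apply: rpred_sum => k _; rewrite [x1 _ _]mxE.
      case: ifP => [/andP[dj _]|_]; last by rewrite mulr0 rpred0.
      by apply: dvdz_mull; apply: dvdz_mulr; apply: delta2.
    exact: (proj2 (rowsP _) rowx).
  have [v vE] := fin_all_exists rowx; exists (\matrix_i v i).
  have -> : (\matrix_i v i) *m M = R^T *m x1 *m R.
    by apply/row_matrixP => i; rewrite row_mul rowK vE.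
  by rewrite /cv !mulmxA mulVmx // mul1mx -mulmxA mulmxV // mulmx1.
exists N1; apply: symE; rewrite cvB cvMn eN1 -ey.
apply/matrixP=> i j; rewrite mxE ![(_ - x1) _ _]mxE ![(- x1) _ _]mxE !mulmxnE ![x1 _ _]mxE !mulr2n.
have both0 : delta i = 0 -> delta j = 0 -> y i j = y j i.
  move=> di dj; have := yx i j; have := xd i j; have := xd j i.
  rewrite di dj !dvd0z => /eqP -> /eqP ->; rewrite subrr => /eqP.
  rewrite mulf_eq0 subr_eq0 => /orP[/eqP //|]; by rewrite eqz_nat; case: m m0 {symN yx}.
case: (eqVneq (delta i) 0) => di; case: (eqVneq (delta j) 0) => dj /=; rewrite ?andbF ?andbT ?orbF ?orbT /=.
- by rewrite (both0 di dj).
- by ring.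
- by ring.
by case: ltngtP => [_|_|/val_inj ->] /=; ring.
Qed.

(** * The torsion is killed by 2 *)

Lemma intr_Zp_eq0 m (z : int) : (1 < m)%N -> (z%:~R == 0 :> 'Z_m) = (z \in dvdz m%:Z).
Proof.
move=> m1; have natE k : (k%:R == 0 :> 'Z_m) = (m %| k)%N.
  by rewrite -val_eqE /= val_Zp_nat.
rewrite dvdzE absz_nat; case: z => k; first by rewrite -pmulrn natE.
by rewrite NegzE abszN absz_nat mulrNz oppr_eq0 -pmulrn natE.
Qed.

Section Torsion2.
Variables (nv ne : nat) (src tgt : 'I_ne -> 'I_nv).
Hypothesis src_tgt : forall e, src e != tgt e.
Notation B := (incidence src tgt).
Notation C := (coboundary src tgt).

Lemma connect_dvd (S : {set 'I_ne}) (t : 'I_nv -> int) m :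
  (forall e, e \in S -> t (tgt e) - t (src e) \in dvdz m) ->
  forall v w, connect (adj_in src tgt S) v w -> t v - t w \in dvdz m.
Proof.
move=> tm; apply: connect_min => [v|v w z|v w /exists_inP[e eS]].
- by rewrite subrr rpred0.
- by move=> vw wz; rewrite -(subrK (t w) (t v)) -addrA rpredD.
case/orP=> /andP[/eqP-> /eqP->]; last exact: tm.
by rewrite -opprB rpredN tm.
Qed.

(** Linear duality: a row orthogonal to the right kernel of the coboundary matrix restricted to [S]
    lies in its row space. The columns of [cokermx], extended by 0, are the cycles to test
    against. *)
Lemma cocycle_exact (F : fieldType) (S : {set 'I_ne}) (c : 'I_ne -> F) :
  (forall u : 'rV_ne, u *m (C F)^T = 0 -> (forall e, e \notin S -> u 0 e = 0) ->
     \sum_e u 0 e * c e = 0) ->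
  exists f : 'I_nv -> F, forall e, e \in S -> c e = f (tgt e) - f (src e).
Proof.
move=> Hc; pose h (l : 'I_#|S|) : 'I_ne := enum_val l.
pose CS := colsub h (C F); pose cS : 'rV[F]_#|S| := \row_l c (h l).
have /submxP[f fE] : (cS <= CS)%MS.
  rewrite submxE; apply/eqP/rowP => j; rewrite [RHS]mxE.
  pose u : 'rV[F]_ne := \row_e \sum_(l < #|S|) cokermx CS l j * (h l == e)%:R.
  have sumE (g : 'I_ne -> F) : \sum_e u 0 e * g e = \sum_l cokermx CS l j * g (h l).
    under eq_bigr => e _ do rewrite mxE mulr_suml.
    rewrite exchange_big; apply: eq_bigr => l _ /=.
    rewrite (bigD1 (h l)) //= eqxx mulr1 big1 ?addr0 // => e /negPf ne_e.
    by rewrite eq_sym ne_e mulr0 mul0r.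
  rewrite mxE -[RHS](Hc u).
  - by rewrite sumE; apply: eq_bigr => l _; rewrite mulrC [cS 0 l]mxE.
  - apply/rowP=> v; rewrite [RHS]mxE mxE.
    under eq_bigr => e _ do rewrite [(C F)^T _ _]mxE.
    rewrite sumE; have /matrixP/(_ v j) := mulmx_coker CS; rewrite [RHS]mxE mxE => CK.
    by rewrite -[RHS]CK; apply: eq_bigr => l _; rewrite mulrC [CS v l]mxE.
  move=> e eS; rewrite mxE big1 // => l _; case: eqP => [el|]; last by rewrite mulr0.
  by case/negP: eS; rewrite -el; apply: enum_valP.
exists (fun v => f 0 v) => e eS.
have /rowP/(_ (enum_rank_in eS e)) := fE.
by rewrite /CS mulmx_colsub [LHS]mxE [RHS]mxE mul_coboundary /h enum_rankK_in.
Qed.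

(* The bipartite components, with a proper colouring; every alternating
   function is 2-torsion off them. *)
Variables (bip : {set 'I_nv}) (col : 'I_nv -> bool).
Hypotheses (bip_closed : forall e, (src e \in bip) = (tgt e \in bip))
  (bip_col : forall e, src e \in bip -> col (src e) != col (tgt e))
  (nbip_torsion : forall (A : zmodType) (t : 'I_nv -> A),
     (forall e, t (src e) = - t (tgt e)) -> forall v, v \notin bip -> t v + t v = 0).

(** A left kernel vector of the incidence matrix over any ring: the sign of the colouring on the
    bipartite part and 0 elsewhere. *)
Definition eps (R : pzRingType) v : R := if v \in bip then (-1) ^+ col v else 0.

Lemma eps_edge (R : pzRingType) e : eps R (src e) = - eps R (tgt e).
Proof.
rewrite /eps bip_closed; case: ifP => b; last by rewrite oppr0.
have := @bip_col e; rewrite bip_closed => /(_ b).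
by case: (col (src e)); case: (col (tgt e)); rewrite //= ?expr0 ?expr1 ?opprK.
Qed.

Lemma eps_sqr (R : pzRingType) v : v \in bip -> eps R v * eps R v = 1.
Proof.
by move=> vb; rewrite /eps vb; case: (col v); rewrite /= ?expr0 ?expr1 ?mulrNN mulr1.
Qed.

Lemma in_rows_incidence (x : 'rV[int]_ne) : in_rows (B int) x <->
  exists y : 'I_nv -> int, forall e, y (src e) + y (tgt e) = x 0 e.
Proof.
split=> [[y <-]|[y yE]]; first by exists (fun v => y 0 v) => e; rewrite mul_incidence.
exists (\row_v y v); apply/rowP=> e; rewrite mul_incidence // !mxE; exact: yE.
Qed.

Let edges_all := [set: 'I_ne].
Let adj := adj_in src tgt edges_all.

(** A solution [y] for [m x] is doubled, corrected and divided by [m]. Off the bipartite part [y]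
    alternates modulo [m], so [2 y] is divisible. On a bipartite component [eps y] is constant
    modulo [m], and subtracting this constant times [eps] changes no edge sum. *)
Lemma incidence_torsion2 (x : 'rV[int]_ne) m : (0 < m)%N ->
  in_rows (B int) (x *+ m) -> in_rows (B int) (x *+ 2).
Proof.
have mulmn (a : int) k : a *+ k = a * k%:Z by rewrite -mulr_natr natz.
(* The ring ['Z_m] is the integers modulo [m] only for [m > 1]. *)
case: m => [|[|m']] // _; first by move=> [y]; rewrite mulr1n => yE; exists (y *+ 2); rewrite -yE -!scaler_nat scalemxAl.
set m := m'.+2 => /in_rows_incidence[y yE]; apply/in_rows_incidence.
have m0 : m%:Z != 0 by [].
have nb v : v \notin bip -> y v *+ 2 \in dvdz m%:Z.
  move=> vb; rewrite -intr_Zp_eq0 // mulr2n rmorphD /=.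
  apply/eqP/(@nbip_torsion 'Z_m (fun v => (y v)%:~R)) => // e.
  apply/eqP; rewrite -subr_eq0 opprK -rmorphD /= yE intr_Zp_eq0 // mulmxnE mulmn.
  exact: dvdz_mull.
pose z v := eps int v * y v; pose r v := fingraph.root adj v.
have zr v : z v - z (r v) \in dvdz m%:Z.
  apply: (connect_dvd (S := edges_all)) (connect_root _ _) => e _.
  rewrite /z eps_edge mulNr opprK -mulrDr addrC yE mulmxnE mulmn mulrA.
  exact: dvdz_mull.
pose g v := divz (if v \in bip then (y v - eps int v * z (r v)) *+ 2 else y v *+ 2) m%:Z.
have gE v : g v * m%:Z = if v \in bip then (y v - eps int v * z (r v)) *+ 2 else y v *+ 2.
  rewrite /g divzK //; case: ifP => vb; last by apply: nb; rewrite vb.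
  rewrite -[y v]mul1r -(eps_sqr int vb) -mulrA -mulrBr mulmn mulrAC.
  by apply: dvdz_mull; apply: zr.
exists g => e; apply: (mulIf m0); rewrite mulrDl !gE -bip_closed.
have rE : r (src e) = r (tgt e).
  apply/(fingraph.rootP (adj_in_sym _ _ _))/connect1/exists_inP; exists e; rewrite ?inE //.
  by rewrite !eqxx.
have := yE e; rewrite !mulmxnE !mulmn.
case: ifP => _; rewrite ?rE ?eps_edge => h; last by rewrite -mulrDl h; ring.
by rewrite -mulrDl mulNr opprK addrACA subrr addr0 h; ring.
Qed.

Lemma alternating_sym_trace (F : fieldType) (Om S : 'M[F]_ne) :
  alternating Om -> S^T = S -> \tr (Om^T *m S) = 0.
Proof.
move=> [W ->] symS; rewrite linearB /= trmxK mulmxBl linearB /=.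
by rewrite -[\tr (W *m _)]mxtrace_tr trmx_mul symS mxtrace_mulC subrr.
Qed.

(** The pairing sees only the differences of [X] along edges, weighted by [u]. Hence it vanishes for
    [X] constant on edges, and in general [u] tests the failure of that constancy. *)
Lemma form_trace (F : fieldType) (X : 'M[F]_(ne, nv)) (Om : 'M[F]_ne) u :
  Om *m (B F)^T = diag_mx u *m (C F)^T ->
  \tr (Om^T *m (X *m B F)) = \sum_e u 0 e * (X e (tgt e) - X e (src e)).
Proof.
move=> OB; rewrite mulmxA mxtrace_mulC mulmxA.
have -> : B F *m Om^T = (diag_mx u *m (C F)^T)^T by rewrite -OB trmx_mul trmxK.
rewrite trmx_mul trmxK tr_diag_mx mxtrace_mulC mulmxA mxtrace_mulC /mxtrace.
apply: eq_bigr => e _; rewrite mul_diag_mx mxE; congr (_ * _).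
have -> : (X *m C F) e e = (row e X *m C F) 0 e by rewrite -row_mul [RHS]mxE.
by rewrite mul_coboundary // ![row e X _ _]mxE.
Qed.

Lemma form_pairing (F : fieldType) (X : 'M[F]_(ne, nv)) (Om : 'M[F]_ne) u :
  alternating Om -> Om *m (B F)^T = diag_mx u *m (C F)^T -> (X *m B F)^T = X *m B F ->
  \sum_e u 0 e * (X e (tgt e) - X e (src e)) = 0.
Proof. by move=> Oa OB symX; rewrite -(form_trace X OB); apply: alternating_sym_trace. Qed.

Definition end_const (R : Type) (N : 'M[R]_(ne, nv)) := forall e, N e (src e) = N e (tgt e).

Definition oriented_lattice (Y : 'M[int]_ne) := exists2 N : 'M[int]_(ne, nv),
  end_const N & (Y - N *m B int)^T = Y - N *m B int.

Definition nbip_edges : {set 'I_ne} := [set e | src e \notin bip].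

(** The kernel vector [eps] changes by 2 in absolute value along a bipartite edge, forcing [u] to
    vanish there. Conversely a rational kernel vector vanishes off the bipartite part, where it is
    2-torsion. *)
Lemma liftable_rat (u : 'rV[rat]_ne) : liftable src tgt u <->
  u *m (C rat)^T = 0 /\ forall e, e \notin nbip_edges -> u 0 e = 0.
Proof.
split=> [[uC uB]|[uC uS]]; split=> //.
  move=> e; rewrite inE negbK => eb; pose t : 'rV[rat]_nv := \row_v eps rat v.
  have tB : t *m B rat = 0.
    by apply/rowP=> e'; rewrite mul_incidence // !mxE eps_edge addNr.
  have := uB t tB e; rewrite !mxE eps_edge opprK => /eqP.
  rewrite mulf_eq0 -mulr2n mulrn_eq0 /= => /orP[/eqP //|/eqP t0].
  by have := eps_sqr rat (_ : tgt e \in bip); rewrite t0 mul0r -bip_closed eb => /(_ isT)/eqP.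
move=> t tB e; case: (boolP (e \in nbip_edges)) => [|/uS->]; last by rewrite mul0r.
rewrite inE => eb.
have t0 v : v \notin bip -> t 0 v = 0.
  move=> vb; have tN e' : t 0 (src e') = - t 0 (tgt e').
    by apply/eqP; rewrite -addr_eq0 -mul_incidence // tB mxE.
  have /eqP := @nbip_torsion rat (fun v => t 0 v) tN v vb.
  by rewrite -mulr2n mulrn_eq0 => /eqP.
by rewrite !t0 -?bip_closed // subrr mulr0.
Qed.

(** In characteristic 2 the sum and the difference along an edge coincide, so the second condition
    in [liftable] is automatic. *)
Lemma liftable_F2 (u : 'rV['F_2]_ne) : liftable src tgt u <-> u *m (C 'F_2)^T = 0.
Proof.
split=> [[] //|uC]; split=> // t tB e.
have ch2 : 2%N \in [pchar 'F_2] by apply: pchar_Fp.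
by rewrite (oppr_pchar2 ch2) addrC -mul_incidence // tB mxE mulr0.
Qed.

Lemma incidence_map (F : fieldType) : map_mx (intr : int -> F) (B int) = B F.
Proof. by apply/matrixP=> v e; rewrite !mxE rmorph_nat. Qed.

(** A form over [u] is orthogonal to symmetric matrices. In the second alternative [X B] is
    symmetric only modulo 2, where the term [Y *+ 2] disappears. *)
Lemma liftable_pairing (F : fieldType) (X : 'M[int]_(ne, nv)) (u : 'rV[F]_ne) :
  (X *m B int)^T = X *m B int \/ (2%N \in [pchar F] /\ exists Y, (Y *+ 2 - X *m B int)^T = Y *+ 2 - X *m B int) ->
  liftable src tgt u -> \sum_e u 0 e * (X e (tgt e) - X e (src e))%:~R = 0.
Proof.
move=> symX lu; have [Oa OB] := lift_formP src_tgt lu.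
rewrite -[RHS](form_pairing (X := map_mx intr X) Oa OB).
  by apply: eq_bigr => e _; rewrite rmorphB !mxE.
rewrite -incidence_map -map_mxM; case: symX => [symX|[ch2 [Y symX]]].
  by rewrite matrix.map_trmx symX.
have Y2 : map_mx (intr : int -> F) (Y *+ 2) = 0.
  by apply/matrixP=> i j; rewrite [LHS]mxE [RHS]mxE mulmxnE rmorphMn /= (mulrn_pchar ch2).
have := congr1 (map_mx (intr : int -> F)) symX.
by rewrite -matrix.map_trmx map_mxB Y2 sub0r linearN => /oppr_inj.
Qed.

(** The defect [c] of [N1] is cancelled by two corrections that keep symmetry: [Nf], for which
    [Nf *m B] is [B^T *m diag f *m B], changes it by the coboundary of [f]; [Ng], for which
    [Ng *m B = 0], changes it by [2 * g] on bipartite edges. *)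
Lemma oriented_lattice_torsion2 (Y : 'M[int]_ne) m : (0 < m)%N ->
  oriented_lattice (Y *+ m) -> oriented_lattice (Y *+ 2).
Proof.
have mulmn (a : int) k : a *+ k = a * k%:Z by rewrite -mulr_natr natz.
move=> m0 [N Nc symN].
have [N1 symN1] := sym_torsion incidence_torsion2 m0 symN.
pose c e := N1 e (tgt e) - N1 e (src e).
have [f1 f1E] : exists f1 : 'I_nv -> int, forall e, e \in nbip_edges ->
    c e = f1 (tgt e) - f1 (src e).
  (* Off the bipartite part there is no correction [Ng], so [c] itself must be a coboundary. The
     combination [N1 *+ m - N *+ 2] has a symmetric product with [B], and its defect is [m] times
     [c] because [N] has none. *)
  have [f fE] : exists f : 'I_nv -> rat, forall e, e \in nbip_edges ->
      (c e)%:~R = f (tgt e) - f (src e).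
    apply: cocycle_exact => u uC uS; have /liftable_rat lu := conj uC uS.
    have ZE e v : (N1 *+ m - N *+ 2) e v = N1 e v * m%:Z - N e v * 2.
      by rewrite mxE [X in _ + X]mxE !mulmxnE !mulmn.
    have symZ : ((N1 *+ m - N *+ 2) *m B int)^T = (N1 *+ m - N *+ 2) *m B int.
      have -> : (N1 *+ m - N *+ 2) *m B int = (Y *+ m - N *m B int) *+ 2 - (Y *+ 2 - N1 *m B int) *+ m.
        have mulmxMnl (A : 'M[int]_(ne, nv)) k : (A *+ k) *m B int = (A *m B int) *+ k.
          by rewrite -!scaler_nat scalemxAl.
        by rewrite mulmxBl !mulmxMnl !mulrnBl -!mulrnA (mulnC 2 m) opprB [RHS]addrC addrA subrK.
      by rewrite linearB /= !linearMn /= symN symN1.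
    have := liftable_pairing (or_introl symZ) lu.
    under eq_bigr => e _.
      rewrite (_ : _ - _ = c e * m%:Z) ?rmorphM /= ?mulrA; last first.
        by rewrite !ZE Nc /c; ring.
      over.
    rewrite -mulr_suml => /eqP; rewrite mulf_eq0 => /orP[/eqP //|].
    by rewrite intr_eq0 eqz_nat; case: m m0 {symN symZ ZE}.
  (* The jumps of [f] along edges are the integers [c e], so subtracting its value at a root of each
     component makes it integral. *)
  pose r v := fingraph.root (adj_in src tgt nbip_edges) v.
  have intf v : exists k : int, f v - f (r v) = k%:~R.
    have : connect (adj_in src tgt nbip_edges) v (r v) by apply: connect_root.
    move: (r v) => w; move: v w.
    apply: (@connect_min _ _ (fun v w => exists k : int, f v - f w = k%:~R))
      => [v|v w z [k fk] [l fl]|v w /exists_inP[e eS]].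
    - by exists 0; rewrite subrr.
    - by exists (k + l); rewrite rmorphD /= -fk -fl addrA subrK.
    case/orP=> /andP[/eqP-> /eqP->]; last by exists (c e); rewrite fE.
    by exists (- c e); rewrite rmorphN /= fE // opprB.
  have [f1 f1E] := fin_all_exists intf; exists f1 => e eS.
  apply: (@intr_inj rat); rewrite fE // rmorphB /= -!f1E.
  have -> : r (tgt e) = r (src e).
    apply/esym/(fingraph.rootP (adj_in_sym _ _ _))/connect1/exists_inP; exists e => //.
    by rewrite !eqxx.
  by rewrite opprB addrA subrK.
have ch2 : 2%N \in [pchar 'F_2] by apply: pchar_Fp.
have [f2 f2E] : exists f2 : 'I_nv -> int, forall e, c e - (f2 (tgt e) - f2 (src e)) \in dvdz 2.
  (* On bipartite edges only the parity of [c] has to be a coboundary; [Ng] will take up the even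
     remainder. *)
  have [f fE] : exists f : 'I_nv -> 'F_2, forall e, e \in [set: 'I_ne] ->
      (c e)%:~R = f (tgt e) - f (src e).
    apply: cocycle_exact => u uC _; have /liftable_F2 lu := uC.
    by apply: liftable_pairing lu; right; split=> //; exists Y.
  exists (fun v => (nat_of_ord (f v))%:Z) => e.
  have fv v : (nat_of_ord (f v))%:~R = f v by rewrite -pmulrn; apply: natr_Zp.
  have E : (c e - ((nat_of_ord (f (tgt e)))%:Z - (nat_of_ord (f (src e)))%:Z))%:~R = 0 :> 'F_2.
    by rewrite rmorphB [X in _ - X]rmorphB /= !fv fE ?inE // subrr.
  by rewrite -(@intr_Zp_eq0 2) //; apply/eqP; exact: E.
pose f v := if v \in bip then f2 v else f1 v.
pose g e := divz (c e - (f (tgt e) - f (src e))) 2.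
have gE e : c e = f (tgt e) - f (src e) + g e * 2.
  rewrite /g divzK; first by ring.
  rewrite /f -bip_closed; case: ifP => eb; first exact: f2E.
  by rewrite f1E ?inE ?eb // subrr rpred0.
have g0 e : tgt e \notin bip -> g e = 0.
  rewrite /g /f -bip_closed => /[dup] eb /negPf ->.
  by rewrite f1E ?inE // subrr div0z.
pose Nf : 'M[int]_(ne, nv) := (B int)^T *m diag_mx (\row_v f v).
pose Ng : 'M[int]_(ne, nv) := \matrix_(e, v) (g e * eps int (tgt e) * eps int v).
exists (N1 - Nf - Ng).
  move=> e; have BT v : Nf e v = ((v == src e)%:R + (v == tgt e)%:R) * f v.
    by rewrite /Nf mul_mx_diag mxE [(B int)^T e v]mxE incidenceE // mxE.
  apply/eqP; rewrite eq_sym -subr_eq0; apply/eqP.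
  transitivity (c e - (Nf e (tgt e) - Nf e (src e)) - (Ng e (tgt e) - Ng e (src e))).
    by move: Nf Ng BT => Nf Ng _; rewrite /c !mxE; ring.
  rewrite !BT !eqxx (negPf (src_tgt e)) eq_sym (negPf (src_tgt e)) !mxE eps_edge gE.
  case: (boolP (tgt e \in bip)) => eb; last by rewrite g0 //=; ring.
  have := eps_sqr int eb; set E := eps int (tgt e) => EE.
  transitivity (g e * 2 - 2 * (g e * (E * E))); first by rewrite /=; ring.
  by rewrite EE; ring.
have NgB : Ng *m B int = 0.
  apply/matrixP=> e e'; rewrite [RHS]mxE.
  have -> : (Ng *m B int) e e' = (row e Ng *m B int) 0 e' by rewrite -row_mul [RHS]mxE.
  by rewrite mul_incidence // !mxE eps_edge mulrN addNr.
have NfB : (Nf *m B int)^T = Nf *m B int.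
  by rewrite /Nf !trmx_mul trmxK tr_diag_mx mulmxA.
have -> : Y *+ 2 - (N1 - Nf - Ng) *m B int = (Y *+ 2 - N1 *m B int) + Nf *m B int.
  by rewrite !mulmxBl NgB subr0 opprB addrA addrAC.
by rewrite linearD /= symN1 NfB.
Qed.
End Torsion2.

(** * The lattice as a row space and its annihilator *)

Section TorsionRank.
Variables (nv ne : nat) (src tgt : 'I_ne -> 'I_nv).
Hypothesis src_tgt : forall e, src e != tgt e.
Notation B := (incidence src tgt).
Notation lattice := (oriented_lattice src tgt).

(** This and [end_part] are retractions onto the symmetric matrices and onto the matrices constant
    on edges. They exhibit the lattice as the image of a linear map on all integer vectors, that is,
    as the row space of a matrix. *)
Definition sym_part (W : 'M[int]_ne) : 'M[int]_ne :=
  \matrix_(i, j) (if (i <= j)%N then W i j else W j i).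

Definition end_part (N : 'M[int]_(ne, nv)) : 'M[int]_(ne, nv) :=
  \matrix_(e, v) (if v == src e then N e (tgt e) else N e v).

Lemma sym_partT W : (sym_part W)^T = sym_part W.
Proof. by apply/matrixP=> i j; rewrite !mxE; case: ltngtP => // /val_inj ->. Qed.

Lemma sym_part_id W : W^T = W -> sym_part W = W.
Proof. by move=> /matrixP Wt; apply/matrixP=> i j; rewrite mxE; case: leqP => // _; rewrite -Wt mxE. Qed.

Lemma end_part_const N : end_const src tgt (end_part N).
Proof. by move=> e; rewrite !mxE eqxx eq_sym (negPf (src_tgt e)). Qed.

Lemma end_part_id N : end_const src tgt N -> end_part N = N.
Proof. by move=> Nc; apply/matrixP=> e v; rewrite mxE; case: eqP => // ->. Qed.

Definition lattice_map (y : 'rV[int]_(ne * ne + ne * nv)) : 'rV[int]_(ne * ne) :=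
  mxvec (sym_part (vec_mx (lsubmx y)) + end_part (vec_mx (rsubmx y)) *m B int).

Lemma lattice_map_linear : linear lattice_map.
Proof.
move=> k x y; rewrite /lattice_map -linearP; congr mxvec.
have -> : sym_part (vec_mx (lsubmx (k *: x + y))) =
    k *: sym_part (vec_mx (lsubmx x)) + sym_part (vec_mx (lsubmx y)).
  by rewrite !linearP /=; apply/matrixP=> i j; rewrite !mxE; case: ifP.
have -> : end_part (vec_mx (rsubmx (k *: x + y))) =
    k *: end_part (vec_mx (rsubmx x)) + end_part (vec_mx (rsubmx y)).
  by rewrite !linearP /=; apply/matrixP=> i j; rewrite !mxE; case: ifP.
by rewrite mulmxDl -scalemxAl scalerDr addrACA.
Qed.

HB.instance Definition _ := GRing.isLinear.Build _ _ _ _ lattice_map lattice_map_linear.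

Definition lattice_mx : 'M[int]_(ne * ne + ne * nv, ne * ne) := lin1_mx lattice_map.

Lemma in_rows_lattice Y : in_rows lattice_mx (mxvec Y) <-> lattice Y.
Proof.
split=> [[y]|[N Nc symY]].
  rewrite mul_rV_lin1 /= => /(can_inj mxvecK) <-.
  exists (end_part (vec_mx (rsubmx y))); first exact: end_part_const.
  by rewrite addrK sym_partT.
exists (row_mx (mxvec (Y - N *m B int)) (mxvec N)).
rewrite mul_rV_lin1 /= /lattice_map row_mxKl row_mxKr !mxvecK sym_part_id // end_part_id //.
by rewrite subrK.
Qed.

Lemma trace_pairing (F : fieldType) (Y : 'M[int]_ne) (Om : 'M[F]_ne) :
  \sum_k (mxvec Y 0 k)%:~R * mxvec Om 0 k = \tr (Om^T *m map_mx intr Y).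
Proof.
transitivity (\sum_i \sum_j (Y i j)%:~R * Om i j); last first.
  rewrite exchange_big /=; apply: eq_bigr => j _; rewrite mxE; apply: eq_bigr => i _.
  by rewrite !mxE mulrC.
rewrite (reindex _ (curry_mxvec_bij _ _)) /= pair_bigA.
by apply: eq_bigr => [[i j] _] /=; rewrite !mxvecE.
Qed.

Lemma annihilatorP (F : fieldType) (Om : 'M[F]_ne) :
  mxvec Om *m (map_mx intr lattice_mx)^T = 0 <->
  forall Y, lattice Y -> \tr (Om^T *m map_mx intr Y) = 0.
Proof.
have key y : \sum_k ((y *m lattice_mx) 0 k)%:~R * mxvec Om 0 k =
    (map_mx intr y *m (map_mx intr lattice_mx *m (mxvec Om)^T)) 0 0.
  rewrite mulmxA -map_mxM mxE; apply: eq_bigr => k _.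
  by rewrite [map_mx _ _ _ _]mxE [(mxvec Om)^T _ _]mxE.
have trE : (mxvec Om *m (map_mx intr lattice_mx)^T)^T = map_mx intr lattice_mx *m (mxvec Om)^T.
  by rewrite trmx_mul trmxK.
split=> [ann Y /in_rows_lattice[y yY]|H].
  by rewrite -trace_pairing -yY key -trE ann trmx0 mulmx0 mxE.
apply: (can_inj trmxK); rewrite trE trmx0; apply/colP=> i.
rewrite [RHS]mxE -[RHS](H (vec_mx (delta_mx 0 i *m lattice_mx))); last first.
  by apply/in_rows_lattice; rewrite vec_mxK; exists (delta_mx 0 i).
rewrite -trace_pairing vec_mxK key [RHS]mxE (bigD1 i) //= big1 ?addr0 => [|k ki].
  have -> : map_mx intr (delta_mx 0 i : 'rV[int]_(ne * ne + ne * nv)) 0 i = 1 :> F by rewrite !mxE !eqxx.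
  by rewrite mul1r.
by rewrite !mxE (negPf ki) andbF mulr0z mul0r.
Qed.

Lemma trace_delta (F : fieldType) p q (A : 'M[F]_(p, q)) i j : \tr (A^T *m delta_mx i j) = A i j.
Proof.
rewrite /mxtrace (bigD1 j) //= big1 ?addr0 => [|k kj]; rewrite !mxE.
  rewrite (bigD1 i) //= big1 ?addr0 => [|k ki]; last by rewrite !mxE (negPf ki) mulr0.
  by rewrite !mxE !eqxx mulr1.
by rewrite big1 // => l _; rewrite !mxE (negPf kj) andbF mulr0.
Qed.

(** Symmetric test matrices make [Om] alternating, the diagonal ones being essential in
    characteristic 2. Test matrices constant on edges force row [e] of [Om *m B^T] to vanish off the
    ends of [e] and to be opposite at them, which is the shape [diag_mx u *m C^T]. *)
Lemma annihilator_form (F : fieldType) (Om : 'M[F]_ne) :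
  (forall Y, lattice Y -> \tr (Om^T *m map_mx intr Y) = 0) <-> edge_form src tgt Om.
Proof.
have map_delta p q (i : 'I_p) (j : 'I_q) : map_mx (intr : int -> F) (delta_mx i j) = delta_mx i j.
  by apply/matrixP=> k l; rewrite !mxE rmorph_nat.
split=> [H|[Oa [u OB]] Y [N Nc symY]]; last first.
  have -> : map_mx intr Y = map_mx intr (Y - N *m B int) + map_mx (intr : int -> F) N *m B F.
    by rewrite -incidence_map -map_mxM -map_mxD subrK.
  rewrite mulmxDr linearD /= alternating_sym_trace ?add0r //; last by rewrite matrix.map_trmx symY.
  rewrite (form_trace _ OB) big1 // => e _; rewrite !mxE Nc subrr mulr0 //.
have symH S : S^T = S -> \tr (Om^T *m map_mx intr S) = 0.
  move=> symS; apply: H; exists 0; first by move=> e; rewrite !mxE.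
  by rewrite mul0mx subr0.
have endH N : end_const src tgt N -> \tr ((Om *m (B F)^T)^T *m map_mx intr N) = 0.
  move=> Nc; rewrite trmx_mul trmxK -mulmxA mxtrace_mulC -mulmxA -incidence_map -map_mxM.
  by apply: H; exists N => //; rewrite subrr trmx0.
have antisym i j : Om i j + Om j i = 0.
  rewrite -[RHS](symH (delta_mx i j + delta_mx j i)); last by rewrite linearD /= !trmx_delta addrC.
  by rewrite map_mxD !map_delta mulmxDr linearD /= !trace_delta.
split.
  apply: alternatingP => [|i].
    by apply/matrixP=> i j; rewrite !mxE; apply/eqP; rewrite -addr_eq0 antisym.
  by have := symH (delta_mx i i); rewrite map_delta trace_delta; apply; rewrite trmx_delta.
exists (\row_e (Om *m (B F)^T) e (tgt e)).
have out e v : v != src e -> v != tgt e -> (Om *m (B F)^T) e v = 0.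
  move=> vs vt; have := endH (delta_mx e v); rewrite map_delta trace_delta; apply => e'.
  by rewrite !mxE ![_ == v]eq_sym; case: eqP => [->|]; rewrite ?andbF //= (negPf vs) (negPf vt).
have sum0 e : (Om *m (B F)^T) e (src e) + (Om *m (B F)^T) e (tgt e) = 0.
  rewrite -[RHS](endH (delta_mx e (src e) + delta_mx e (tgt e))) => [|e'].
    by rewrite map_mxD !map_delta mulmxDr linearD /= !trace_delta.
  rewrite !mxE; case: (eqVneq e' e) => [->|] //=.
  by rewrite !eqxx [tgt e == src e]eq_sym (negPf (src_tgt e)) addrC.
apply/matrixP=> e v; rewrite diag_coboundaryE [X in X * _]mxE.
case: (eqVneq v (tgt e)) => [->|vt].
  by rewrite eq_sym (negPf (src_tgt e)) subr0 mulr1.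
case: (eqVneq v (src e)) => [->|vs]; last by rewrite out // subrr mulr0.
by rewrite sub0r mulrN mulr1; apply/eqP; rewrite -addr_eq0 sum0.
Qed.

Lemma rank_lattice (F : fieldType) d :
  has_dim (@edge_form nv ne src tgt F) d -> (rank_over lattice_mx F + d = ne * ne)%N.
Proof.
move=> dF; rewrite /rank_over -mxrank_tr; apply: has_dim_rank.
apply: (has_dim_inj (f := mxvec)) dF => [|w]; first exact: can_inj mxvecK.
rewrite -[w]vec_mxK annihilatorP annihilator_form; split=> [fw|[Om Of /(can_inj mxvecK) <-]] //.
by exists (vec_mx w).
Qed.
End TorsionRank.

(** * The rank of the torsion *)

Lemma bin2D a b : ('C(a + b, 2) = 'C(a, 2) + 'C(b, 2) + a * b)%N.
Proof.
by elim: a => [|a IH]; [rewrite bin0n addn0 | rewrite addSn !binS !bin1 IH; lia].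
Qed.

(** With [a = ne - rq], the two binomials differ by [a * cn + 'C(cn, 2)]. The cyclomatic number of
    the graph is [a + cn], and [cn * cn] is twice ['C(cn, 2)] plus [cn]; this produces the product
    minus ['C(cn.+1, 2)]. The difference of [d2] and [dq] is the cyclomatic number of the bipartite
    part. *)
Lemma torsion_count (k nv ne R2 Rq r2 rq d2 dq cb cn eN nb : nat) :
  (k + R2 = Rq -> r2 + (cb + cn) = nv -> rq + cb = nv ->
   R2 + ('C(ne - r2, 2) + d2) = ne * ne -> Rq + ('C(ne - rq, 2) + dq) = ne * ne ->
   r2 <= ne -> rq <= ne -> d2 + nv = ne + (cb + cn) -> dq + nv = eN + (nb + cn) ->
  k%:Z = (ne%:Z - eN%:Z - nb%:Z + cb%:Z + cn%:Z * (ne%:Z - nv%:Z + (cb + cn)%N%:Z)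
    - 'C(cn.+1, 2)%:Z)%R)%N.
Proof.
move=> kE b2 bq h2 hq le2 leq d2E dqE.
have E : (ne - r2 = (ne - rq) + cn)%N by lia.
rewrite E bin2D in h2; rewrite binS bin1.
have : (cn * cn = 'C(cn, 2) + 'C(cn, 2) + cn)%N.
  elim: (cn) => // m IH; rewrite binS bin1; nia.
have : (ne - rq)%:Z = ne%:Z - nv%:Z + cb%:Z by lia.
move: (ne - rq)%N ('C(cn, 2)) ('C(_, 2)) h2 hq E => a x y h2 hq E aE ccE.
have -> : ne%:Z - nv%:Z + (cb + cn)%:Z = a%:Z + cn%:Z by lia.
nia.
Qed.

Section TorsionCount.
Variables (nv ne : nat) (src tgt : 'I_ne -> 'I_nv).
Hypothesis src_tgt : forall e, src e != tgt e.
Variables (bip : {set 'I_nv}) (col : 'I_nv -> bool).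
Hypotheses (bip_closed : forall e, (src e \in bip) = (tgt e \in bip))
  (bip_col : forall e, src e \in bip -> col (src e) != col (tgt e))
  (nbip_torsion : forall (A : zmodType) (t : 'I_nv -> A),
     (forall e, t (src e) = - t (tgt e)) -> forall v, v \notin bip -> t v + t v = 0).
Notation B := (incidence src tgt).
Local Notation nbip := (nbip_edges src bip).
Local Notation adj := (adj_in src tgt [set: 'I_ne]).

Lemma adj_in_bip S v w : adj_in src tgt S v w -> (v \in bip) = (w \in bip).
Proof. by case/exists_inP=> e _ /orP[] /andP[/eqP-> /eqP->]. Qed.

Lemma connect_bip S v w : connect (adj_in src tgt S) v w -> (v \in bip) = (w \in bip).
Proof.
move: v w; apply: (@connect_min _ _ (fun v w => (v \in bip) = (w \in bip))) => // [u v w -> //|].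
exact: adj_in_bip.
Qed.

Lemma card_eclasses_bip S (e := adj_in src tgt S) :
  (#|eclasses e| = #|eclass e @: bip| + #|eclass e @: ~: bip|)%N.
Proof.
have -> : eclasses e = eclass e @: bip :|: eclass e @: ~: bip.
  rewrite -imsetU setUCr; apply/setP=> Z; apply/imsetP/imsetP => -[x _ ->]; by exists x.
rewrite cardsU disjoint_setI0 ?cards0 ?subn0 //.
rewrite -setI_eq0; apply/eqP/setP=> Z; rewrite !inE; apply/negP=> /andP[/imsetP[v vb ->]].
case/imsetP=> w; rewrite inE => wb /eqP; rewrite eq_eclass; last exact: adj_in_sym.
by move/connect_bip; rewrite vb (negPf wb).
Qed.

(** Without the bipartite edges each bipartite vertex is a component by itself, and the other
    components are unchanged. *)
Lemma card_eclasses_nbip : (#|eclasses (adj_in src tgt nbip)| = #|bip| + #|eclass adj @: ~: bip|)%N.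
Proof.
rewrite card_eclasses_bip; congr (_ + _)%N.
  apply: card_in_imset => v w vb wb /eqP; rewrite eq_eclass; last exact: adj_in_sym.
  move=> vw; suff: v \in bip -> v = w by apply.
  move: v w vw {vb wb}; apply: (@connect_min _ _ (fun v w => v \in bip -> v = w)) => //.
    by move=> u v w uv vw ub; rewrite uv // vw // -uv.
  move=> v w /exists_inP[e]; rewrite inE => eb.
  by case/orP=> /andP[/eqP-> _]; rewrite -?bip_closed (negPf eb).
congr #|pred_of_set _|; apply: eq_in_imset => v; rewrite inE => vb.
apply/setP=> w; rewrite !inE; apply/idP/idP.
  apply: (@connect_min _ _ (fun v w => connect adj v w)) => [//|u x y|x y].
    exact: connect_trans.
  case/exists_inP=> e _ xy; apply: connect1; apply/exists_inP; exists e => //.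
move=> vw; suff: v \notin bip -> connect (adj_in src tgt nbip) v w by apply.
move: v w vw {vb}; apply: (@connect_min _ _ (fun v w => v \notin bip -> connect (adj_in src tgt nbip) v w)) => //.
  move=> u v w uv vw ub; apply: connect_trans (uv ub) (vw _).
  by rewrite -(connect_bip (uv ub)).
move=> v w /exists_inP[e _ vw] vb; apply/connect1/exists_inP; exists e => //.
by move: vb; rewrite inE; case/orP: vw => /andP[/eqP-> _]; rewrite -?bip_closed.
Qed.

Lemma rank_incidence_F2 : (\rank (B 'F_2) + #|eclasses adj| = nv)%N.
Proof.
apply: has_dim_rank.
have -> : #|eclasses adj| = #|eclass adj @: [set: 'I_nv]|.
  by congr #|pred_of_set _|; apply/setP=> Z; apply/imsetP/imsetP => -[x _ ->]; exists x.
apply: has_dim_ext (has_dim_locally_constant (adj_in_sym _ _ _) _ (fun=> oner_neq0 'F_2)); last first.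
  by move=> v w _; rewrite !inE.
have ch2 : 2%N \in [pchar 'F_2] by apply: pchar_Fp.
move=> t; split=> [[_ H]|/rowP H].
  apply/rowP=> e; rewrite mul_incidence // [RHS]mxE.
  have := H (src e) (tgt e) (in_setT _); rewrite !mul1r => -> //.
    by rewrite addrr_pchar2.
  by apply/exists_inP; exists e; rewrite ?inE // !eqxx.
split=> [v|v w _ /exists_inP[e _ vw]]; first by rewrite inE.
have := H e; rewrite mul_incidence // [RHS]mxE => /eqP.
rewrite addr_eq0 (oppr_pchar2 ch2) => /eqP te; rewrite !mul1r.
by case/orP: vw => /andP[/eqP-> /eqP->].
Qed.

(** A kernel vector is a constant times the colouring sign on each bipartite component and vanishes
    elsewhere. *)
Lemma rank_incidence_rat : (\rank (B rat) + #|eclass adj @: bip| = nv)%N.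
Proof.
apply: has_dim_rank.
have s0 v : (-1) ^+ col v != 0 :> rat by rewrite signr_eq0.
apply: has_dim_ext (has_dim_locally_constant (adj_in_sym _ _ _) _ s0); last exact: adj_in_bip.
have sE e : src e \in bip -> (-1) ^+ col (src e) = - (-1) ^+ col (tgt e) :> rat.
  by move/bip_col; case: (col _); case: (col _) => //= _; rewrite ?expr0 ?expr1 ?opprK.
move=> t; split=> [[t0 tc]|/rowP tB].
  apply/rowP=> e; rewrite mul_incidence // [RHS]mxE.
  case: (boolP (src e \in bip)) => eb; last by rewrite !t0 -?bip_closed // addr0.
  have := tc _ (tgt e) eb; rewrite sE // mulNr => H.
  apply/eqP; rewrite -(mulrI_eq0 _ (mulfI (s0 (tgt e)))) mulrDr -[X in X + _]opprK.
  rewrite H ?addNr //; apply/exists_inP; exists e; rewrite ?inE // !eqxx //.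
have tN e : t 0 (src e) = - t 0 (tgt e).
  by apply/eqP; rewrite -addr_eq0 -mul_incidence // tB mxE.
split=> [v vb|v w vb /exists_inP[e _ vw]].
  have /eqP := @nbip_torsion rat (fun v => t 0 v) tN v vb.
  by rewrite -mulr2n mulrn_eq0 => /eqP.
have eb : src e \in bip by move: vb; case/orP: vw => /andP[/eqP-> _]; rewrite ?bip_closed.
by case/orP: vw => /andP[/eqP-> /eqP->]; rewrite tN sE // mulrNN.
Qed.

Lemma oriented_torsion_rank : exists2 k : nat,
  k%:Z = ne%:Z - #|nbip|%:Z - #|bip|%:Z + #|eclass adj @: bip|%:Z
    + #|eclass adj @: ~: bip|%:Z * (ne%:Z - nv%:Z + #|eclasses adj|%:Z)
    - 'C(#|eclass adj @: ~: bip|.+1, 2)%:Z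
  & exists theta : {additive 'M[int]_ne -> 'rV['Z_2]_k},
  [/\ forall Y, oriented_lattice src tgt Y -> theta Y = 0,
      forall Y m, (0 < m)%N -> oriented_lattice src tgt (Y *+ m) -> theta Y = 0 ->
        oriented_lattice src tgt Y
    & forall w, exists Y, theta Y = w /\ oriented_lattice src tgt (Y *+ 2)].
Proof.
have tor2 x m : (0 < m)%N -> in_rows (lattice_mx src tgt) (x *+ m) -> in_rows (lattice_mx src tgt) (x *+ 2).
  have xE k : x *+ k = mxvec (vec_mx x *+ k) by rewrite raddfMn /= vec_mxK.
  rewrite !xE => m0 /(in_rows_lattice src_tgt) H; apply/(in_rows_lattice src_tgt).
  refine (oriented_lattice_torsion2 src_tgt bip_closed bip_col nbip_torsion m0 H).
have [k kE [theta [th0 thker thsurj]]] := elementary_torsion tor2; exists k.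
  have [d2 dim2 d2E] := has_dim_cycles src tgt [set: 'I_ne] 'F_2.
  have [dq dimq dqE] := has_dim_cycles src tgt nbip rat.
  have lift2 : has_dim (liftable src tgt (F:='F_2)) d2.
    apply: has_dim_ext dim2 => u; rewrite (liftable_F2 src_tgt); split=> [[] //|uC]; split=> // e.
    by rewrite inE.
  have liftq : has_dim (liftable src tgt (F:=rat)) dq.
    apply: has_dim_ext dimq => u; rewrite (liftable_rat src_tgt bip_closed bip_col nbip_torsion) //.
  have r2 := rank_lattice src_tgt (has_dim_forms src_tgt lift2).
  have rq := rank_lattice src_tgt (has_dim_forms src_tgt liftq).
  have b2 := rank_incidence_F2; have bq := rank_incidence_rat.
  have le2 := rank_leq_col (B 'F_2); have leq := rank_leq_col (B rat).
  rewrite card_eclasses_nbip in dqE; rewrite cardsT card_ord in d2E.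
  rewrite card_eclasses_bip in b2 d2E *.
  exact: torsion_count kE b2 bq r2 rq le2 leq d2E dqE.
have thA : zmod_morphism (theta \o mxvec) by move=> x y; rewrite /= !raddfB.
pose thM := GRing.isZmodMorphism.Build _ _ (theta \o mxvec) thA.
pose Theta : {additive 'M[int]_ne -> 'rV['Z_2]_k} := HB.pack (theta \o mxvec) thM.
exists Theta; split=> [Y /(in_rows_lattice src_tgt)|Y m m0 /(in_rows_lattice src_tgt)|w].
- exact: th0.
- by rewrite raddfMn => H /(thker _ _ m0 H)/(in_rows_lattice src_tgt).
have [x [<- xw]] := thsurj w; exists (vec_mx x); rewrite /= vec_mxK; split=> //.
by apply/(in_rows_lattice src_tgt); rewrite raddfMn /= vec_mxK.
Qed.
End TorsionCount.

(** * Components *)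

Lemma eq_set2 (T : finType) (x y a b : T) : [set x; y] = [set a; b] ->
  x = a /\ y = b \/ x = b /\ y = a.
Proof.
move=> E; have /set2P[xa|xb]: x \in [set a; b] by rewrite -E set21.
  left; split=> //; have /set2P[|//] : y \in [set a; b] by rewrite -E set22.
  by have /set2P[] : b \in [set x; y]; rewrite ?E ?set22 // xa => -> ->.
right; split=> //; have /set2P[//|yb] : y \in [set a; b] by rewrite -E set22.
by have /set2P[] : a \in [set x; y]; rewrite ?E ?set21 // xb yb => ->.
Qed.

Section Components.
Variables (T : finType) (G : graph T).

Lemma adj_connect_sym : connect_sym (adj G).
Proof. by apply: sym_connect_sym => x y; rewrite /adj setUC. Qed.

Lemma cover_bip_components x : x \in verts G ->
  (x \in cover (bip_components G)) = bipartite (induced G (eclass (adj G) x)).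
Proof.
move=> xG; apply/bigcupP/idP => [[K]|b]; last first.
  exists (eclass (adj G) x); last by rewrite inE.
  by rewrite inE b andbT; apply/imsetP; exists x.
rewrite inE => /andP[/imsetP[y yG ->] b]; rewrite inE => yx; move: b.
have /eqP -> // : eclass (adj G) x == [set z | connect (adj G) y z].
by rewrite eq_sym (eq_eclass _ _ adj_connect_sym).
Qed.

Lemma bip_components_imset :
  bip_components G = eclass (adj G) @: (verts G :&: cover (bip_components G)).
Proof.
apply/setP=> K; apply/idP/imsetP => [|[x /setIP[xG]]].
  rewrite inE => /andP[/imsetP[x xG KE] b]; exists x => //.
  by rewrite !inE xG cover_bip_components //= -[eclass _ _]KE.
by rewrite cover_bip_components // => b ->; rewrite inE b andbT; apply/imsetP; exists x.
Qed.

Lemma nonbip_components_imset :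
  nonbip_components G = eclass (adj G) @: (verts G :\: cover (bip_components G)).
Proof.
apply/setP=> K; apply/idP/imsetP => [|[x /setDP[xG]]].
  rewrite inE => /andP[/imsetP[x xG KE] b]; exists x => //.
  by rewrite !inE xG cover_bip_components //= -[eclass _ _]KE andbT.
by rewrite cover_bip_components // => b ->; rewrite inE b andbT; apply/imsetP; exists x.
Qed.

(** Bipartiteness depends only on the component, so a path that starts in the bipartite part stays
    in it and survives in the induced subgraph. *)
Lemma components_bip_part : 
  (forall x y, adj G x y -> (x \in verts G) && (y \in verts G)) ->
  components (bip_part G) = bip_components G.
Proof.
move=> adjG; rewrite [RHS]bip_components_imset; apply: eq_in_imset => x /setIP[xG xb].
apply/setP=> y; rewrite !inE; apply/idP/idP.
  move: x y {xG xb}; apply: connect_min => [//|x y z|x y]; first exact: connect_trans.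
  by rewrite /adj inE => /andP[xy _]; exact: connect1.
move=> xy; suff: x \in verts G :&: cover (bip_components G) -> connect (adj (bip_part G)) x y.
  by apply; rewrite inE xG.
suff: x \in verts G :&: cover (bip_components G) ->
  y \in verts G :&: cover (bip_components G) /\ connect (adj (bip_part G)) x y.
  by move=> H /H[].
move: x y xy {xG xb}; apply: (@connect_min _ _ (fun x y => x \in verts G :&: cover (bip_components G) ->
  y \in verts G :&: cover (bip_components G) /\ connect (adj (bip_part G)) x y)) => [//|x y z xy yz|x y xy].
  by move=> /xy[/yz[zb cyz] cxy]; split=> //; apply: connect_trans cyz.
case/setIP=> xG xb; have /andP[_ yG] := adjG _ _ xy.
have yb : y \in cover (bip_components G).
  move: xb; rewrite !cover_bip_components //.
  have /eqP -> // : eclass (adj G) x == eclass (adj G) y.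
  by rewrite (eq_eclass _ _ adj_connect_sym) connect1.
split; first by rewrite inE yG.
apply: connect1; rewrite /adj inE; apply/andP; split=> //.
by apply/subsetP=> z /set2P[]->.
Qed.
End Components.

(** * Translation between indices and the graph *)

Section GraphTorsion.
Variables (T : finType) (G : graph T).
Local Notation nv := #|verts G|.
Local Notation ne := #|edges G|.
Local Notation bips := (cover (bip_components G)).
Variables src tgt : 'I_ne -> 'I_nv.
Hypotheses (src_tgt : forall e, src e != tgt e)
  (edgE : forall e, edg e = [set vtx (src e); vtx (tgt e)]).
Local Notation ladj := (adj_in src tgt [set: 'I_ne]).

Lemma vtx_inj : injective (@vtx T G).
Proof. exact: enum_val_inj. Qed.

Lemma vtx_verts v : @vtx T G v \in verts G.
Proof. exact: enum_valP. Qed.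

Lemma vtx_onto x : x \in verts G -> exists v : 'I_nv, x = vtx v.
Proof. by move=> xG; exists (enum_rank_in xG x); rewrite /vtx enum_rankK_in. Qed.

Lemma edg_onto P : P \in edges G -> exists e : 'I_ne, P = edg e.
Proof. by move=> PG; exists (enum_rank_in PG P); rewrite /edg enum_rankK_in. Qed.

Lemma vtx_edg v e : (vtx v \in edg e) = (v == src e) || (v == tgt e).
Proof. by rewrite edgE !inE !(inj_eq vtx_inj). Qed.

Lemma adjP x y : adj G x y -> exists v w, [/\ x = vtx v, y = vtx w & ladj v w].
Proof.
move/edg_onto=> [e]; rewrite edgE => /eq_set2[] [-> ->]; [exists (src e), (tgt e) | exists (tgt e), (src e)];
  split=> //; apply/exists_inP; exists e; rewrite ?inE // !eqxx ?orbT //.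
Qed.

Lemma ladj_adj v w : ladj v w -> adj G (vtx v) (vtx w).
Proof.
case/exists_inP=> e _ vw; suff: [set vtx v; vtx w] = edg e by rewrite /adj => ->; exact: enum_valP.
by case/orP: vw => /andP[/eqP-> /eqP->]; rewrite edgE // setUC.
Qed.

Lemma eclass_vtx v : eclass (adj G) (vtx v) = @vtx T G @: eclass ladj v.
Proof.
apply/setP=> y; rewrite inE; apply/idP/imsetP.
  suff H x : connect (adj G) x y -> forall v, x = vtx v -> exists2 w, w \in eclass ladj v & y = vtx w.
    by move=> /H/(_ v erefl).
  move=> xy {v}; move: x y xy; apply: connect_min => [x v ->|x y z xy yz v /xy[w]|x y xy v xv].
  - by exists v; rewrite ?inE.
  - rewrite inE => vw /yz[u]; rewrite inE => wu ->; exists u => //.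
    by rewrite inE; apply: connect_trans wu.
  have [v' [w [xv' -> vw]]] := adjP xy; exists w => //.
  by rewrite inE; apply: connect1; move: xv'; rewrite xv => /vtx_inj ->.
case=> w; rewrite inE => vw ->; move: v w vw; apply: (@connect_min _ _ (fun v w => connect (adj G) (vtx v) (vtx w))).
- by move=> v.
- by move=> u v w; exact: connect_trans.
by move=> v w /ladj_adj/connect1.
Qed.

Lemma card_eclass_vtx (A : {set 'I_nv}) :
  #|eclass (adj G) @: (@vtx T G @: A)| = #|eclass ladj @: A|.
Proof.
rewrite -imset_comp (eq_imset _ (_ : _ =1 (fun K : {set 'I_nv} => @vtx T G @: K) \o eclass ladj)).
  by rewrite imset_comp card_imset //; apply: imset_inj vtx_inj.
by move=> v; rewrite /= eclass_vtx.
Qed.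

Definition bip_vtx : {set 'I_nv} := [set v | vtx v \in bips].

Lemma vtx_bip : @vtx T G @: bip_vtx = verts G :&: bips.
Proof.
apply/setP=> x; apply/imsetP/setIP => [[v]|[xG xb]].
  by rewrite inE => vb ->; rewrite vtx_verts.
by have [v xv] := vtx_onto xG; exists v; rewrite ?inE -?xv.
Qed.

Lemma vtx_nbip : @vtx T G @: (~: bip_vtx) = verts G :\: bips.
Proof.
apply/setP=> x; apply/imsetP/setDP => [[v]|[xG xb]].
  by rewrite !inE => vb ->; rewrite vtx_verts.
by have [v xv] := vtx_onto xG; exists v; rewrite ?inE -?xv.
Qed.

Lemma card_components : #|components G| = #|eclasses ladj|.
Proof.
have -> : eclasses ladj = eclass ladj @: [set: 'I_nv].
  by apply/setP=> Z; apply/imsetP/imsetP => -[x _ ->]; exists x.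
rewrite -card_eclass_vtx; congr #|pred_of_set _|; congr (imset _ (mem (pred_of_set _))).
apply/setP=> x; apply/idP/imsetP=> [/vtx_onto[v ->]|[v _ ->]]; last exact: vtx_verts.
by exists v.
Qed.

Lemma src_adj e : adj G (vtx (src e)) (vtx (tgt e)).
Proof. by apply: ladj_adj; apply/exists_inP; exists e; rewrite ?inE // !eqxx. Qed.

Lemma adj_vertsE x y : adj G x y -> (x \in verts G) && (y \in verts G).
Proof. by move/adjP=> [v [w [-> -> _]]]; rewrite !vtx_verts. Qed.

Lemma eclass_src e : eclass (adj G) (vtx (src e)) = eclass (adj G) (vtx (tgt e)).
Proof. by apply/eqP; rewrite eq_eclass ?connect1 ?src_adj //; apply: adj_connect_sym. Qed.

Lemma bip_vtx_closed e : (src e \in bip_vtx) = (tgt e \in bip_vtx).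
Proof. by rewrite !inE !cover_bip_components ?vtx_verts // eclass_src. Qed.

(** A choice depending on the graph alone, so that adjacent vertices, which have the same component,
    consult the same colouring. The default [set0] concerns only graphs that are not bipartite. *)
Definition colouring (H : graph T) : {set T} := odflt set0 [pick S : {set T} |
  [forall x, forall y, adj H x y ==> ((x \in S) != (y \in S))]].

Lemma colouringP H x y : bipartite H -> adj H x y -> (x \in colouring H) != (y \in colouring H).
Proof.
move=> /existsP[S HS] xy; rewrite /colouring; case: pickP => [S' /= /forallP/(_ x)/forallP/(_ y)|/(_ S)].
  by rewrite xy.
by rewrite HS.
Qed.

Definition bip_col (v : 'I_nv) : bool := vtx v \in colouring (induced G (eclass (adj G) (vtx v))).

Lemma bip_colP e : src e \in bip_vtx -> bip_col (src e) != bip_col (tgt e).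
Proof.
rewrite !inE cover_bip_components ?vtx_verts // => b.
rewrite /bip_col -eclass_src; apply: colouringP b _.
rewrite /adj inE [_ \in edges G]src_adj /=; apply/subsetP=> z /set2P[]->; rewrite inE //.
exact: connect1 (src_adj e).
Qed.

(* If t v + t v <> 0, then the level set of t at t v is one side of a
   bipartition of the component of v. *)
Lemma alternating_torsion (A : zmodType) (t : 'I_nv -> A) :
  (forall e, t (src e) = - t (tgt e)) -> forall v, v \notin bip_vtx -> t v + t v = 0.
Proof.
move=> tN v; rewrite inE cover_bip_components ?vtx_verts // => nb.
apply/eqP; apply: contraNT nb => tv.
have tadj a b : ladj a b -> t a = - t b.
  by case/exists_inP=> e _ /orP[] /andP[/eqP-> /eqP->]; rewrite tN ?opprK.
have tpm w : connect ladj v w -> t w = t v \/ t w = - t v.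
  move: w; suff H u w : connect ladj u w -> t w = t u \/ t w = - t u by move=> w /H.
  move: u w; apply: connect_min => [u|a b c ab bc|a b ab]; first by left.
    by case: bc => ->; case: ab => ->; rewrite ?opprK; auto.
  by right; rewrite (tadj _ _ ab) opprK.
apply/existsP; exists (@vtx T G @: [set w | t w == t v]).
apply/forallP=> x; apply/forallP=> y; apply/implyP; rewrite /adj inE => /andP[/adjP[a [b [-> -> ab]]]].
move=> /subsetP/(_ (vtx a) (set21 _ _)); rewrite eclass_vtx !(mem_imset _ _ vtx_inj) !inE => va.
rewrite (tadj _ _ ab); have : t b = t v \/ t b = - t v.
  apply: tpm; apply: connect_trans va (connect1 ab).
have tv' : (- t v == t v) = false by apply/negP; rewrite eq_sym -addr_eq0; apply/negP.
by case=> ->; rewrite ?opprK eqxx tv'.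
Qed.

Lemma inc_mxE (R : pzRingType) : inc_mx G R = incidence src tgt R.
Proof. by apply/matrixP=> v e; rewrite mxE vtx_edg [RHS]mxE. Qed.

Lemma in_lattice_oriented Y : in_lattice Y <-> oriented_lattice src tgt Y.
Proof.
split=> -[N Nc NY]; exists N; rewrite ?inc_mxE // in NY *.
  by move=> e; apply: Nc; rewrite vtx_edg eqxx ?orbT.
by move=> e v w; rewrite !vtx_edg => /orP[]/eqP-> /orP[]/eqP->.
Qed.

Lemma card_bip_edges : (#|edges (bip_part G)| + #|nbip_edges src bip_vtx| = ne)%N.
Proof.
have -> : edges (bip_part G) = @edg T G @: (~: nbip_edges src bip_vtx).
  apply/setP=> P; apply/idP/imsetP => [|[e]].
    rewrite inE => /andP[/edg_onto[e ->] /subsetP sub]; exists e => //.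
    by rewrite !inE negbK; apply: sub; rewrite edgE set21.
  rewrite !inE negbK => eb ->; rewrite enum_valP edgE; apply/subsetP=> z /set2P[]-> //.
  by have := bip_vtx_closed e; rewrite !inE eb.
rewrite card_imset; last exact: enum_val_inj.
by rewrite addnC cardsC card_ord.
Qed.

Lemma oriented_graph_torsion_rank : exists2 k : nat,
  k%:Z = cyclomatic (bip_part G) + #|nonbip_components G|%:Z * cyclomatic G
    - 'C(#|nonbip_components G|.+1, 2)%:Z & torsion_rank G k.
Proof.
have [k kE [theta [th0 thker thsurj]]] :=
  oriented_torsion_rank src_tgt bip_vtx_closed bip_colP alternating_torsion.
exists k; last first.
  exists theta; split=> [Y /in_lattice_oriented|Y m m0 /in_lattice_oriented|w]; first exact: th0.
    by move=> H /(thker _ _ m0 H)/in_lattice_oriented.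
  have [Y [<- Yw]] := thsurj w; exists Y; split=> //; exists 2%N => //; exact/in_lattice_oriented.
rewrite kE /cyclomatic (components_bip_part adj_vertsE) card_components.
rewrite [in RHS]bip_components_imset nonbip_components_imset -vtx_bip -vtx_nbip !card_eclass_vtx.
congr (_ + _ - _).
rewrite [verts (bip_part G)](_ : _ = verts G :&: bips) // -vtx_bip (card_imset _ vtx_inj).
by congr (_ - _ + _); rewrite -[X in X%:Z - _]card_bip_edges PoszD addrK.
Qed.
End GraphTorsion.

Lemma graph_torsion_rank (T : finType) (G : graph T) : simple_graph G -> exists2 k : nat,
  k%:Z = cyclomatic (bip_part G) + #|nonbip_components G|%:Z * cyclomatic G
    - 'C(#|nonbip_components G|.+1, 2)%:Z & torsion_rank G k.
Proof.
move=> Gs; have ends e : exists p : 'I_#|verts G| * 'I_#|verts G|,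
    p.1 != p.2 /\ @edg T G e = [set vtx p.1; vtx p.2].
  have [x [y [xy xG yG eE]]] := Gs _ (enum_valP e).
  have [v vx] := vtx_onto xG; have [w wy] := vtx_onto yG.
  exists (v, w); rewrite /edg eE /= -vx -wy; split=> //.
  by apply: contra xy => /eqP vw; rewrite vx wy vw.
have [p pE] := fin_all_exists ends.
apply: (@oriented_graph_torsion_rank _ _ (fun e => (p e).1) (fun e => (p e).2)) => e; by case: (pE e).
Qed.

(** * Connected graphs *)

Section Connected.
Variables (T : finType) (G : graph T).

Lemma bipartite_odd_cycle : has_odd_cycle G -> ~~ bipartite G.
Proof.
case=> -[|x p] [] // /andP[xp _] _ op; apply/negP=> /existsP[S /forallP HS].
have alt q y : path (adj G) y q -> (last y q \in S) = (y \in S) (+) odd (size q).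
  elim: q y => [|z q IH] y /=; first by rewrite addbF.
  case/andP=> yz /IH ->; have := HS y => /forallP/(_ z); rewrite yz /=.
  by case: (y \in S); case: (z \in S); case: (odd _).
by have := alt _ _ xp; rewrite last_rcons size_rcons; move: op => /= ->; case: (x \in S).
Qed.

Hypotheses (simpleG : simple_graph G) (connG : connected G).

Lemma components1 : exists2 K : {set T}, components G = [set K] & verts G \subset K.
Proof.
have /cards1P[K KE] := connG; exists K => //; apply/subsetP=> x xG.
have : [set y | connect (adj G) x y] \in components G by apply/imsetP; exists x.
by rewrite KE inE => /eqP <-; rewrite inE.
Qed.

Lemma sub_edges (K : {set T}) P : verts G \subset K -> P \in edges G -> P \subset K.
Proof.
move=> /subsetP VK /simpleG[x [y [_ xG yG ->]]].
by apply/subsetP=> z /set2P[]->; apply: VK.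
Qed.

Lemma bipartite_induced (K : {set T}) : verts G \subset K -> bipartite (induced G K) = bipartite G.
Proof.
move=> VK; apply: eq_existsb => S; apply: eq_forallb => x; apply: eq_forallb => y.
rewrite /adj inE; case: (boolP (_ \in edges G)) => //= xy.
by rewrite (sub_edges VK xy).
Qed.

Lemma bip_components_connected : bip_components G = if bipartite G then components G else set0.
Proof.
have [K KE VK] := components1; apply/setP=> L; rewrite inE KE inE.
have [->|LK] := eqVneq L K; first by rewrite bipartite_induced //; case: ifP; rewrite !inE ?eqxx.
by case: ifP; rewrite !inE // (negPf LK).
Qed.

Lemma nonbip_components_connected : nonbip_components G = if bipartite G then set0 else components G.
Proof.
have [K KE VK] := components1; apply/setP=> L; rewrite inE KE inE.
have [->|LK] := eqVneq L K; first by rewrite bipartite_induced //; case: ifP; rewrite !inE ?eqxx.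
by case: ifP; rewrite !inE // (negPf LK).
Qed.

Lemma cyclomatic_bip_part_connected :
  cyclomatic (bip_part G) = if bipartite G then cyclomatic G else 0.
Proof.
have [K KE VK] := components1.
have adjG x y : adj G x y -> (x \in verts G) && (y \in verts G).
  by rewrite /adj => /simpleG[a [b [_ aG bG /eq_set2[] [-> ->]]]]; rewrite aG bG.
rewrite /cyclomatic (components_bip_part adjG) bip_components_connected /bip_part /= bip_components_connected.
case: ifP => _.
  rewrite KE /cover big_set1 (setIidPl VK).
  have -> // : [set e in edges G | e \subset K] = edges G.
  by apply/setP=> P; rewrite inE; case: (boolP (P \in edges G)) => //= /(sub_edges VK) ->.
rewrite /cover big_set0 setI0.
have -> : [set e in edges G | e \subset set0] = set0.
  apply/setP=> P; rewrite !inE; apply/negP=> /andP[/simpleG[x [y [_ _ _ ->]]]].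
  by move=> /subsetP/(_ x (set21 _ _)); rewrite inE.
by rewrite !cards0.
Qed.
End Connected.

Theorem proposition4p8 (D : link_diagram) (D_adequate : plus_adequate D) :
  let n := (ncross D)%:Z in
  let G' := simplify (state_graph (splus D)) in
  let H := khovanov D (n - 4) (n + 2 * #|circles (splus D)|%:Z - 8) in
  let p0nbi := #|nonbip_components G'| in
  (connected G' ->
    (has_odd_cycle G' -> isog_Z2_pow (tor H) (cyclomatic G' - 1)) /\
    (bipartite G' -> isog_Z2_pow (tor H) (cyclomatic G'))) /\
  isog_Z2_pow (tor H)
    (cyclomatic (bip_part G') + p0nbi%:Z * cyclomatic G'
     - 'C(p0nbi.+1, 2)%:Z).
Proof.
move=> n G' H p0nbi; have simpleG := state_graph_simple D_adequate.
have [k kE /(tor_khovanov D_adequate) phi] := graph_torsion_rank simpleG.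
have torH : isog_Z2_pow (tor H) (cyclomatic (bip_part G') + p0nbi%:Z * cyclomatic G'
    - 'C(p0nbi.+1, 2)%:Z) by exists k.
split=> // connG; move: torH.
(* For connected [G'] the number [p0nbi] is 0 or 1. In the second case the bipartite part is empty
   and ['C(2, 2) = 1] is subtracted from the cyclomatic number. *)
rewrite /p0nbi (cyclomatic_bip_part_connected simpleG) // nonbip_components_connected //.
split=> [/bipartite_odd_cycle nb|b].
  by move: torH; rewrite (negPf nb) (eqP connG) add0r mul1r.
by move: torH; rewrite b cards0 mul0r addr0 subr0.
Qed.
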